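(* Fix $d\ge 3$, and let $S$ be a finite set and $M:S\times S\to\mathbb N\cup\{0\}$ such that $\sum_{q\in S}M(s,q)=d$ holds for every $s\in S$ and the weighted directed graph with adjacency matrix $M$ is connected. Let $$\varepsilon_0=\inf\left\{\varepsilon>0:\ \frac12\left(\delta(M,\varepsilon)^d-\varepsilon\right)\le\sqrt{\varepsilon\,\log|S|\,\frac{d-1}{d-2}}\right\},$$ where $\delta(M,\varepsilon)>0$ is the lower bound described in the context. Then for every $0<\varepsilon<\varepsilon_0$ the probability $\mathbb P(c(\mathbb G_i,M)<\varepsilon)$ converges to $0$ as $i\to\infty$, where $\mathbb G_i$ is a random $d$-regular graph on $i$ vertices and $c(\cdot,M)$ is the covering error ratio with respect to $M$.
   Context: Random $d$-regular graphs are chosen uniformly; if $d$ and $i$ are both odd there are no such graphs and statements are understood to hold trivially. Covering: for a $d$-regular (not necessarily finite) graph $G=(V,E)$ and a function $f:V\to S$, $f$ is a covering at $v\in V$ if $|\{w\in N(v): f(w)=q\}|=M(f(v),q)$ for every $q\in S$, where $N(v)$ is the set of neighbors of $v$. Covering error ratio: for a finite $d$-regular graph $G=(V,E)$ and $g:V\to S$, let $W\subseteq V$ be the set of vertices at which $g$ is not a covering, and $e(g)=|W|/|V|$. Then $c(G,M)=\min_{g:V\to S}e(g)$. The quantity $\delta(M,\varepsilon)$: let $T_d$ be the infinite $d$-regular tree with root $o$, and let $I_d(S)$ be the set of $\mathrm{Aut}(T_d)$-invariant Borel probability measures on $S^{V(T_d)}$. For $\varepsilon\ge 0$, $\delta(M,\varepsilon)>0$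 denotes a number, whose existence the paper asserts in a preceding lemma, with the following property: whenever $\mu\in I_d(S)$ is such that a $\mu$-random function $f:V(T_d)\to S$ is a covering at $o$ with probability $1-\varepsilon$ and the distribution of $f(o)$ is supported on at least two elements, then $\mathbb P(f(o)=s)\ge\delta(M,\varepsilon)$ for all $s\in S$.
   Formalization: S is assumed to have at least two elements (for |S|=1 the property of δ is vacuous and the claim fails with δ=1), and δ(M,ε) is taken to be 0 for those ε where no positive lower bound exists, e.g. ε=1 with mixtures of constant labelings. *)

(* Defs.v *)
From HB Require Import structures.
From mathcomp Require Import all_boot all_order all_algebra.
From mathcomp Require Import all_classical all_reals all_analysis.

Set Implicit Arguments.
Unset Strict Implicit.
Unset Printing Implicit Defensive.

Import Order.TTheory GRing.Theory Num.Theory.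
Import numFieldNormedType.Exports.

Local Open Scope classical_set_scope.
Local Open Scope ring_scope.

(* Connectivity is that of the underlying undirected graph (directions of the
   arcs are ignored); in particular it is implied by strong connectivity. *)
Definition digraph_connected (S : finType) (M : S -> S -> nat) : Prop :=
  forall s q : S,
    connect (fun a b => (0 < M a b)%N || (0 < M b a)%N) s q.

Definition covering_at (V : Type) (adj : rel V) (S : Type) (M : S -> S -> nat)
    (f : V -> S) (v : V) : Prop :=
  forall q : S, ([set w | adj v w /\ f w = q] #= `I_(M (f v) q))%card.

Section ErrorRatio.
Context {R : realType}.

Definition error (V : finType) (adj : rel V) (S : finType) (M : S -> S -> nat)
    (g : {ffun V -> S}) : R :=
  #|[set v : V | `[< ~ covering_at adj M g v >]]%SET|%:R / #|V|%:R.

(* Every error is at most 1, so the default value 1 does not affect the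
   minimum. *)
Definition covering_error_ratio (V : finType) (adj : rel V) (S : finType)
    (M : S -> S -> nat) : R :=
  \big[Num.min/1]_(g : {ffun V -> S}) error adj M g.

End ErrorRatio.

Definition edge_rel (n : nat) (E : {set 'I_n * 'I_n}) : rel 'I_n :=
  fun x y => (x, y) \in E.

(* Simple d-regular graphs on the labelled vertex set 'I_n, each graph being
   given by its symmetric irreflexive set of ordered adjacent pairs. *)
Definition regular_graphs (d n : nat) : {set {set 'I_n * 'I_n}} :=
  [set E : {set 'I_n * 'I_n} |
    [&& [forall x, forall y, edge_rel E x y == edge_rel E y x],
        [forall x, ~~ edge_rel E x x] &
        [forall x, #|[set y | edge_rel E x y]| == d]]]%SET.

(* The probability that c(G, M) < eps for a uniform d-regular graph G on n
   vertices; when there is no such graph this is 0 / 0 = 0. *)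
Definition prob_ratio_lt {R : realType} (d : nat) (S : finType)
    (M : S -> S -> nat) (eps : R) (n : nat) : R :=
  #|[set E in regular_graphs d n |
      covering_error_ratio (edge_rel E) M < eps]%SET|%:R
  / #|regular_graphs d n|%:R.

(* The d-regular tree as the Cayley graph of the free product of d copies of
   Z/2: vertices are the words over 'I_d without two equal consecutive letters,
   and the parent of i :: w is w. *)
Definition tree (d : nat) : Type :=
  {w : seq 'I_d | sorted (fun i j => i != j) w}.

Definition tree_root (d : nat) : tree d := exist _ [::] isT.

Definition tree_parent (d : nat) (x y : tree d) : bool :=
  [exists i : 'I_d, sval y == i :: sval x].

Definition tree_adj (d : nat) : rel (tree d) :=
  fun x y => tree_parent x y || tree_parent y x.

Definition tree_automorphism (d : nat) (phi : tree d -> tree d) : Prop :=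
  bijective phi /\ forall x y, tree_adj (phi x) (phi y) = tree_adj x y.

(* S^V(T_d) with the product topology, S being discrete. The label s0 is only
   the witness of inhabitation that measurable spaces require. *)
Definition labeling (d : nat) (S : finType) (s0 : S) : Type :=
  {ptws tree d -> discrete_topology S}.

HB.instance Definition _ (d : nat) (S : finType) (s0 : S) :=
  Topological.copy (labeling d s0) {ptws tree d -> discrete_topology S}.
HB.instance Definition _ (d : nat) (S : finType) (s0 : S) :=
  isPointed.Build (labeling d s0) (fun=> s0).

Definition borel_labeling (d : nat) (S : finType) (s0 : S) :=
  g_sigma_algebraType (@open (labeling d s0)).

Section Delta.
Context {R : realType} (d : nat) (S : finType) (M : S -> S -> nat).

Definition invariant_measure (s0 : S) (mu : probability (borel_labeling d s0) R)
    : Prop :=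
  forall phi : tree d -> tree d, tree_automorphism phi ->
  forall A : set (borel_labeling d s0), measurable A ->
    mu ((fun f : borel_labeling d s0 => f \o phi) @^-1` A) = mu A.

Definition delta_property (eps x : R) : Prop :=
  forall (s0 : S) (mu : probability (borel_labeling d s0) R),
    invariant_measure mu ->
    mu [set f | covering_at (@tree_adj d) M f (tree_root d)] = (1 - eps)%:E ->
    (exists s t : S, [/\ s <> t,
        (0 < mu [set f | f (tree_root d) = s])%E &
        (0 < mu [set f | f (tree_root d) = t])%E]) ->
    forall s : S, (x%:E <= mu [set f | f (tree_root d) = s])%E.

(* delta eps is an arbitrary positive number with the defining property
   whenever there is one. There need not be one for large eps: mixtures of
   constant labelings with labels s such that M s s != d have eps = 1 and
   arbitrarily small marginals. Then only the trivial lower bound 0 is left,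
   and such an eps belongs to the set in eps0. *)
Definition is_delta (delta : R -> R) : Prop :=
  forall eps : R, 0 <= eps ->
    (0 < delta eps /\ delta_property eps (delta eps)) \/
    (delta eps = 0 /\ ~ exists x : R, 0 < x /\ delta_property eps x).

Definition eps0 (delta : R -> R) : R :=
  inf [set eps : R | 0 < eps /\
    2^-1 * (delta eps ^+ d - eps) <=
      Num.sqrt (eps * ln (#|S|%:R) * ((d%:R - 1) / (d%:R - 2)))].

End Delta.

(* Main.v *)
(* Composing a labeling g of a finite d-regular graph with a uniformly random
   covering map from T_d onto the graph gives an invariant process on T_d, whose
   probability of covering at the root is 1 - e(g) and whose marginals are the
   label densities of g. Hence delta bounds these densities from below.

   In the configuration model (a random perfect matching of the n * d
   half-edges) the expected number of labelings with prescribed empirical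
   distributions of stars and of edges is, up to a polynomial factor,
   exp(n (H(star) - d/2 H(edge))). If few stars fail to be coverings, one label
   of a star is nearly determined by the others; by Fano's inequality, and by
   comparing the remaining labels with the Markov and with the independent law
   by means of Gibbs' inequality, the exponent is at most -c n for some c > 0,
   as soon as the error is below eps0. A first moment bound then concludes for
   random configurations. Simple configurations form at least a polynomial
   fraction of all configurations, since switchings repair the few loops and
   multiple edges one at a time, and they project uniformly to regular graphs. *)
Require Import Defs.
From HB Require Import structures.
From mathcomp Require Import all_boot all_order fingroup perm all_algebra.
From mathcomp Require Import all_classical all_reals all_analysis.
From mathcomp Require Import zify ring lra.

Set Implicit Arguments.
Unset Strict Implicit.
Unset Printing Implicit Defensive.

Import Order.TTheory GRing.Theory Num.Theory.
Import numFieldNormedType.Exports.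

(** * Vertices and automorphisms of the regular tree *)

(** The property of [delta] concerns one exact error, and nothing relates its values at different
    errors. It is therefore applied at x = e(g) itself, where failure of the condition in [eps0]
    gives x + 2 sqrt(x L) < delta(x)^d with L = log|S| (d-1)/(d-2). At a fixed x > 0 this makes the
    entropy gain, of order sqrt(x L), beat the Fano loss; but that gap tends to 0 with x, and x = 0
    is not covered. An exponent uniform in the graph needs a second regime: for tiny errors the
    densities are bounded below by following arcs of [M]. Since connectivity ignores directions, the
    support of [M] must first be shown symmetric, which follows from the existence of one labeling
    with error below [eps0]. L arises from weighting the Markov law by d and the independent law by
    d - 2, the proportion in which the vertex entropies cancel. Dividing by 2(d-1) leaves the factor
    (d-2)/(2(d-1)), whose product with L is log|S|/2. Labelings that are constant, or perfect but
    miss a label, are excluded by applying the property of [delta] to disjoint unions of copies of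
    the graph. *)

Section Tree.
Variable d : nat.
Notation tr := (tree d).

HB.instance Definition _ := Countable.copy tr
  {w : seq 'I_d | sorted (fun i j => i != j) w}.

Definition len (x : tr) : nat := size (sval x).

Lemma sorted_behead (w : seq 'I_d) :
  sorted (fun i j => i != j) w -> sorted (fun i j => i != j) (behead w).
Proof. by case: w => //= i w /path_sorted. Qed.

Definition parent (x : tr) : tr := exist _ (behead (sval x)) (sorted_behead (svalP x)).

Lemma tree_parentP (x y : tr) : reflect (x = parent y /\ 0 < len y) (tree_parent x y).
Proof.
apply: (iffP existsP) => [[i /eqP E]|[-> ]]; last first.
  by rewrite /len /=; case: (sval y) => // i w _; exists i.
by split; [apply: val_inj; rewrite /= E | rewrite /len E].
Qed.

Lemma tree_adjC (x y : tr) : tree_adj x y = tree_adj y x.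
Proof. by rewrite /tree_adj orbC. Qed.

Lemma len_parent (y : tr) : len (parent y) = (len y).-1.
Proof. by rewrite /len size_behead. Qed.

Lemma tree_adj_irr (x : tr) : tree_adj x x = false.
Proof.
by rewrite /tree_adj orbb; apply/tree_parentP => -[/(congr1 len)]; rewrite len_parent; lia.
Qed.

Lemma len0 (x : tr) : len x = 0 -> x = tree_root d.
Proof. by move=> /size0nil E; apply: val_inj. Qed.

(** The generator on the edge [yz] of the Cayley graph, read as the first letter of the longer
    endpoint; [i0] is only a default for [head]. *)
Definition edge_color (i0 : 'I_d) (y z : tr) : 'I_d :=
  if len y < len z then head i0 (sval z) else head i0 (sval y).

(** Two children of [y] differ in their first letters, and a child sharing the letter of the edge to
    the parent would begin with two equal letters. So the edges at a vertex inject into the [d]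
    letters. *)
Lemma edge_color_inj (i0 : 'I_d) (y : tr) :
  {in tree_adj y &, injective (edge_color i0 y)}.
Proof.
have key z : y = parent z -> 0 < len z -> sval z = head i0 (sval z) :: sval y.
  by move=> ->; rewrite /len /=; case: (sval z).
move=> z z'; rewrite /edge_color.
case/orP=> /tree_parentP[E P]; case/orP => /tree_parentP[E' P'].
- have [l l'] : len y < len z /\ len y < len z'.
    by move: (len_parent z) (len_parent z'); rewrite -E -E'; lia.
  by rewrite l l' => Eh; apply: val_inj; rewrite /= (key z) // (key z') // Eh.
- have [l l'] : len y < len z /\ (len y < len z') = false.
    by move: (len_parent z) (len_parent y); rewrite -E -E'; lia.
  rewrite l l' => Eh; have /= := svalP z; rewrite (key z) // Eh.
  by move: P'; rewrite /len; case: (sval y) => //= a w _; rewrite eqxx.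
- have [l l'] : (len y < len z) = false /\ len y < len z'.
    by move: (len_parent y) (len_parent z'); rewrite -E -E'; lia.
  rewrite l l' => Eh; have /= := svalP z'; rewrite (key z') // -Eh.
  by move: P; rewrite /len; case: (sval y) => //= a w _; rewrite eqxx.
- by rewrite E E'.
Qed.

Lemma size_uniq_nbrs (y : tr) (l : seq tr) :
  uniq l -> all (tree_adj y) l -> size l <= d.
Proof.
case: l => // z l U /allP A.
have [i0] : exists i : 'I_d, true.
  have /orP[/tree_parentP[_]|/tree_parentP[_]] : tree_adj y z by apply: A; rewrite inE eqxx.
    by rewrite /len; case: (sval z) => // i; exists i.
  by rewrite /len; case: (sval y) => // i; exists i.
move=> _; have Ui : uniq (map (edge_color i0 y) (z :: l)).
  by rewrite map_inj_in_uniq // => a b /A ? /A ?; apply: (@edge_color_inj i0 y).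
by rewrite -(size_map (edge_color i0 y)) -(card_uniqP Ui) -[X in _ <= X]card_ord max_card.
Qed.

Definition attach (x : tr) (B : seq tr) := (x \notin B) && (count (tree_adj x) B == 1).

(** Growth leaf by leaf, the head of [C] being attached last. Every step multiplies the number of
    homomorphisms by a constant. *)
Fixpoint grows (C B : seq tr) :=
  if C is x :: C' then attach x (C' ++ B) && grows C' B else true.

Lemma grows_cat C C' B : grows (C ++ C') B = grows C (C' ++ B) && grows C' B.
Proof. by elim: C => //= x C ->; rewrite catA andbA. Qed.

Lemma grows_uniq C B : grows C B -> uniq B -> uniq (C ++ B).
Proof. by elim: C => //= x C IH /andP[/andP[-> _] /IH]. Qed.

Definition suffix_closed (B : seq tr) :=
  forall x, x \in B -> parent x \in B.

(** Longer words come earlier and each vertex precedes its parent; read from the end, the list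
    builds a subtree from the root. *)
Fixpoint descending (L : seq tr) :=
  if L is x :: L' then
    [&& x \notin L', (len x == 0) || (parent x \in L'),
        all (fun y => len y <= len x) L' & descending L']
  else true.

Lemma descending_uniq L : descending L -> uniq L.
Proof. by elim: L => //= x L IH /and4P[-> _ _ /IH]. Qed.

(** A vertex outside [B] has no child among the vertices already present: those from the list are
    not longer, and [B] contains the parents of its members. Hence its parent is its only neighbour
    there. *)
Lemma descending_grows L B : descending L -> suffix_closed B -> uniq B ->
  tree_root d \in B -> grows [seq x <- L | x \notin B] B.
Proof.
move=> + sB uB oB; elim: L => //= x L IH /and4P[xL px lx dL].
case: ifP => xB /=; last exact: IH.
rewrite IH // andbT; set F := [seq x <- L | x \notin B].
have UF : uniq (F ++ B) by apply: grows_uniq => //; exact: IH.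
have xo : 0 < len x by rewrite lt0n; apply: contraNN xB => /eqP/len0 ->.
rewrite /attach mem_cat mem_filter xB (negbTE xL) /=.
suff /eq_in_count -> : {in F ++ B, tree_adj x =1 pred1 (parent x)}.
  rewrite count_uniq_mem // mem_cat mem_filter.
  move: px; rewrite eqn0Ngt xo /= => ->; rewrite xB; by case: (parent x \in B).
move=> y yFB; rewrite /= /tree_adj.
have -> /= : tree_parent x y = false.
  apply/tree_parentP => -[E P]; move: yFB; rewrite mem_cat mem_filter.
  case/orP => [/andP[_ yL]|yB]; last by move: (sB _ yB); rewrite -E (negbTE xB).
  by have := allP lx _ yL; rewrite E len_parent; lia.
by apply/tree_parentP/eqP => [[]//|->].
Qed.

Definition words (n : nat) : seq tr := pmap insub [seq tval t | t <- enum {: n.-tuple 'I_d}].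

Lemma mem_words n x : (x \in words n) = (len x == n).
Proof.
rewrite mem_pmap_sub; apply/mapP/eqP => [[t _ E]|E].
  by rewrite /len [sval x]E size_tuple.
by exists (tcast E (in_tuple (sval x))); rewrite ?mem_enum // val_tcast.
Qed.

Lemma words_uniq n : uniq (words n).
Proof. by apply: pmap_sub_uniq; rewrite map_inj_uniq ?enum_uniq //; exact: val_inj. Qed.

Fixpoint tball (n : nat) : seq tr :=
  if n is n'.+1 then words n ++ tball n' else [:: tree_root d].

Lemma mem_tball n x : (x \in tball n) = (len x <= n).
Proof.
elim: n => [|n IH] /=.
  by rewrite inE leqn0; apply/eqP/eqP => [->//|/len0].
by rewrite mem_cat mem_words IH [in RHS]leq_eqVlt ltnS.
Qed.

Lemma descending_tball n : descending (tball n).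
Proof.
elim: n => // n IH /=.
suff H (C : seq tr) : uniq C -> all (fun x => len x == n.+1) C -> descending (C ++ tball n).
  by apply: H; [exact: words_uniq | apply/allP => x; rewrite mem_words].
elim: C => //= x C IHC /andP[xC uC] /andP[/eqP lx aC].
rewrite IHC // andbT mem_cat (negbTE xC) mem_tball lx ltnn /=.
rewrite mem_cat mem_tball len_parent lx leqnn orbT /=.
by apply/allP => y; rewrite mem_cat => /orP[/(allP aC)/eqP->//|]; rewrite mem_tball; lia.
Qed.

Lemma suffix_closed_tball n : suffix_closed (tball n).
Proof. by move=> x; rewrite !mem_tball len_parent; lia. Qed.

Lemma grows_tball n : grows (words n.+1) (tball n).
Proof.
have := @descending_grows (tball n.+1) (tball n) (descending_tball n.+1) (@suffix_closed_tball n).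
move=> /(_ (descending_uniq (descending_tball n))).
rewrite mem_tball => /(_ isT); rewrite /= filter_cat.
have /eq_in_filter -> : {in words n.+1, (fun x => x \notin tball n) =1 predT}.
  by move=> x; rewrite mem_words mem_tball => /eqP->; rewrite ltnn.
rewrite filter_predT.
have /eq_in_filter -> : {in tball n, (fun x => x \notin tball n) =1 pred0}.
  by move=> x ->.
by rewrite filter_pred0 cats0.
Qed.

Lemma grows_tball_root n : exists2 C, tball n = C ++ [:: tree_root d] & grows C [:: tree_root d].
Proof.
elim: n => [|n [C E g]]; first by exists [::].
exists (words n.+1 ++ C); first by rewrite /= E catA.
by rewrite grows_cat g andbT -E; exact: grows_tball.
Qed.

Lemma extend_to_tball B n : suffix_closed B -> uniq B -> tree_root d \in B ->
  {subset B <= tball n} -> exists2 C, grows C B & perm_eq (C ++ B) (tball n).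
Proof.
move=> sB uB oB Bn; exists [seq x <- tball n | x \notin B].
  by apply: descending_grows => //; exact: descending_tball.
apply: uniq_perm; last first.
- move=> x; rewrite mem_cat mem_filter; case: (boolP (x \in B)) => [/Bn->//|] /=.
  by rewrite orbF.
- exact: descending_uniq (descending_tball n).
- by apply: grows_uniq => //; apply: descending_grows => //; exact: descending_tball.
Qed.

Section Automorphism.
Variables (phi : tr -> tr) (hphi : tree_automorphism phi).

Let phi_inj : injective phi. Proof. exact: bij_inj hphi.1. Qed.

Lemma attach_map x B : attach (phi x) (map phi B) = attach x B.
Proof.
rewrite /attach mem_map // count_map; congr (_ && (_ == _)).
by apply: eq_count => y; rewrite /= hphi.2.
Qed.

Lemma grows_map C B : grows (map phi C) (map phi B) = grows C B.
Proof. by elim: C => //= x C ->; rewrite -map_cat attach_map. Qed.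

End Automorphism.

(** Connectedness as an induction principle: each new leaf has an edge to the older part, along
    which [P] passes in either direction. *)
Lemma grows_connected (C : seq tr) (x0 : tr) (P : pred tr) :
  grows C [:: x0] ->
  (forall x y, x \in C ++ [:: x0] -> y \in C ++ [:: x0] -> tree_adj x y -> P x -> P y) ->
  has P (C ++ [:: x0]) -> all P (C ++ [:: x0]).
Proof.
elim: C => [_ _|x C IH /= /andP[/andP[_ c1] g] clP]; first by rewrite /= !orbF andbT.
have clP' y z : y \in C ++ [:: x0] -> z \in C ++ [:: x0] -> tree_adj y z -> P y -> P z.
  by move=> yC zC; apply: clP; rewrite inE ?yC ?zC orbT.
have /hasP[y yC xy] : has (tree_adj x) (C ++ [:: x0]) by rewrite has_count (eqP c1).
have xin : x \in x :: C ++ [:: x0] by rewrite inE eqxx.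
have yin : y \in x :: C ++ [:: x0] by rewrite inE yC orbT.
case/orP => [Px|/(IH g clP') aP].
  have Py : P y by apply: clP Px.
  by rewrite Px IH //; apply/hasP; exists y.
by rewrite aP andbT; apply: (clP y x); rewrite // 1?tree_adjC //; exact: (allP aP).
Qed.

(* A connected set of vertices containing the root is closed under parents:
   the subtree above a vertex can only be left through that vertex's parent. *)
Lemma connected_suffix_closed C x0 :
  grows C [:: x0] -> tree_root d \in C ++ [:: x0] -> suffix_closed (C ++ [:: x0]).
Proof.
move=> g oC z zC; apply: contraT => wC.
have zpos : 0 < len z.
  rewrite lt0n; apply: contraNN wC => /eqP/len0 z0.
  suff -> : parent z = z by [].
  by rewrite z0; apply: val_inj.
pose P (y : tr) := suffix (sval z) (sval y).
have := @grows_connected C x0 P g _ _.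
have H1 : has P (C ++ [:: x0]) by apply/hasP; exists z; rewrite // /P suffix_refl.
move=> /(_ _ H1) H; have : all P (C ++ [:: x0]); last first.
  by move=> /allP/(_ _ oC); rewrite /P suffixs0; move: zpos; rewrite /len; case: (sval z).
apply: H => x y xC yC /orP[/tree_parentP[-> _]|/tree_parentP[E p]].
  rewrite /P /=; case: (sval y) => [|i w] //= /suffixP[u ->].
  by apply/suffixP; exists (i :: u).
rewrite /P => /suffixP[u Ex].
case: u Ex => [|i u] Ex.
  have Exz : x = z by apply: val_inj.
  by move: yC; rewrite E Exz (negbTE wC).
by rewrite E /= Ex /=; apply/suffixP; exists u.
Qed.

End Tree.

(** * Counting locally injective homomorphisms *)

Definition local_pred (d : nat) (T : Type) (B : seq (tree d)) (P : pred (tree d -> T)) :=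
  forall h h', {in B, h =1 h'} -> P h = P h'.

Lemma local_predS (d : nat) (T : Type) (B B' : seq (tree d)) (P : pred (tree d -> T)) :
  {subset B <= B'} -> local_pred B P -> local_pred B' P.
Proof. by move=> s l h h' E; apply: l => x /s /E. Qed.

Section Homs.
Variables (d : nat) (V : finType) (v0 : V) (adj : rel V).
Hypotheses (adjC : symmetric adj) (adj_reg : forall v, #|[pred w | adj v w]| = d).
Notation tr := (tree d).

(** Finite stand-in for a covering map of the tree onto the graph: a homomorphism on [B] that
    separates the neighbours of a common vertex. By regularity it is bijective around any vertex
    whose [d] neighbours all lie in [B]. *)
Definition lih (B : seq tr) (h : tr -> V) : bool :=
  all (fun x => all (fun y => tree_adj x y ==>
    adj (h x) (h y) && all (fun z => tree_adj x z && (y != z) ==> (h y != h z)) B) B) B.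

Lemma lihP B h : reflect
  ({in B &, forall x y, tree_adj x y -> adj (h x) (h y)} /\
   {in B & &, forall x y z, tree_adj x y -> tree_adj x z -> h y = h z -> y = z})
  (lih B h).
Proof.
apply: (iffP allP) => [H|[H1 H2] x xB].
  split=> [x y xB yB xy|x y z xB yB zB xy xz E].
    by have /allP/(_ y yB) := H x xB; rewrite xy => /andP[].
  have /allP/(_ y yB) := H x xB; rewrite xy => /andP[_ /allP/(_ z zB)].
  by rewrite xz E eqxx /= implybF negbK => /eqP.
apply/allP => y yB; apply/implyP => xy; rewrite H1 //=.
apply/allP => z zB; apply/implyP => /andP[xz]; apply: contraNN => /eqP E.
by apply/eqP; apply: (H2 x).
Qed.

Lemma eq_in_lih B h h' : {in B, h =1 h'} -> lih B h = lih B h'.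
Proof.
by move=> E; apply: eq_in_all => x xB; apply: eq_in_all => y yB; rewrite !E //;
  congr (_ ==> (_ && _)); apply: eq_in_all => z zB; rewrite !E.
Qed.

Lemma eq_mem_lih B B' h : B =i B' -> lih B h = lih B' h.
Proof.
move=> E; rewrite /lih (eq_all_r E); apply: eq_all => x; rewrite (eq_all_r E).
by apply: eq_all => y; rewrite (eq_all_r E).
Qed.

(** A map on the list [B] is coded by the tuple of its values; outside [B] it takes the junk value
    [v0], which predicates local to [B] do not see. *)
Definition ev (B : seq tr) (t : seq V) (x : tr) : V := nth v0 t (index x B).

Definition nhom (B : seq tr) (P : pred (tr -> V)) : nat :=
  #|[pred t : (size B).-tuple V | lih B (ev B t) && P (ev B t)]|.

Lemma eq_nhom B P P' : (forall h, lih B h -> P h = P' h) -> nhom B P = nhom B P'.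
Proof.
move=> E; apply: eq_card => t; rewrite !inE.
by case L: (lih _ _) => //=; rewrite E.
Qed.

Lemma nhom_cons x B : attach x B -> uniq B ->
  exists2 c, 0 < c & forall P, local_pred B P -> nhom (x :: B) P = c * nhom B P.
Proof.
case/andP=> xB /eqP c1 uB.
have /hasP[y yB xy] : has (tree_adj x) B by rewrite has_count c1.
have only z : z \in B -> tree_adj x z -> z = y.
  move=> zB xz; apply/eqP; apply: contraT => zy.
  have : 1 < count (tree_adj x) B.
    rewrite -size_filter; have U : uniq [:: z; y] by rewrite /= inE zy.
    apply: (uniq_leq_size U) => u; rewrite !inE mem_filter => /orP[]/eqP->.
      by rewrite xz.
    by rewrite xy.
  by rewrite c1.
pose F := [seq z <- B | tree_adj y z].
exists (d - size F).
  rewrite subn_gt0; have : uniq (x :: F) by rewrite /= filter_uniq // mem_filter (negbTE xB) andbF.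
  move=> /(@size_uniq_nbrs _ y) /=; apply; rewrite tree_adjC xy /=.
  exact: filter_all.
move=> P lP; rewrite /nhom /=.
pose ok (h : tr -> V) v := adj (h y) v && (v \notin map h F).
have cons_ev v t : {in B, ev (x :: B) (v :: t) =1 ev B t}.
  by move=> z zB; rewrite /ev /=; case: eqP => // E; rewrite E zB in xB.
have evx v t : ev (x :: B) (v :: t) x = v by rewrite /ev /= eqxx.
have key v (t : seq V) : lih (x :: B) (ev (x :: B) (v :: t)) =
    lih B (ev B t) && ok (ev B t) v.
  apply/lihP/andP => [[H1 H2]|[/lihP[H1 H2] /andP[a n]]].
    split.
      apply/lihP; split=> [a b aB bB ab|a b c aB bB cB ab ac].
        by rewrite -!(cons_ev v) //; apply: H1; rewrite // inE (aB, bB) orbT.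
      by rewrite -!(cons_ev v) //; apply: (H2 a); rewrite // inE (aB, bB, cB) orbT.
    have xin : x \in x :: B by rewrite inE eqxx.
    have yin : y \in x :: B by rewrite inE yB orbT.
    apply/andP; split.
      by rewrite adjC -(cons_ev v) // -[X in adj X](evx v t); apply: H1.
    apply/mapP => -[z]; rewrite mem_filter => /andP[yz zB] E.
    move: (E); rewrite -(cons_ev v) // -[X in X = _](evx v t) => E'.
    have zin : z \in x :: B by rewrite inE zB orbT.
    have xz := H2 y x z yin xin zin _ yz E'.
    by move: xB; rewrite xz ?zB // tree_adjC.
  split=> [b c|b c e]; rewrite !inE.
    case/predU1P => [->|bB] /predU1P[->|cB].
    - by rewrite tree_adj_irr.
    - by move=> /(only _ cB) ->; rewrite evx cons_ev // adjC.
    - by rewrite tree_adjC => /(only _ bB) ->; rewrite evx cons_ev.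
    - by rewrite !cons_ev //; apply: H1.
  case/predU1P => [->|bB] /predU1P[->|cB] /predU1P[->|eB] //.
  - by rewrite tree_adj_irr.
  - by rewrite tree_adj_irr.
  - by move=> /(only _ cB) -> /(only _ eB) ->.
  - rewrite tree_adjC => /(only _ bB) -> ye; rewrite evx cons_ev // => E; case/negP: n.
    by rewrite E map_f // mem_filter ye.
  - move=> bc; rewrite tree_adjC => /(only _ bB) by_; rewrite by_ in bc.
    rewrite evx cons_ev // => E; case/negP: n.
    by rewrite -E map_f // mem_filter bc.
  - by rewrite !cons_ev //; apply: H2.
have cnt (t : seq V) : lih B (ev B t) -> #|[pred v | ok (ev B t) v]| = d - size F.
  move=> /lihP[H1 H2]; set h := ev B t.
  have uF : uniq (map h F).
    rewrite map_inj_in_uniq ?filter_uniq // => a b.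
    by rewrite !mem_filter => /andP[ya aB] /andP[yb bB]; apply: (H2 y).
  have sF : {subset map h F <= [pred w | adj (h y) w]}.
    by move=> w /mapP[z]; rewrite mem_filter inE => /andP[yz zB] ->; apply: H1.
  have := cardID (mem (map h F)) [pred w | adj (h y) w]; rewrite adj_reg.
  have -> : #|[predI [pred w | adj (h y) w] & mem (map h F)]| = size F.
    rewrite -(size_map h F) -(card_uniqP uF); apply: eq_card => w; rewrite !inE.
    case: (boolP (w \in map h F)); last by rewrite andbF.
    by move=> /sF; rewrite inE => ->.
  move=> /(congr1 (subn^~ (size F))) /=; rewrite addKn => <-.
  by apply: eq_card => w; rewrite !inE /ok andbC.
rewrite -!sum1_card.
rewrite (reindex (fun p : V * (size B).-tuple V => [tuple of p.1 :: p.2])) /=; last first.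
  exists (fun t => (thead t, [tuple of behead t])).
    by move=> [v t] _ /=; rewrite theadE; congr (_, _); apply: val_inj.
  by move=> t _; rewrite [RHS]tuple_eta; apply: val_inj.
rewrite big_mkcond /= -(pair_bigA _ (fun v (t : (size B).-tuple V) =>
  if [tuple of v :: t] \in _ then 1 else 0)) /= exchange_big /= big_distrr /=.
rewrite [RHS]big_mkcond /=; apply: eq_bigr => t _; rewrite inE.
case L: (lih B (ev B t)) => /=; last first.
  by rewrite big1 // => v _; rewrite inE key L.
rewrite muln1 -(cnt t L) -sum1_card [in RHS]big_mkcond /=.
case: ifP => PP.
  apply: eq_bigr => v _; rewrite !inE key L /=.
  by rewrite (lP _ _ (cons_ev v t)) PP andbT.
by rewrite big1 // => v _; rewrite inE (lP _ _ (cons_ev v t)) PP andbF.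
Qed.

Lemma nhom_cat C B : grows C B -> uniq B ->
  exists2 c, 0 < c & forall P, local_pred B P -> nhom (C ++ B) P = c * nhom B P.
Proof.
move=> + uB; elim: C => [_|x C IH /= /andP[a g]].
  by exists 1 => // P _; rewrite mul1n.
have [c c0 H] := IH g.
have [c' c'0 H'] := nhom_cons a (grows_uniq g uB).
exists (c' * c); first by rewrite muln_gt0 c0 c'0.
move=> P lP; rewrite H' ?H ?mulnA //.
by apply: local_predS lP => y yB; rewrite mem_cat yB orbT.
Qed.

Lemma nhom_perm B B' P : uniq B -> perm_eq B B' -> local_pred B P ->
  nhom B P = nhom B' P.
Proof.
move=> uB pB lP; have uB' : uniq B' by rewrite -(perm_uniq pB).
have mB := perm_mem pB.
pose f B1 B2 (t : (size B1).-tuple V) : (size B2).-tuple V :=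
  [tuple of map (ev B1 t) (in_tuple B2)].
have evf B1 B2 (t : (size B1).-tuple V) : B1 =i B2 -> {in B1, ev B2 (f B1 B2 t) =1 ev B1 t}.
  move=> m12 x xB; rewrite {1}/ev /= (nth_map x) ?index_mem -?m12 //.
  by rewrite nth_index // -m12.
have fK B1 B2 : uniq B1 -> B1 =i B2 -> cancel (f B1 B2) (f B2 B1).
  move=> u1 m12 t; apply: val_inj; apply: (@eq_from_nth _ v0); first by rewrite !size_tuple.
  move=> i; rewrite size_tuple => iB1.
  have x0 : tr by case: (B1) iB1.
  rewrite /= (nth_map x0) // evf ?mem_nth // /ev index_uniq //.
rewrite /nhom -!sum1_card (reindex (f B' B)) /=; last first.
  exists (f B B') => t _; apply: fK => // x; by rewrite mB.
apply: eq_bigl => t; rewrite !inE.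
have E : {in B, ev B (f B' B t) =1 ev B' t}.
  by move=> x xB; apply: evf; rewrite -?mB // => y; rewrite mB.
by rewrite (lP _ _ E) (eq_in_lih E) (eq_mem_lih _ mB).
Qed.

Lemma nhom_map (phi : tr -> tr) (hphi : tree_automorphism phi) B P :
  nhom (map phi B) (fun h => P (h \o phi)) = nhom B P.
Proof.
have inj := bij_inj hphi.1.
have E (t : seq V) : ev (map phi B) t \o phi = ev B t.
  by apply: boolp.funext => x; rewrite /ev /= index_map.
have L (t : seq V) : lih (map phi B) (ev (map phi B) t) = lih B (ev B t).
  have E' x : ev (map phi B) t (phi x) = ev B t x by rewrite -E.
  rewrite /lih all_map; apply: eq_all => x /=; rewrite all_map; apply: eq_all => y /=.
  rewrite hphi.2 !E' all_map; congr (_ ==> (_ && _)); apply: eq_all => z /=.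
  by rewrite hphi.2 !E' (inj_eq inj).
rewrite /nhom -!sum1_card.
have sz : size B = size (map phi B) by rewrite size_map.
rewrite (reindex (tcast sz)) /=; last first.
  by exists (tcast (esym sz)) => t _; rewrite ?tcastK ?tcastKV.
by apply: eq_bigl => t; rewrite !inE !val_tcast L E.
Qed.

Lemma nhom_root (P : pred V) :
  nhom [:: tree_root d] (fun h => P (h (tree_root d))) = #|P|.
Proof.
rewrite /nhom -!sum1_card /=.
rewrite (reindex (fun v : V => [tuple v])) /=; last first.
  exists (fun t => thead t) => [v _|t _]; first by rewrite theadE.
  by apply: val_inj; case/tupleP: t => v t; rewrite theadE /= tuple0.
apply: eq_bigl => v; rewrite !inE /lih /= tree_adj_irr /=.
by [].
Qed.

Lemma nhom_gt0 C : grows C [:: tree_root d] -> 0 < nhom (C ++ [:: tree_root d]) predT.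
Proof.
move=> /nhom_cat-/(_ isT)[c c0 ->//].
rewrite muln_gt0 c0 (nhom_root predT).
by apply/card_gt0P; exists v0.
Qed.

Lemma nhom_tball_gt0 n : 0 < nhom (tball d n) predT.
Proof. by have [C -> g] := grows_tball_root d n; exact: nhom_gt0. Qed.

(** Consistency of the uniform laws on balls of different radii, with denominators cleared. *)
Lemma nhom_tball_eq n m P : n <= m -> local_pred (tball d n) P ->
  nhom (tball d n) P * nhom (tball d m) predT = nhom (tball d m) P * nhom (tball d n) predT.
Proof.
move=> /subnKC <-; elim: (m - n) => [|k IH] lP; first by rewrite addn0 mulnC.
rewrite addnS /=; have [c c0 H] := nhom_cat (@grows_tball d (n + k))
  (descending_uniq (descending_tball d (n + k))).
rewrite !H //; first by rewrite mulnCA IH // mulnA.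
by apply: local_predS lP => x; rewrite !mem_tball; lia.
Qed.

(* The proportion of homomorphisms with a given property is not changed by an
   automorphism: compare the image of the ball with a larger ball. *)
Lemma nhom_automorphism (phi : tr -> tr) (hphi : tree_automorphism phi) n P :
  local_pred (tball d n) P ->
  exists2 m, local_pred (tball d m) (fun h => P (h \o phi)) &
    nhom (tball d m) (fun h => P (h \o phi)) * nhom (tball d n) predT =
    nhom (tball d n) P * nhom (tball d m) predT.
Proof.
move=> lP.
have [psi _ phiK] := hphi.1.
(* The radius is large enough for the image of the ball to contain the root; the image is then
   closed under parents and can be completed to a ball by leaves. *)
pose k := maxn n (len (psi (tree_root d))).
pose B := map phi (tball d k).
have oB : tree_root d \in B.
  by apply/mapP; exists (psi (tree_root d)); rewrite ?phiK // mem_tball leq_maxr.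
have uk := descending_uniq (descending_tball d k).
have uB : uniq B by rewrite map_inj_uniq //; exact: bij_inj hphi.1.
have [C E g] := grows_tball_root d k.
have g' : grows (map phi C) [:: phi (tree_root d)] by rewrite (grows_map hphi _ [:: _]).
have EB : B = map phi C ++ [:: phi (tree_root d)] by rewrite /B E map_cat.
have sB : suffix_closed B by rewrite EB; apply: connected_suffix_closed; rewrite -?EB.
pose m := maxn n (\max_(x <- B) len x).
have Bm : {subset B <= tball d m}.
  move=> x xB; rewrite mem_tball leq_max; apply/orP; right.
  by apply: (@leq_bigmax_seq _ B predT (@len d)).
have [C' gC' pC'] := extend_to_tball sB uB oB Bm.
have lk : local_pred (tball d k) P.
  by apply: local_predS lP => x; rewrite !mem_tball leq_max => ->.
have lB : local_pred B (fun h => P (h \o phi)).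
  by move=> h h' Eh; apply: lk => x xk; apply: Eh; rewrite map_f.
have [c c0 H] := nhom_cat gC' uB.
have uCB := grows_uniq gC' uB.
have lT B' : local_pred B' predT by [].
have sCB : {subset B <= C' ++ B} by move=> x xB; rewrite mem_cat xB orbT.
exists m; first exact: local_predS lB.
rewrite -!(nhom_perm uCB pC') //; last exact: local_predS lB.
rewrite !H // (nhom_map hphi).
have -> : nhom B predT = nhom (tball d k) predT.
  exact: (nhom_map hphi (tball d k) predT).
have nk : n <= k by rewrite leq_maxl.
by rewrite -mulnA -(nhom_tball_eq nk lP) mulnCA.
Qed.

End Homs.

(** * Uniform points in projective systems *)

Lemma nth_flatten_const (T1 T2 : Type) (f : T1 -> seq T2) (c : nat) (s : seq T1) x1 x2 j :
  (forall x, size (f x) = c) -> j < c * size s ->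
  nth x2 (flatten (map f s)) j = nth x2 (f (nth x1 s (j %/ c))) (j %% c).
Proof.
move=> fc; have [->|c0] := posnP c; first by rewrite mul0n.
elim: s j => [|x s IH] j; first by rewrite muln0.
rewrite /= nth_cat fc mulnS => jl; case: (ltnP j c) => [jc|cj].
  by rewrite (divn_small jc) (modn_small jc).
have jE : j = c + (j - c) by rewrite subnKC.
rewrite IH; last by rewrite ltn_subLR.
by rewrite {3 4}jE divnDl // divnn c0 /= modnDl.
Qed.

Section ProjectiveLimit.
Variables (R : realType) (X : nat -> finType) (p : forall n, X n.+1 -> X n) (c : nat -> nat).
Hypothesis fiber : forall n x, #|[pred y : X n.+1 | p y == x]| = c n :> nat.
Variable x0 : forall n, X n.

Local Open Scope ring_scope.

(* Fibres are listed consecutively, so that the index of the image of a point is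
   the index of the point divided by the size of the fibres. Hence the digits of
   one uniform real select compatible uniform points on all levels. *)
Fixpoint proj_enum n : seq (X n) :=
  if n is n'.+1 then flatten [seq enum [pred y : X _.+1 | p y == x] | x <- proj_enum n'] else enum (X 0%N).

Lemma proj_enumP n : perm_eq (proj_enum n) (enum (X n)).
Proof.
elim: n => //= n IH; apply: uniq_perm; rewrite ?enum_uniq //.
  have : uniq (proj_enum n) by rewrite (perm_uniq IH) enum_uniq.
  elim: (proj_enum n) => //= x s IHs /andP[xs us].
  rewrite cat_uniq enum_uniq IHs // andbT /=; apply/hasPn => y /flattenP[l /mapP[z zs ->]].
  rewrite !mem_enum !inE => /eqP yz; apply: contraNN xs => /eqP <-.
  by rewrite yz.
move=> y; rewrite mem_enum inE; apply/flattenP.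
exists (enum [pred z : X n.+1 | p z == p y]); last by rewrite mem_enum inE.
by apply: map_f; rewrite (perm_mem IH) mem_enum.
Qed.

Lemma size_proj_enum n : size (proj_enum n) = #|X n|.
Proof. by rewrite (perm_size (proj_enumP n)) cardE. Qed.

Lemma card_projS n : #|X n.+1| = (c n * #|X n|)%N.
Proof.
rewrite -!size_proj_enum /= size_flatten /shape -map_comp.
elim: (proj_enum n) => [|x s IH] /=; first by rewrite muln0.
by rewrite IH -cardE fiber mulnS.
Qed.

Lemma card_proj_gt0 n : (0 < #|X n|)%N.
Proof. by apply/card_gt0P; exists (x0 n). Qed.

Lemma proj_c_gt0 n : (0 < c n)%N.
Proof. by have := card_proj_gt0 n.+1; rewrite card_projS muln_gt0 => /andP[]. Qed.

Definition digit n (u : R) : nat := Num.truncn ((#|X n|)%:R * u).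

Lemma digit_lt n u : 0 <= u < 1 -> (digit n u < #|X n|)%N.
Proof.
move=> /andP[u0 u1]; rewrite /digit truncn_lt_nat; last by rewrite mulr_ge0.
by rewrite gtr_pMr // ltr0n card_proj_gt0.
Qed.

(** The grid of level [n.+1] refines that of level [n], each cell being cut into [c n] equal
    cells. *)
Lemma digit_div n u : 0 <= u -> (digit n.+1 u %/ c n)%N = digit n u.
Proof.
move=> u0; have c0 := proj_c_gt0 n.
have v0 : 0 <= (#|X n|)%:R * u by rewrite mulr_ge0.
apply/eqP; rewrite eq_sym /digit truncn_eq // card_projS natrM -mulrA.
set v := _ * u in v0 *.
have w0 : 0 <= (c n)%:R * v by rewrite mulr_ge0.
have [/andP[h1 h2]] := (truncn_itv w0, divn_eq (Num.truncn ((c n)%:R * v)) (c n)).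
set k := Num.truncn _ in h1 h2 *; set q := (k %/ c n)%N => kE.
have lt_r : (k %% c n < c n)%N by rewrite ltn_mod.
have cR : 0 < (c n)%:R :> R by rewrite ltr0n.
apply/andP; split.
  rewrite -(ler_pM2l cR) -natrM; apply: le_trans h1; rewrite ler_nat; lia.
rewrite -(ltr_pM2l cR) -natrM; apply: lt_le_trans h2 _; rewrite ler_nat; nia.
Qed.

(** Makes the selected points defined and compatible for every real; their law is taken on the unit
    interval, where this is the identity. *)
Definition unit_clamp (u : R) : R := if 0 <= u < 1 then u else 0.

Lemma unit_clampP u : 0 <= unit_clamp u < 1.
Proof. by rewrite /unit_clamp; case: ifP => // _; rewrite lexx ltr01. Qed.

Definition proj_point n (u : R) : X n := nth (x0 n) (proj_enum n) (digit n (unit_clamp u)).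

Lemma proj_pointP n u : p (proj_point n.+1 u) = proj_point n u.
Proof.
rewrite /proj_point; set v := unit_clamp u; have /andP[v0 v1] : 0 <= v < 1 := unit_clampP u.
have lt : (digit n.+1 v < c n * size (proj_enum n))%N.
  by rewrite size_proj_enum -card_projS digit_lt ?v0.
rewrite /= (nth_flatten_const (x0 n) _ _ lt); last by move=> x; rewrite -cardE fiber.
rewrite digit_div //; set y := nth _ _ _.
have : y \in enum [pred y : X _.+1 | p y == nth (x0 n) (proj_enum n) (digit n v)].
  by rewrite mem_nth // -cardE fiber ltn_mod proj_c_gt0.
by rewrite mem_enum inE => /eqP.
Qed.

Local Open Scope classical_set_scope.

Definition digit_itv n (j : 'I_#|X n|) : set R :=
  `[j%:R / (#|X n|)%:R, j.+1%:R / (#|X n|)%:R[.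

Lemma digit_itvE n (j : 'I_#|X n|) u :
  digit_itv j u <-> (0 <= u < 1 /\ digit n u = j).
Proof.
have N0 : 0 < (#|X n|)%:R :> R by rewrite ltr0n card_proj_gt0.
rewrite /digit_itv /= in_itv /= ler_pdivrMr // ltr_pdivlMr // [u * _]mulrC.
split=> [/andP[h1 h2]|[/andP[u0 u1] /eqP]]; last by rewrite truncn_eq ?mulr_ge0.
have Nu0 : 0 <= (#|X n|)%:R * u by apply: le_trans h1.
have u0 : 0 <= u by rewrite -(pmulr_rge0 _ N0).
split; last by apply/eqP; rewrite truncn_eq // h1.
rewrite u0 -(ltr_pM2l N0) mulr1; apply: (lt_le_trans h2).
by rewrite ler_nat ltn_ord.
Qed.

Lemma proj_point_preimage n (A : pred (X n)) :
  [set u | A (proj_point n u)] `&` `[0, 1[%classic =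
  \big[setU/set0]_(j < #|X n| | A (nth (x0 n) (proj_enum n) j)) digit_itv j.
Proof.
rewrite -bigcup_seq_cond; apply/seteqP; split => u.
  move=> [/= Au]; rewrite in_itv /= => u01.
  move: Au; rewrite /proj_point /unit_clamp u01 => Au.
  exists (Ordinal (digit_lt n u01)); last by apply/digit_itvE.
  by rewrite /= mem_index_enum.
move=> [j /= /andP[_ Aj] /digit_itvE[u01 E]]; split; last by rewrite /= in_itv.
by rewrite /= /proj_point /unit_clamp u01 E.
Qed.

Lemma trivIset_digit_itv n : trivIset setT (@digit_itv n).
Proof.
apply/trivIsetP => i j _ _ /eqP ij; apply/seteqP; split => // u [].
move=> /digit_itvE[_ E] /digit_itvE[_ E']; case: ij; apply: val_inj.
by rewrite /= -E -E'.
Qed.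

Lemma measurable_proj_point n (A : pred (X n)) :
  measurable [set u | A (proj_point n u)].
Proof.
have -> : [set u | A (proj_point n u)] =
   ([set u | A (proj_point n u)] `&` `[0, 1[%classic) `|`
   (if A (proj_point n 0) then ~` `[0, 1[%classic else set0).
  apply/seteqP; split => u /=.
    move=> Au; case: (boolP (u \in `[0, 1[%R)) => [u01|nu]; first by left.
    right; move: Au; rewrite /proj_point /unit_clamp.
    move: (nu); rewrite in_itv /= => /negbTE->; rewrite lexx ltr01 => -> /=.
    exact/negP.
  case=> [[]//|]; case: ifP => [A0 nu|_ []].
  move: A0; rewrite /proj_point /unit_clamp lexx ltr01 /=; case: ifP => //.
apply: measurableU; last by case: ifP => // _; apply: measurableC.
rewrite proj_point_preimage; apply: bigsetU_measurable => j _.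
exact: measurable_itv.
Qed.

Lemma lebesgue_proj_point n (A : pred (X n)) :
  lebesgue_measure ([set u | A (proj_point n u)] `&` `[0, 1[%classic) =
  ((#|A|)%:R / (#|X n|)%:R)%:E.
Proof.
have N0 : 0 < (#|X n|)%:R :> R by rewrite ltr0n card_proj_gt0.
have itvE (j : 'I_#|X n|) : lebesgue_measure (digit_itv j) = ((#|X n|)%:R^-1)%:E.
  rewrite lebesgue_measure_itv /= lte_fin ltr_pM2r ?invr_gt0 // ltr_nat ltnSn.
  by rewrite -EFinB -mulrBl -natrB // subSnn mul1r.
rewrite proj_point_preimage measure_bigsetU_ord; last exact: trivIset_digit_itv; last first.
  by move=> j; exact: measurable_itv.
rewrite (eq_bigr (fun=> ((#|X n|)%:R^-1)%:E)); last by move=> j _; exact: itvE.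
rewrite -(big_mkord (fun j => A (nth (x0 n) (proj_enum n) j)) (fun=> ((#|X n|)%:R^-1)%:E)).
rewrite -size_proj_enum -(big_nth (x0 n) A (fun=> ((size (proj_enum n))%:R^-1)%:E)).
rewrite (perm_big _ (proj_enumP n)) /= big_enum_cond /= sumEFin.
rewrite size_proj_enum sumr_const -[_ *+ _]mulr_natl.
by congr ((_%:R / _)%:E); apply: eq_card => x; rewrite inE.
Qed.

End ProjectiveLimit.

Section UnitMeasure.
Variable R : realType.
Local Open Scope classical_set_scope.
Local Open Scope ring_scope.

Definition unit_measure :=
  mrestr (@lebesgue_measure R) (measurable_itv `[0 : R, 1[).

HB.instance Definition _ := Measure.copy unit_measure
  (mrestr (@lebesgue_measure R) (measurable_itv `[0 : R, 1[)).

Lemma unit_measureT : unit_measure setT = 1%:E.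
Proof.
rewrite /unit_measure /mrestr setTI lebesgue_measure_itv /= lte_fin ltr01.
by rewrite sube0.
Qed.

HB.instance Definition _ :=
  Measure_isProbability.Build _ _ _ unit_measure unit_measureT.

End UnitMeasure.

(** * The invariant lift of a finite labeling *)

Section BorelLabeling.
Variables (d : nat) (S : finType) (s0 : S).
Local Open Scope classical_set_scope.

Lemma nbhs_coordinate (f : labeling d s0) (x : tree d) :
  nbhs f [set f' : labeling d s0 | f' x = f x].
Proof.
have := @proj_continuous (tree d) (fun=> discrete_topology S) x f.
move=> /(_ [set f x]); apply.
by rewrite nbhs_principalE; apply/principal_filterP.
Qed.

Lemma local_open n (P : pred (tree d -> S)) :
  local_pred (tball d n) P -> open [set f : labeling d s0 | P f].
Proof.
move=> lP; rewrite openE => f Pf; rewrite /interior.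
have : nbhs f [set f' : labeling d s0 | {in tball d n, f' =1 f}].
  elim: (tball d n) => [|x B IH]; first by apply: filterS filterT.
  apply: filterS (filterI (nbhs_coordinate f x) IH) => f' [fx fB] y.
  by rewrite inE => /predU1P[->|/fB].
by apply: filterS => f' E; rewrite /= (lP _ _ E).
Qed.

(** Otherwise some [f] in [U] is, for every [n], matched on the ball of radius [n] by a labeling
    outside [U]; these labelings converge to [f], against openness. The union is countable and each
    term depends on one ball only. *)
Lemma open_local (U : set (labeling d s0)) : open U ->
  U = \bigcup_n [set f : labeling d s0 |
        `[< forall f' : labeling d s0, {in tball d n, f' =1 f} -> U f' >]].
Proof.
move=> oU; apply/seteqP; split => [f Uf|f [n _ /= /asboolP]]; last exact.
apply: contrapT => H.
have /choice[F HF] (n : nat) : exists f' : labeling d s0, {in tball d n, f' =1 f} /\ ~ U f'.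
  apply: contrapT => Hn; apply: H; exists n => //=; apply/asboolP => f' E.
  by apply: contrapT => nU; apply: Hn; exists f'.
have Fcvg : (F @ \oo) --> (f : labeling d s0).
  apply/cvg_sup => x; apply/cvg_image.
    by apply/seteqP; split => // s _; exists (fun=> s).
  move=> W nW; exists ((fun f' : tree d -> S => f' x) @^-1` W); last first.
    by apply/seteqP; split => [_ [? ? <-//]|s Ws]; exists (fun=> s).
  have Wf : W (f x) by exact: nbhs_singleton nW.
  exists (len x) => // n /= xn.
  by have [-> //] := HF n; rewrite mem_tball.
have [|n _ /(_ n)] := Fcvg U; first by apply: open_nbhs_nbhs; split.
by move=> /(_ (leqnn n)); have [] := HF n.
Qed.

(** The cylinders: a system closed under intersection that generates the Borel sets, hence one that
    determines finite measures. *)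
Definition local_sets : set (set (borel_labeling d s0)) :=
  [set A | exists n (P : pred (tree d -> S)), local_pred (tball d n) P /\ A = [set f | P f]].

Lemma local_setsI : setI_closed local_sets.
Proof.
move=> _ _ [n [P [lP ->]]] [m [Q [lQ ->]]].
exists (maxn n m), (fun f => P f && Q f); split.
  move=> h h' E; congr (_ && _); [apply: lP|apply: lQ] => x; rewrite mem_tball => xn;
  by apply: E; rewrite mem_tball leq_max xn ?orbT.
by apply/seteqP; split => [f [/= -> ->]|f /= /andP[]].
Qed.

Lemma local_sets_measurable A : local_sets A -> measurable A.
Proof.
move=> [n [P [lP ->]]]; apply: sub_sigma_algebra.
exact: (@local_open n P lP).
Qed.

Lemma measurable_local_sets :
  @measurable _ (borel_labeling d s0) = <<s local_sets >>.
Proof.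
apply/seteqP; split; last first.
  apply: smallest_sub; first exact: sigma_algebra_measurable.
  exact: local_sets_measurable.
apply: smallest_sub; first exact: smallest_sigma_algebra.
move=> U oU; rewrite (open_local oU); apply: sigma_algebra_bigcup => n.
apply: sub_sigma_algebra.
exists n, (fun f => `[< forall f' : labeling d s0, {in tball d n, f' =1 f} -> U f' >]).
split => // h h' E; apply: asbool_equiv_eq; split => H f' E'; apply: H => x xn.
  by rewrite E' // E.
by rewrite E' // -E.
Qed.

Lemma local_sets_unique (R : realType) (mu nu : {measure set (borel_labeling d s0) -> \bar R}%R) :
  (mu setT < +oo)%E -> (forall A, local_sets A -> mu A = nu A) ->
  forall A, measurable A -> mu A = nu A.
Proof.
move=> fin E A mA; apply: (measure_unique local_sets (fun=> setT)) => //.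
- exact: measurable_local_sets.
- exact: local_setsI.
- by move=> _; exists 0, predT; split => //; apply/seteqP; split.
- by apply/seteqP; split => // x _; exists 0.
Qed.

End BorelLabeling.

Section LiftMeasure.
Variables (R : realType) (d : nat) (S : finType) (s0 : S).
Variables (V : finType) (v0 : V) (adj : rel V).
Hypotheses (adjC : symmetric adj) (adj_reg : forall v, #|[pred w | adj v w]| = d).
Variable g : V -> S.
Notation tr := (tree d).
Notation hcount := (nhom v0 adj).
Notation evB := (@ev d V v0).

Definition hom_ball n : finType :=
  {t : (size (tball d n)).-tuple V | lih adj (tball d n) (evB (tball d n) t)}.

Definition hom_of n (t : hom_ball n) : tr -> V := evB (tball d n) (val t).

Lemma card_hom_ball n (P : pred (tr -> V)) :
  #|[pred t : hom_ball n | P (hom_of t)]| = hcount (tball d n) P.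
Proof.
rewrite -(fintype.card_image val_inj); apply: eq_card => t; rewrite inE.
apply/fintype.imageP/andP => [[u]|[L Pt]]; first by rewrite inE => Pu ->; split=> //; exact: (valP u).
by exists (exist _ t L) => //; rewrite inE.
Qed.

Lemma ev_map B B' (t : seq V) : {in B', evB B' (map (evB B t) B') =1 evB B t}.
Proof.
by move=> x xB; rewrite [LHS](nth_map x) ?index_mem // nth_index.
Qed.

Lemma ev_inj B (t t' : (size B).-tuple V) : uniq B -> {in B, evB B t =1 evB B t'} -> t = t'.
Proof.
move=> uB E; apply: val_inj; apply: (@eq_from_nth _ v0); first by rewrite !size_tuple.
move=> i; rewrite size_tuple => iB; have x0 : tr by case: (B) iB.
by have := E (nth x0 B i) (mem_nth _ iB); rewrite /ev index_uniq.
Qed.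

Lemma hom_restrict_subproof n (t : hom_ball n.+1) :
  lih adj (tball d n) (evB (tball d n)
    (map_tuple (hom_of t) (in_tuple (tball d n)))).
Proof.
rewrite (eq_in_lih _ (@ev_map (tball d n.+1) (tball d n) (val t))).
have /lihP[H1 H2] := valP t.
have sub : {subset tball d n <= tball d n.+1} by move=> x; rewrite !mem_tball; lia.
by apply/lihP; split=> [x y /sub ? /sub ?|x y z /sub ? /sub ? /sub ?]; [apply: H1|apply: H2].
Qed.

Definition hom_restrict n (t : hom_ball n.+1) : hom_ball n :=
  exist (fun t : (size (tball d n)).-tuple V => lih adj (tball d n) (evB (tball d n) t)) _
    (hom_restrict_subproof t).

Lemma hom_restrictE n (t : hom_ball n.+1) :
  {in tball d n, hom_of (hom_restrict t) =1 hom_of t}.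
Proof. exact: ev_map. Qed.

Definition ext_count n := hcount (tball d n.+1) predT %/ hcount (tball d n) predT.

(** Counting with the predicate [P] of being equal to [x] on the small ball singles out one
    homomorphism there, and the constant of [nhom_cat] is the same for all predicates. *)
Lemma card_restrict_fiber n (x : hom_ball n) :
  #|[pred y : hom_ball n.+1 | hom_restrict y == x]| = ext_count n.
Proof.
have uB := descending_uniq (descending_tball d n).
have [c c0 H] := nhom_cat v0 adjC adj_reg (grows_tball d n) uB.
rewrite /ext_count /= H // mulnK; last exact: nhom_tball_gt0.
pose P h := all (fun z => h z == hom_of x z) (tball d n).
have lP : local_pred (tball d n) P.
  by move=> h h' E; apply: eq_in_all => z /E ->.
have E1 : hcount (tball d n) P = 1%N.
  rewrite -card_hom_ball; apply/eqP/card1P; exists x => t; rewrite !inE.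
  apply/allP/eqP => [E|->//]; apply: val_inj.
  by apply: ev_inj => // z /E /eqP.
rewrite -[RHS]muln1 -E1 -H // -[words d n.+1 ++ _]/(tball d n.+1) -card_hom_ball.
apply: eq_card => t; rewrite !inE; apply/eqP/allP => [<- z zn|E].
  by rewrite hom_restrictE.
apply: val_inj; apply: ev_inj => // z zn.
by rewrite -[RHS]/(hom_of x z) -(eqP (E z zn)) -hom_restrictE.
Qed.

Lemma hom_ball_exists n : exists t : hom_ball n, true.
Proof.
have : 0 < #|[pred t : hom_ball n | predT (hom_of t)]|.
  by rewrite (card_hom_ball n predT) nhom_tball_gt0.
by move=> /card_gt0P[t _]; exists t.
Qed.

Definition hom_default n : hom_ball n := xchoose (hom_ball_exists n).

Definition random_hom n (u : R) : hom_ball n :=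
  proj_point hom_restrict hom_default n u.

Lemma random_homE n m u x : len x <= n -> n <= m ->
  hom_of (random_hom m u) x = hom_of (random_hom n u) x.
Proof.
move=> xn /subnKC <-; elim: (m - n) => [|k IH]; first by rewrite addn0.
have E : hom_restrict (random_hom (n + k).+1 u) = random_hom (n + k) u.
  exact: proj_pointP card_restrict_fiber _ _ _.
by rewrite -IH addnS -E hom_restrictE // mem_tball; lia.
Qed.

(** The value at [x] is read at level [len x], the first that sees [x]; compatibility of the levels
    makes any higher one give the same value. *)
Definition random_labeling (u : measurableTypeR R) : borel_labeling d s0 :=
  fun x => g (hom_of (random_hom (len x) u) x).

Lemma random_labelingE n u : {in tball d n,
  random_labeling u =1 g \o hom_of (random_hom n u)}.
Proof. by move=> x; rewrite mem_tball => xn; rewrite /= (@random_homE (len x)). Qed.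

Local Open Scope classical_set_scope.
Local Open Scope ring_scope.

Lemma random_labeling_preimage n (P : pred (tr -> S)) : local_pred (tball d n) P ->
  random_labeling @^-1` [set f | P f] = [set u | P (g \o hom_of (random_hom n u))].
Proof.
move=> lP; apply/seteqP; split=> u /=;
by rewrite (lP _ _ (@random_labelingE n u)).
Qed.

Lemma measurable_random_labeling : measurable_fun setT random_labeling.
Proof.
apply: (measurability (@open (labeling d s0) : set (set (borel_labeling d s0)))) => // _ [U oU <-].
rewrite setTI (open_local oU) preimage_bigcup; apply: bigcup_measurable => n _.
rewrite (@random_labeling_preimage n (fun f => `[< forall f' : labeling d s0,
  {in tball d n, f' =1 f} -> U f' >])); last first.
  move=> h h' E; apply: asbool_equiv_eq; split => H f' E'; apply: H => x xn.
    by rewrite E' // E.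
  by rewrite E' // -E.
exact: (measurable_proj_point hom_restrict hom_default
  (fun t => `[< forall f' : labeling d s0, {in tball d n, f' =1 g \o hom_of t} -> U f' >])).
Qed.

Lemma lift_measure_exists : exists mu : probability (borel_labeling d s0) R,
  forall n (P : pred (tr -> S)), local_pred (tball d n) P ->
  mu [set f | P f] =
    ((hcount (tball d n) (fun h => P (g \o h)))%:R / (hcount (tball d n) predT)%:R)%:E.
Proof.
pose F : {mfun _ >-> _} := HB.pack random_labeling
  (isMeasurableFun.Build _ _ _ _ random_labeling measurable_random_labeling).
exists (distribution (@unit_measure R) F) => n P lP.
rewrite /distribution /pushforward /= (random_labeling_preimage lP).
rewrite /unit_measure /mrestr.
have -> : (hcount (tball d n) predT) = #|hom_ball n|.
  by rewrite -(card_hom_ball n predT); apply: eq_card.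
rewrite -(@card_hom_ball n (fun h => P (g \o h))).
have := @lebesgue_proj_point R hom_ball hom_restrict hom_default n (fun t => P (g \o hom_of t)).
by move=> ->.
Qed.

End LiftMeasure.

(** * Coverings as neighbour counts, on finite graphs and at the root of the tree *)

Section Covering.
Local Open Scope classical_set_scope.

Lemma card_eq_uniq (T : choiceType) (A : set T) (s : seq T) k :
  uniq s -> (forall x, A x <-> x \in s) -> (A #= `I_k)%card <-> size s = k.
Proof.
move=> us As.
have sA : (A #= `I_(size s))%card.
  case: s us As => [|x0 s] us As.
    have -> : A = set0 by apply/seteqP; split => // x /As.
    by rewrite /= II0.
  have -> : A = nth x0 (x0 :: s) @` `I_(size (x0 :: s)).
    apply/seteqP; split => [x /As xs|x [i /= il <-]]; last by apply/As/mem_nth.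
    exists (index x (x0 :: s)); last by rewrite nth_index.
    by move: xs; rewrite -index_mem.
  by apply: inj_card_eq => i j /set_mem /= il /set_mem /= jl /eqP; rewrite nth_uniq // => /eqP.
split=> [Ak|<-//]; apply/card_eq_II.
by apply: card_eq_trans Ak; rewrite card_eq_sym.
Qed.

Lemma covering_atP (V : finType) (adj : rel V) (S : finType) (M : S -> S -> nat)
    (g : V -> S) v :
  covering_at adj M g v <-> forall q, #|[pred w | adj v w && (g w == q)]| = M (g v) q.
Proof.
have E q : ([set w | adj v w /\ g w = q] #= `I_(M (g v) q))%card <->
    #|[pred w | adj v w && (g w == q)]| = M (g v) q.
  rewrite cardE; apply: card_eq_uniq (enum_uniq _) _ => w.
  rewrite mem_enum inE /=; split=> [[-> ->]|/andP[-> /eqP->]//].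
  by rewrite eqxx.
by split=> H q; apply/E/H.
Qed.

Variable d : nat.

Lemma mem_words1 (x : tree d) : (x \in words d 1) = tree_adj (tree_root d) x.
Proof.
rewrite mem_words /tree_adj; apply/eqP/orP => [lx|[/tree_parentP[E p]|/tree_parentP[//]]].
  left; apply/tree_parentP; rewrite lx; split => //.
  by apply/esym/len0; rewrite len_parent lx.
have l0 : len (tree_root d) = 0 by [].
by move: p (congr1 (@len d) E); rewrite len_parent l0; lia.
Qed.

Lemma size_words1 : size (words d 1) = d.
Proof.
rewrite size_pmap_sub; set s := map _ _.
have : all (sorted (fun i j : 'I_d => i != j)) s; last first.
  by rewrite all_count => /eqP->; rewrite size_map -cardE card_tuple card_ord expn1.
by apply/allP => w /mapP[t _ ->]; case/tupleP: t => a t; rewrite (tuple0 t).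
Qed.

Lemma covering_at_rootP (S : finType) (M : S -> S -> nat) (f : tree d -> S) :
  covering_at (@tree_adj d) M f (tree_root d) <->
  forall q, count (fun x => f x == q) (words d 1) = M (f (tree_root d)) q.
Proof.
have E q : ([set w | tree_adj (tree_root d) w /\ f w = q] #= `I_(M (f (tree_root d)) q))%card <->
    count (fun x => f x == q) (words d 1) = M (f (tree_root d)) q.
  rewrite -size_filter; apply: card_eq_uniq; first by rewrite filter_uniq // words_uniq.
  move=> w; rewrite mem_filter mem_words1 /=; split=> [[-> ->]|/andP[/eqP-> ->]//].
  by rewrite eqxx.
by split=> H q; apply/E/H.
Qed.

End Covering.

Lemma local_pred_comp d (phi : tree d -> tree d) n : exists m, forall (T : Type)
  (P : pred (tree d -> T)), local_pred (tball d n) P ->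
  local_pred (tball d m) (fun f => P (f \o phi)).
Proof.
exists (\max_(x <- tball d n) len (phi x)) => T P lP h h' E; apply: lP => x xn /=.
by apply: E; rewrite mem_tball; apply: (@leq_bigmax_seq _ _ predT (fun x => len (phi x))).
Qed.

Section Lift.
Variables (R : realType) (d : nat) (S : finType) (s0 : S) (M : S -> S -> nat).
Variables (V : finType) (v0 : V) (adj : rel V).
Hypotheses (adjC : symmetric adj) (adj_reg : forall v, #|[pred w | adj v w]| = d).
Notation tr := (tree d).
Notation hcount := (nhom v0 adj).
Notation o := (tree_root d).

(** The [d] neighbours of the root map injectively into the [d] neighbours of [h o], hence onto
    them, so the label counts agree. *)
Lemma lih_covering (g : V -> S) h : lih adj (tball d 1) h ->
  covering_at (@tree_adj d) M (g \o h) o <-> covering_at adj M g (h o).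
Proof.
move=> /lihP[H1 H2]; rewrite covering_at_rootP covering_atP.
have oB : o \in tball d 1 by rewrite mem_tball.
have wB : {subset words d 1 <= tball d 1} by move=> x; rewrite mem_words mem_tball => /eqP->.
have uh : uniq (map h (words d 1)).
  rewrite map_inj_in_uniq ?words_uniq // => x y xw yw.
  by apply: (H2 o x y oB (wB _ xw) (wB _ yw)); rewrite -mem_words1.
have sh : {subset map h (words d 1) <= enum [pred w | adj (h o) w]}.
  move=> w /mapP[x xw ->]; rewrite mem_enum inE; apply: H1 => //; first exact: wB.
  by rewrite -mem_words1.
have sz : size (enum [pred w | adj (h o) w]) <= size (map h (words d 1)).
  by rewrite -cardE adj_reg size_map size_words1.
have [_ mem_h] := uniq_min_size uh sh sz.
have E q : count (fun x => (g \o h) x == q) (words d 1) =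
    #|[pred w | adj (h o) w && (g w == q)]|.
  rewrite -(count_map h (fun w => g w == q)) -size_filter cardE; apply/perm_size.
  apply: uniq_perm; [by rewrite filter_uniq | exact: enum_uniq | move=> w].
  by rewrite mem_filter mem_h !mem_enum !inE andbC.
by split=> H q; rewrite -?H ?E // -E H.
Qed.

Local Open Scope ring_scope.

(** The image of the root is uniform on [V]: this is clear for the ball of radius 0, and the laws on
    balls are consistent. *)
Lemma nhom_ratio_root n (Q : pred V) :
  (hcount (tball d n) (fun h => Q (h o)))%:R / (hcount (tball d n) predT)%:R =
  (#|Q|)%:R / (#|V|)%:R :> R.
Proof.
have l0 : local_pred (tball d 0) (fun h : tr -> V => Q (h o)).
  by move=> h h' E; rewrite E // mem_tball.
have := nhom_tball_eq v0 adjC adj_reg (leq0n n) l0.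
rewrite (nhom_root d v0 adj Q) (nhom_root d v0 adj predT) => E.
have V0 : (#|V|)%:R != 0 :> R by rewrite pnatr_eq0 -lt0n; apply/card_gt0P; exists v0.
have N0 : (hcount (tball d n) predT)%:R != 0 :> R.
  by rewrite pnatr_eq0 -lt0n nhom_tball_gt0.
apply/eqP; rewrite eqr_div // -!natrM; apply/eqP; congr _%:R.
by rewrite E.
Qed.

Local Open Scope classical_set_scope.

Lemma nhom_ratio_automorphism phi n m (P : pred (tr -> V)) : tree_automorphism phi ->
  local_pred (tball d n) P -> local_pred (tball d m) (fun h => P (h \o phi)) ->
  (hcount (tball d m) (fun h => P (h \o phi)))%:R / (hcount (tball d m) predT)%:R =
  (hcount (tball d n) P)%:R / (hcount (tball d n) predT)%:R :> R.
Proof.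
move=> hphi lP lm; have [k lk Ek] := nhom_automorphism v0 adjC adj_reg hphi lP.
have N0 i : (hcount (tball d i) predT)%:R != 0 :> R.
  by rewrite pnatr_eq0 -lt0n nhom_tball_gt0.
have step i j Q : (i <= j)%N -> local_pred (tball d i) Q ->
    (hcount (tball d i) Q)%:R / (hcount (tball d i) predT)%:R =
    (hcount (tball d j) Q)%:R / (hcount (tball d j) predT)%:R :> R.
  move=> ij lQ; apply/eqP; rewrite eqr_div // -!natrM; apply/eqP; congr _%:R.
  exact: nhom_tball_eq.
rewrite (step m (maxn m k)) ?leq_maxl // -(step k) ?leq_maxr //.
by apply/eqP; rewrite eqr_div // -!natrM Ek.
Qed.

Theorem lift_measure (g : {ffun V -> S}) :
  exists mu : probability (borel_labeling d s0) R,
  [/\ invariant_measure mu,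
      mu [set f | covering_at (@tree_adj d) M f o] = (1 - error adj M g)%:E &
      forall s, mu [set f | f o = s] = ((#|[pred v | g v == s]|)%:R / (#|V|)%:R)%:E].
Proof.
have [mu muE] := lift_measure_exists R s0 v0 adjC adj_reg g; exists mu; split.
- move=> phi hphi.
  have mphi : measurable_fun setT (fun f : borel_labeling d s0 => (f \o phi : borel_labeling d s0)).
    apply: (measurability (@local_sets d S s0)); first exact: measurable_local_sets.
    move=> _ [A [n [P [lP ->]]] <-]; rewrite setTI; apply: local_sets_measurable.
    have [m lm] := local_pred_comp phi n.
    by exists m, (fun f => P (f \o phi)); split; [apply: lm|].
  (* Invariance under [phi] says that [mu] equals its image under composition with [phi], which is
     tested on cylinders. *)
  pose nu := distribution mu (HB.pack_for {mfun _ >-> _}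
    (fun f : borel_labeling d s0 => (f \o phi : borel_labeling d s0))
    (isMeasurableFun.Build _ _ _ _ _ mphi)).
  move=> A mA; have := @local_sets_unique d S s0 R nu mu.
  apply => // [|_ [n [P [lP ->]]]].
    by rewrite /= /distribution /pushforward preimage_setT probability_setT ltry.
  have lgP : local_pred (tball d n) (fun h : tr -> V => P (g \o h)).
    by move=> h h' E; apply: lP => x xn; rewrite /= E.
  have [m lm] := local_pred_comp phi n.
  rewrite /= /distribution /pushforward /= (muE n P lP).
  rewrite (muE m (fun f => P (f \o phi)) (lm _ _ lP)).
  by rewrite (nhom_ratio_automorphism hphi lgP (lm _ _ lgP)).
- pose P (f : tr -> S) := `[< covering_at (@tree_adj d) M f o >].
  have -> : [set f : borel_labeling d s0 | covering_at (@tree_adj d) M f o] = [set f | P f].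
    by apply/seteqP; split => f /asboolP.
  have lP : local_pred (tball d 1) P.
    move=> f f' E; apply: asbool_equiv_eq; rewrite !covering_at_rootP.
    have oB : o \in tball d 1 by rewrite mem_tball.
    have Eq q : count (fun x => f x == q) (words d 1) = count (fun x => f' x == q) (words d 1).
      by apply: eq_in_count => x xw; rewrite E // mem_tball; move: xw; rewrite mem_words => /eqP->.
    by split=> H q; have := H q; rewrite Eq E.
  rewrite (muE 1%N P lP).
  rewrite (eq_nhom v0 (P' := fun h => `[< covering_at adj M g (h o) >])); last first.
    by move=> h /lih_covering Lh; apply: asbool_equiv_eq; exact: Lh.
  rewrite (nhom_ratio_root 1 (fun v => `[< covering_at adj M g v >])).
  have V0 : (#|V|)%:R != 0 :> R by rewrite pnatr_eq0 -lt0n; apply/card_gt0P; exists v0.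
  congr EFin; rewrite /error -[X in X - _](mulfV V0) -mulrBl; congr (_ / _).
  have -> : #|[set v | `[< ~ covering_at adj M g v >]]%SET| =
    #|[predC [pred v | `[< covering_at adj M g v >]]]|.
    by apply: eq_card => v; rewrite !inE asbool_neg.
  by rewrite -(cardC [pred v | `[< covering_at adj M g v >]]) natrD addrK.
- move=> s; have -> : [set f : borel_labeling d s0 | f o = s] = [set f | (fun f : tr -> S => f o == s) f].
    by apply/seteqP; split => f /eqP.
  have l0 : local_pred (tball d 0) (fun f : tr -> S => f o == s).
    by move=> h h' E; rewrite E // mem_tball.
  rewrite (muE 0%N _ l0).
  by rewrite (nhom_ratio_root 0 (fun v => g v == s)).
Qed.

End Lift.

(** * Label densities below the threshold *)

Section Density.
Variables (R : realType) (V : finType) (S : finType).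
Local Open Scope ring_scope.

Definition density (g : V -> S) (s : S) : R := (#|[pred v | g v == s]|)%:R / (#|V|)%:R.

Lemma density_ge0 g s : 0 <= density g s.
Proof. by rewrite /density divr_ge0. Qed.

Lemma sum_density (v0 : V) g : \sum_s density g s = 1.
Proof.
rewrite /density -mulr_suml -natr_sum.
have -> : (\sum_s #|[pred v | g v == s]| = #|V|)%N.
  rewrite -sum1_card (partition_big g predT) //=; apply: eq_bigr => s _.
  by rewrite -sum1_card; apply: eq_bigl => v; rewrite inE.
by rewrite mulfV // pnatr_eq0 -lt0n; apply/card_gt0P; exists v0.
Qed.

End Density.

(** * Propagation of label densities along the arcs of [M] *)

Section DensityPropagation.
Variables (R : realType) (d : nat) (S : finType) (M : S -> S -> nat).
Variables (V : finType) (v0 : V) (adj : rel V) (g : {ffun V -> S}).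
Hypotheses (adjC : symmetric adj) (adj_reg : forall v, #|[pred w | adj v w]| = d).

Definition bad_vertices : {set V} := [set v | `[< ~ covering_at adj M g v >]].

(** Double counting of the edges between [A] and [B]. *)
Lemma card_nbrs_le (A B : pred V) :
  (forall v, A v -> exists2 w, adj v w & B w) -> #|A| <= d * #|B|.
Proof.
move=> H; rewrite -sum1_card.
apply: (@leq_trans (\sum_(v | A v) \sum_(w | B w) adj v w)).
  apply: leq_sum => v /H[w vw Bw]; rewrite (bigD1 w) //= vw //.
rewrite exchange_big /= -[X in _ <= _ * X]sum1_card big_distrr /=.
apply: leq_sum => w _; rewrite muln1 -(adj_reg w).
rewrite big_mkcond -sum1_card [X in _ <= X]big_mkcond /=; apply: leq_sum => v _.
by rewrite inE adjC; case: (A v); case: (adj w v).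
Qed.

Lemma good_vertex v : v \notin bad_vertices ->
  forall q, #|[pred w | adj v w && (g w == q)]| = M (g v) q.
Proof. by rewrite inE asbool_neg negbK => /asboolP/covering_atP. Qed.

Lemma card_split_bad (A : pred V) :
  #|A| <= #|[pred v | A v && (v \notin bad_vertices)]| + #|bad_vertices|.
Proof.
rewrite -(cardID (mem bad_vertices) A) addnC leq_add //.
  apply: subset_leq_card; apply/fintype.subsetP => v; rewrite !inE.
  by move=> /andP[-> Av]; rewrite andbT; exact: Av.
by apply: subset_leq_card; apply/fintype.subsetP => v /andP[].
Qed.

Lemma card_density_step s q : 0 < M s q ->
  #|[pred v | g v == s]| <= d * #|[pred v | g v == q]| + #|bad_vertices|.
Proof.
move=> Msq; apply: leq_trans (card_split_bad _) _; rewrite leq_add2r.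
apply: card_nbrs_le => v /= /andP[/eqP gv /good_vertex/(_ q)]; rewrite gv => E.
have : 0 < #|[pred w | adj v w && (g w == q)]| by rewrite E.
by move=> /card_gt0P[w]; rewrite inE => /andP[vw gw]; exists w.
Qed.

(** A vertex labelled [q] at which [g] covers has a neighbour labelled [s]. That neighbour sees the
    label [q] although [M s q = 0], so it is bad. Thus every vertex labelled [q] is bad or next to a
    bad one. *)
Lemma card_density_asym s q : 0 < M q s -> M s q = 0 ->
  #|[pred v | g v == q]| <= d.+1 * #|bad_vertices|.
Proof.
move=> Mqs Msq; apply: leq_trans (card_split_bad _) _; rewrite mulSn addnC leq_add2l.
apply: card_nbrs_le => v /= /andP[/eqP gv /good_vertex/(_ s)]; rewrite gv => E.
have : 0 < #|[pred w | adj v w && (g w == s)]| by rewrite E.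
move=> /card_gt0P[w]; rewrite inE => /andP[vw /eqP gw]; exists w => //.
apply: contraT => /good_vertex/(_ q); rewrite gw Msq => /eqP; rewrite -leqn0 leqNgt.
by case/negP; apply/card_gt0P; exists v; rewrite inE adjC vw gv eqxx.
Qed.

Local Open Scope ring_scope.
Notation dens := (density R g).
Notation err := (error adj M g : R).

Let V0 : 0 < (#|V|)%:R :> R.
Proof. by rewrite ltr0n; apply/card_gt0P; exists v0. Qed.

Lemma density_step s q : (1 < d)%N -> (0 < M s q)%N -> dens s / d%:R - err <= dens q.
Proof.
move=> d1 /card_density_step H.
have dR : 1 <= d%:R :> R by rewrite ler1n ltnW.
have d0 : 0 < d%:R :> R by apply: lt_le_trans dR.
rewrite lerBlDr ler_pdivrMr // /density /error.
rewrite -mulrDl mulrAC ler_pM2r ?invr_gt0 // mulrDl -!natrM -natrD ler_nat.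
by apply: leq_trans H _; rewrite mulnC leq_add2l leq_pmulr // ltnW.
Qed.

Lemma density_asym s q : (0 < M q s)%N -> M s q = 0%N -> dens q <= d.+1%:R * err.
Proof.
move=> Mqs Msq; rewrite /density /error mulrA ler_pM2r ?invr_gt0 // -natrM ler_nat.
exact: card_density_asym Mqs Msq.
Qed.

(** The losses of the successive steps form a geometric series of ratio [1 / d], at most [1 / 2],
    whence the factor 2. *)
Lemma density_path s p : (1 < d)%N -> path (fun a b => 0 < M a b)%N s p ->
  dens s / d%:R ^+ size p - 2 * err <= dens (last s p).
Proof.
move=> d1; have e0 : 0 <= err by rewrite /error divr_ge0.
have d2 : 2 <= d%:R :> R by rewrite ler_nat.
have d0 : 0 < d%:R :> R by apply: lt_le_trans d2.
elim/last_ind: p => [_|p q IH].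
  by rewrite expr0 divr1 /= lerBlDr lerDl mulr_ge0.
rewrite rcons_path last_rcons size_rcons => /andP[/IH{}IH /density_step-/(_ d1)].
apply: le_trans; rewrite exprSr invfM mulrA.
set D := dens s / _ in IH *.
have : (D - 2 * err) / d%:R <= dens (last s p) / d%:R by rewrite ler_pM2r ?invr_gt0.
have : 2 * err / d%:R <= err by rewrite ler_pdivrMr // mulrC ler_wpM2l.
rewrite mulrBl; lra.
Qed.

End DensityPropagation.

(** * What the property of [delta] yields on finite graphs *)

Section DeltaConsequences.
Variables (R : realType) (d : nat) (hd : 3 <= d) (S : finType) (hS : 1 < #|S|).
Variable M : S -> S -> nat.
Hypotheses (hM : forall s : S, \sum_(q : S) M s q = d) (hconn : digraph_connected M).
Local Open Scope ring_scope.
Variables (delta : R -> R) (hdelta : is_delta d M delta).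

Lemma delta_property_density (V : finType) (v0 : V) (adj : rel V) (g : {ffun V -> S}) (x : R) :
  symmetric adj -> (forall v, #|[pred w | adj v w]| = d) ->
  delta_property d M (error adj M g) x -> (exists v w, g v <> g w) ->
  forall s, x <= density R g s.
Proof.
move=> adjC adj_reg hx [v [w gvw]] s.
have [mu [inv cov dens]] := @lift_measure R d S s M V v0 adj adjC adj_reg g.
have pos u : (0 < mu [set f | f (tree_root d) = g u]%classic)%E.
  rewrite dens lte_fin divr_gt0 // ltr0n; apply/card_gt0P; last by exists v0.
  by exists u; rewrite inE eqxx.
have := hx s mu inv cov; rewrite -lee_fin /density -dens; apply.
by exists (g v), (g w).
Qed.

Definition entropy_const : R := ln (#|S|%:R) * ((d%:R - 1) / (d%:R - 2)).

(** A positive number below the infimum is not in the set, so the defining inequality fails at [x]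
    itself. *)
Lemma below_eps0 (x : R) : 0 < x -> x < eps0 d S delta ->
  Num.sqrt (x * entropy_const) < 2^-1 * (delta x ^+ d - x).
Proof.
move=> x0; rewrite /eps0 ltNge => xe; rewrite ltNge; apply: contraNN xe => h.
apply: ge_inf; first by exists 0 => y [/ltW].
by split => //; rewrite -mulrA.
Qed.

Lemma below_eps0_gt (x : R) : 0 < x -> x < eps0 d S delta -> x < delta x ^+ d.
Proof.
move=> x0 /(below_eps0 x0) /(le_lt_trans (sqrtr_ge0 _)).
by rewrite pmulr_rgt0 ?invr_gt0 // subr_gt0.
Qed.

(** The default value 0 of [delta] is impossible here, since it would give [x < 0]. *)
Lemma delta_below_eps0 (x : R) : 0 < x -> x < eps0 d S delta ->
  0 < delta x /\ delta_property d M x (delta x).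
Proof.
move=> x0 xe; have := below_eps0_gt x0 xe.
case: (hdelta (ltW x0)) => // -[-> _]; rewrite expr0n.
by case: d hd => // n _ /= /(lt_trans x0); rewrite ltxx.
Qed.

(** Combines x < delta(x)^d, delta(x) at most 1, and delta(x) at most the density. Its use is to
    refute labelings with a label rarer than the error. *)
Lemma density_gt_error (V : finType) (v0 : V) (adj : rel V) (g : {ffun V -> S}) s :
  symmetric adj -> (forall v, #|[pred w | adj v w]| = d) -> (exists v w, g v <> g w) ->
  let x : R := error adj M g in 0 < x -> x < eps0 d S delta -> x < density R g s.
Proof.
move=> adjC adj_reg ne x x0 xe; have [del0 dp] := delta_below_eps0 x0 xe.
have := delta_property_density v0 adjC adj_reg dp ne => /(_ s) ds.
have d1 : delta x <= 1.
  apply: le_trans ds _; rewrite -(sum_density R v0 g) (bigD1 s) //= lerDl.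
  by apply: sumr_ge0 => q _; exact: density_ge0.
apply: lt_le_trans (below_eps0_gt x0 xe) _; apply: le_trans ds.
by case: d hd => // n _; rewrite exprS ger_pMr // exprn_ile1 // ltW.
Qed.

Section DisjointUnion.
Variables (V : finType) (v0 : V) (adj : rel V) (k : nat) (G : 'I_k -> V -> S).
Hypotheses (adjC : symmetric adj) (adj_reg : forall v, #|[pred w | adj v w]| = d).

(** Disjoint copies of one graph, copy [i] labelled by [G i]. Errors and densities are averaged over
    the copies, so both can be prescribed by mixing labelings. *)
Definition union_adj : rel (V * 'I_k) := fun p q => adj p.1 q.1 && (p.2 == q.2).
Definition union_labeling : {ffun V * 'I_k -> S} := [ffun p => G p.2 p.1].

Lemma union_adjC : symmetric union_adj.
Proof. by move=> p q; rewrite /union_adj adjC eq_sym. Qed.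

Lemma card_union_nbrs (A : pred V) (v : V) i :
  #|[pred q : V * 'I_k | union_adj (v, i) q && A q.1]| = #|[pred w | adj v w && A w]|.
Proof.
have inj : injective (fun w : V => (w, i)) by move=> ? ? [].
rewrite -(fintype.card_image inj); apply: eq_card => -[w j]; rewrite inE /union_adj /=.
apply/idP/fintype.imageP => [/andP[/andP[vw /eqP<-] Aw]|[w']]; first by exists w; rewrite ?inE ?vw.
by rewrite inE => /andP[vw Aw] [-> ->]; rewrite vw eqxx.
Qed.

Lemma union_adj_reg p : #|[pred q | union_adj p q]| = d.
Proof.
case: p => v i; rewrite -(adj_reg v).
have := card_union_nbrs predT v i; rewrite /=.
have -> : #|[pred w | adj v w & true]| = #|[pred w | adj v w]|.
  by apply: eq_card => w; rewrite !inE andbT.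
by move=> <-; apply: eq_card => w; rewrite !inE andbT.
Qed.

Lemma union_covering p : covering_at union_adj M union_labeling p <->
  covering_at adj M (G p.2) p.1.
Proof.
case: p => v i; rewrite !covering_atP.
have E q : #|[pred w | union_adj (v, i) w & union_labeling w == q]| =
    #|[pred w | adj v w & G i w == q]|.
  rewrite -(card_union_nbrs (fun w => G i w == q) v i); apply: eq_card => -[w j].
  by rewrite !inE ffunE /union_adj /=; case: eqP => [->|]; rewrite ?andbF.
by split=> H q; have := H q; rewrite E ffunE.
Qed.

Lemma error_union : error union_adj M union_labeling =
  (\sum_i #|[pred v | `[< ~ covering_at adj M (G i) v >]]|)%:R / (#|V| * k)%:R :> R.
Proof.
rewrite /error card_prod card_ord; congr (_%:R / _).
transitivity (\sum_(p : V * 'I_k) if `[< ~ covering_at adj M (G p.2) p.1 >] then 1 else 0)%N.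
  rewrite -sum1_card big_mkcond /=; apply: eq_bigr => p _; rewrite inE.
  by congr (if _ then _ else _); apply: asbool_equiv_eq; rewrite union_covering.
rewrite -(pair_bigA _ (fun v i => if `[< ~ covering_at adj M (G i) v >] then 1 else 0)%N) /=.
rewrite exchange_big /=; apply: eq_bigr => i _; rewrite -sum1_card [RHS]big_mkcond.
by apply: eq_bigr => v _; rewrite inE.
Qed.

End DisjointUnion.

Lemma not_covering_const (V : finType) (adj : rel V) t v :
  (forall v, #|[pred w | adj v w]| = d) -> M t t != d ->
  ~ covering_at adj M (fun _ : V => t) v.
Proof.
move=> adj_reg /eqP Mt /covering_atP/(_ t) E; apply: Mt; rewrite -E -(adj_reg v).
by apply: eq_card => w; rewrite !inE eqxx andbT.
Qed.

(** Otherwise all rows of [M] are concentrated on the diagonal, and two distinct labels cannot be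
    connected. *)
Lemma exists_noncovering_label : exists t, M t t != d.
Proof.
apply/existsP; rewrite -negb_forall; apply/negP => /forallP H.
have diag a b : (0 < M a b)%N -> a = b.
  move=> Mab; apply/eqP; apply: contraT => ab; have := hM a.
  rewrite (bigD1 a) //= (eqP (H a)) (bigD1 b) 1?eq_sym //=; lia.
have /card_gt1P[s [q [_ _ /negP sq]]] : (1 < #|[pred s : S | true]|)%N by rewrite cardE -cardE.
apply: sq; have /connectP[p + ->] := hconn s q.
elim: p s {q} => //= b p IH a /andP[/orP ab /IH /eqP <-].
by case: ab => /diag ->.
Qed.

Section BelowEps0.
Variables (V : finType) (v0 : V) (adj : rel V) (g : {ffun V -> S}).
Hypotheses (adjC : symmetric adj) (adj_reg : forall v, #|[pred w | adj v w]| = d).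
Hypothesis eps0_gt0 : 0 < eps0 d S delta.

(* If [s] were missed, then [k - 1] copies of [g] together with one copy of a
   constant labeling that covers nowhere would have error [1 / k], while [s]
   has density at most [1 / k]; this contradicts [density_gt_error]. *)
Lemma perfect_covering_onto : error adj M g = 0 :> R -> forall s, exists v, g v = s.
Proof.
move=> e0 s; apply: contrapT => ns; have [t Mt] := exists_noncovering_label.
have V0 : (0 < #|V|)%N by apply/card_gt0P; exists v0.
have gcov v : covering_at adj M g v.
  move: e0 => /eqP; rewrite /error mulf_eq0 invr_eq0 !pnatr_eq0.
  rewrite (negbTE (lt0n_neq0 V0)) orbF cards_eq0 => /eqP/setP/(_ v).
  by rewrite !inE asbool_neg => /negbFE/asboolP.
(* With [k] at least 2 one copy of [g] remains, while the constant copy raises the error from 0 to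
   the positive value [1 / k], to which [eps0] applies. *)
have [k k2 ke] : exists2 k : nat, (1 < k)%N & k%:R^-1 < eps0 d S delta.
  have ie0 : 0 <= (eps0 d S delta)^-1 by rewrite invr_ge0 ltW.
  have hb := archi_boundP ie0; set b := Num.bound _ in hb.
  exists b.+2 => //.
  rewrite invf_plt ?posrE //; apply: lt_le_trans hb _; rewrite ler_nat; lia.
pose G (i : 'I_k) : V -> S := if val i == 0%N then (fun=> t) else g.
have kR : 0 < k%:R :> R by rewrite ltr0n; lia.
have i1 : 'I_k := Ordinal k2.
have eE : error (union_adj adj (k := k)) M (union_labeling G) = k%:R^-1 :> R.
  rewrite error_union.
  have -> : (\sum_i #|[pred v | `[< ~ covering_at adj M (G i) v >]]| = #|V|)%N.
    rewrite (bigD1 (Ordinal (ltnW k2))) //= big1 => [|i]; rewrite ?addn0.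
      by apply: eq_card => v; rewrite !inE; apply/asboolP; exact: not_covering_const.
    rewrite -val_eqE /= => /negbTE i0; apply: eq_card0 => v; rewrite !inE /G i0.
    by apply/negbTE; rewrite asbool_neg negbK; apply/asboolP.
  by rewrite natrM invfM mulrA mulfV ?mul1r // pnatr_eq0 -lt0n.
have ne : exists v w, union_labeling G v <> union_labeling G w.
  have [v gv] : exists v, g v <> t.
    apply: contrapT => H; apply: (@not_covering_const V adj t v0 adj_reg Mt).
    have gt : g =1 (fun=> t) by move=> v; apply: contrapT => gv; apply: H; exists v.
    rewrite covering_atP => q; have /covering_atP/(_ q) := gcov v0; rewrite gt => <-.
    by apply: eq_card => w; rewrite !inE gt.
  by exists (v, Ordinal k2), (v, Ordinal (ltnW k2)); rewrite !ffunE /G.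
have := @density_gt_error _ (v0, i1) (union_adj adj (k := k)) (union_labeling G) s
  (union_adjC adjC) (union_adj_reg adj_reg) ne.
rewrite /= eE invr_gt0 => /(_ kR ke); apply/negP; rewrite -leNgt.
rewrite /density card_prod card_ord ler_pdivrMr; last by rewrite ltr0n muln_gt0 V0; lia.
rewrite natrM mulrCA mulVf ?mulr1 ?gt_eqF // ler_nat.
have inj : injective (fun w : V => (w, Ordinal (ltnW k2))) by move=> ? ? [].
rewrite -(fintype.card_image inj predT) //; apply: subset_leq_card.
apply/fintype.subsetP => -[v i]; rewrite inE ffunE /G /=.
case: ifP => [/eqP i0 _|_ /eqP gs]; last by case: ns; exists v.
by apply/fintype.imageP; exists v => //; congr (_, _); apply: val_inj.
Qed.

End BelowEps0.

Section Labels.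
Variables (V : finType) (v0 : V) (adj : rel V).
Hypotheses (adjC : symmetric adj) (adj_reg : forall v, #|[pred w | adj v w]| = d).
Hypothesis eps0_gt0 : 0 < eps0 d S delta.

Lemma covering_const t : M t t = d -> error adj M [ffun=> t] = 0 :> R.
Proof.
move=> Mt; have M0 q : q != t -> M t q = 0%N.
  by move=> qt; have := hM t; rewrite (bigD1 t) //= Mt (bigD1 q) //=; lia.
rewrite /error; apply/eqP; rewrite mulf_eq0 pnatr_eq0 cards_eq0; apply/orP; left.
apply/eqP/setP => v; rewrite !inE asbool_neg; apply/negbTE; rewrite negbK.
apply/asboolP/covering_atP => q; rewrite ffunE; have [->|qt] := eqVneq q t.
  by rewrite Mt -(adj_reg v); apply: eq_card => w; rewrite !inE ffunE eqxx andbT.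
by rewrite M0 //; apply: eq_card0 => w; rewrite !inE ffunE eq_sym (negbTE qt) andbF.
Qed.

Lemma exists_other_label (s : S) : exists t, t != s.
Proof.
have /card_gt1P[x [y [_ _ xy]]] : (1 < #|(predT : pred S)|)%N by rewrite (eq_card (B := S)).
have [xs|] := eqVneq x s; last by exists x.
by exists y; rewrite -xs eq_sym.
Qed.

(** If [M t t = d], the constant labeling [t] is a perfect covering that misses every other
    label. *)
Lemma all_labels_nonconst t : M t t != d.
Proof.
apply/negP => /eqP Mt; have [q qt] := exists_other_label t.
have [v] := perfect_covering_onto v0 adjC adj_reg eps0_gt0 (covering_const Mt) q.
by rewrite ffunE => /eqP; rewrite eq_sym (negbTE qt).
Qed.

(** A constant labeling covers nowhere, so its error is 1 and [eps0] exceeds 1. Two copies with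
    different constant labels then also have error 1, which would force each label to have density
    above 1. *)
Lemma below_eps0_nonconst (g : {ffun V -> S}) :
  error adj M g < eps0 d S delta -> exists v w, g v <> g w.
Proof.
move=> ge; apply: contrapT => H.
have V0 : (0 < #|V|)%N by apply/card_gt0P; exists v0.
have gt : g = [ffun=> g v0].
  by apply/ffunP => v; rewrite ffunE; apply: contrapT => gv; apply: H; exists v, v0.
have bad t v : ~ covering_at adj M (fun=> t) v.
  by apply: not_covering_const => //; exact: all_labels_nonconst.
have e1 : 1 < eps0 d S delta.
  apply: le_lt_trans ge; rewrite /error.
  have -> : #|[set v | `[< ~ covering_at adj M g v >]]%SET| = #|V|.
    by apply: eq_card => v; rewrite !inE gt; apply/asboolP; rewrite covering_atP => C;
      apply: (bad (g v0) v); apply/covering_atP => q; have := C q; rewrite ffunE => <-;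
      apply: eq_card => w; rewrite !inE ffunE.
  by rewrite mulfV // pnatr_eq0 -lt0n.
have [u ut] := exists_other_label (g v0).
pose G (i : 'I_2) : V -> S := fun=> if val i == 0%N then u else g v0.
have eE : error (union_adj adj (k := 2)) M (union_labeling G) = 1 :> R.
  rewrite error_union (eq_bigr (fun=> #|V|)); last first.
    move=> i _; apply: eq_card => v; rewrite !inE; apply/asboolP.
    exact: bad.
  by rewrite sum_nat_const card_ord mulnC mulfV // pnatr_eq0 -lt0n muln_gt0 V0.
have ne : exists v w, union_labeling G v <> union_labeling G w.
  exists (v0, ord0), (v0, Ordinal (ltnSn 1)); rewrite !ffunE /G /=.
  by apply/eqP.
have := @density_gt_error _ (v0, ord0) (union_adj adj (k := 2)) (union_labeling G) u
  (union_adjC adjC) (union_adj_reg adj_reg) ne.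
rewrite /= eE ltr01 => /(_ isT e1); apply/negP; rewrite -leNgt.
rewrite -(sum_density R (v0, ord0) (union_labeling G)) (bigD1 u) //= lerDl.
by apply: sumr_ge0 => q _; exact: density_ge0.
Qed.

End Labels.

End DeltaConsequences.

(** * The entropy gap of stars *)

Section GapEstimate.
Variable R : realType.
Local Open Scope ring_scope.

Lemma ln_le_subr1 (u : R) : 0 < u -> ln u <= u - 1.
Proof. by move=> u0; have := expR_ge1Dx (ln u); rewrite lnK ?posrE //; lra. Qed.

Lemma ln_ge_sub1V (u : R) : 0 < u -> 1 - u^-1 <= ln u.
Proof. by move=> u0; have := @ln_le_subr1 u^-1; rewrite invr_gt0 lnV ?posrE // => /(_ u0); lra. Qed.

Lemma ln2_gt0 : 0 < ln 2 :> R.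
Proof. by apply: ln_gt0; rewrite ltr1n. Qed.

Lemma ln16E : ln 16 = 4 * ln 2 :> R.
Proof.
have -> : 16 = 2 ^+ 4 :> R by rewrite -natrX.
by rewrite lnXn // mulr_natl.
Qed.

Lemma sub1_mul_ln_ge (x : R) : x < 1 -> - x <= (1 - x) * ln (1 - x).
Proof.
move=> x1; have u0 : 0 < 1 - x by lra.
have := ln_ge_sub1V u0; rewrite -(ler_pM2l u0) mulrBr mulr1 mulfV ?gt_eqF //; lra.
Qed.

Section Core.
Variables (a l L : R).
Hypotheses (a_ge : 1 / 4 <= a) (a_le : a <= 1 / 2) (l_ge : ln 2 <= l) (aL : a * L = l / 2).

(** Entropy gap per vertex: the first term is the gain over the independent law, the other two are
    the Fano loss at error [xi]. In the application [a] is (d-2)/(2(d-1)), [l] is log|S| and [y] is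
    p(s) p(q)^(d-1). *)
Definition gap_core (y xi : R) : R :=
  a * (15 / 16 * y - xi * ln 16) + (1 - xi) * ln (1 - xi) + xi * (ln xi - l).

Let a0 : 0 < a.
Proof. by have := a_ge; lra. Qed.

Let l0 : 0 < l. Proof. exact: lt_le_trans ln2_gt0 l_ge. Qed.

Let L0 : 0 < L.
Proof. by rewrite -(pmulr_rgt0 L a0) aL divr_gt0. Qed.

Let L_le : L <= 2 * l.
Proof. by have := ler_wpM2r (ltW L0) a_ge; rewrite aL; lra. Qed.

(** With s = sqrt x and r = sqrt L, the gain is 15/8 a r s up to order x, and the losses are of
    order x log(1/x). After division by s the claim is linear in s, where s is at most 1/(16 r);
    multiplication by 8 r and a L = l/2 leave at least 6 l - 5 log 2. *)
Lemma gap_core_sqrt (x y : R) : 0 < x -> x <= 1 / 2 ->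
  x + 2 * Num.sqrt (x * L) <= y -> 2 * Num.sqrt (x * L) <= 1 / 8 ->
  Num.sqrt x * (ln 2 / (8 * Num.sqrt L)) <= gap_core y x.
Proof.
move: a_ge a_le l_ge aL a0 l0 L0 L_le => age ale lge aLE a0' l0' L0' Lle x0 x1 hy h8.
rewrite (sqrtrM L (ltW x0)) in hy h8.
have : 0 < Num.sqrt x by rewrite sqrtr_gt0.
have : 0 < Num.sqrt L by rewrite sqrtr_gt0.
have : x = Num.sqrt x ^+ 2 by rewrite sqr_sqrtr // ltW.
have : Num.sqrt L ^+ 2 = L by rewrite sqr_sqrtr // ltW.
move: (Num.sqrt x) (Num.sqrt L) hy h8 => s r hy h8 rE xE r0 s0.
have lnx : ln x = 2 * ln s by rewrite xE lnXn // mulr_natl.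
have h1 := @sub1_mul_ln_ge x ltac:(lra).
(* Tangent of the logarithm at [s = 1 / 16]: the term [x * ln x] then costs [s / 8] besides terms of
   order [x]. *)
have lns := @ln_le_subr1 (16 * s)^-1 ltac:(by rewrite invr_gt0; lra).
rewrite lnV ?posrE ?lnM ?posrE ?ln16E // in lns; last by lra.
rewrite /gap_core ln16E lnx.
have la2 : 1 / 2 <= ln 2 :> R by have := @ln_ge_sub1V 2 ltac:(lra); lra.
move: (ln 2) (ln s) (ln (1 - x)) lge lns h1 la2 => la ls lc hl lns h1 la2.
have sV : s * (16 * s)^-1 = 1 / 16 by rewrite invfM mulrCA mulfV ?gt_eqF //; lra.
move: (16 * s)^-1 lns sV => t lns sV.
have h2 : - (2 * x * (4 * la - 1) + s / 8) <= x * (2 * ls).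
  have : x * (- ls) <= x * (4 * la + t - 1) by rewrite ler_pM2l //; lra.
  have : x * t = s / 16 by rewrite xE expr2 -mulrA sV; lra.
  lra.
set K := (a + 2) * (4 * la) - 1 + l.
have h3 : s * (15 / 8 * a * r - 1 / 8 - s * K) <=
  a * (15 / 16 * y - x * (4 * la)) + (1 - x) * lc + x * (2 * ls - l).
  have : a * (x + 2 * (s * r)) <= a * y by rewrite (ler_pM2l a0).
  have : 0 <= a * x by apply: mulr_ge0; apply: ltW.
  rewrite /K; rewrite xE in h1 h2 *; lra.
apply: le_trans h3; rewrite ler_pM2l //.
have ala : a * la <= 1 / 2 * la by rewrite ler_pM2r //; lra.
have ala0 : 0 < a * la by apply: mulr_gt0 => //; lra.
have K0 : 0 < K by rewrite /K; lra.
have sK : s * K <= K / (16 * r).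
  rewrite ler_pdivlMr; last by lra.
  have : K * (s * r) <= K * (1 / 16) by rewrite (ler_pM2l K0); lra.
  lra.
apply: le_trans (_ : 15 / 8 * a * r - 1 / 8 - K / (16 * r) <= _); last by lra.
rewrite ler_pdivrMr; last by lra.
have -> : (15 / 8 * a * r - 1 / 8 - K / (16 * r)) * (8 * r) = 15 * (a * r ^+ 2) - r - K / 2.
  by field; rewrite gt_eqF.
have hr : 2 * r <= 1 + L by rewrite -rE; have := sqr_ge0 (r - 1); rewrite sqrrB; lra.
rewrite rE aLE /K; lra.
Qed.

(** The losses are at most [C] times the square root of [xi], so a gain bounded away from 0 absorbs
    them for small [xi]. *)
Lemma gap_core_small (y0 : R) : 0 < y0 -> exists2 xi0, 0 < xi0 &
  forall xi y, 0 < xi -> xi <= xi0 -> y0 <= y -> a * y0 / 2 <= gap_core y xi.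
Proof.
move: a_ge a_le l_ge a0 l0 => age ale lge a0' l0' y00; set C := 4 * ln 2 + 3 + l.
have la0 := @ln2_gt0.
have C0 : 0 < C by rewrite /C; lra.
pose s0 : R := Num.min (1 / 2) (a * y0 / (4 * C)).
have s00 : 0 < s0.
  by rewrite lt_min; apply/andP; split; [lra | rewrite divr_gt0 ?mulr_gt0 //; lra].
have s0h : s0 <= 1 / 2 by rewrite ge_min lexx.
have s0C : s0 * C <= a * y0 / 4.
  have : s0 <= a * y0 / (4 * C) by rewrite ge_min lexx orbT.
  rewrite ler_pdivlMr; last by lra.
  by lra.
exists (s0 ^+ 2); first by rewrite exprn_gt0.
move=> xi y xi0 xis hy.
have : 0 < Num.sqrt xi by rewrite sqrtr_gt0.
have : Num.sqrt xi <= s0.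
  by rewrite -(ger0_norm (ltW s00)) -sqrtr_sqr ler_wsqrtr.
have : xi = Num.sqrt xi ^+ 2 by rewrite sqr_sqrtr // ltW.
move: (Num.sqrt xi) => s xE ss0 sp.
have lnx : ln xi = 2 * ln s by rewrite xE lnXn // mulr_natl.
have x1 : xi <= s by rewrite xE expr2 ger_pMl //; lra.
have h1 := @sub1_mul_ln_ge xi ltac:(lra).
have lns := @ln_ge_sub1V s sp.
rewrite /gap_core ln16E lnx.
have h2 : - (2 * s) <= xi * (2 * ln s).
  have : xi * (1 - s^-1) <= xi * ln s by rewrite ler_pM2l.
  have : xi * s^-1 = s by rewrite xE expr2 mulfK ?gt_eqF.
  lra.
have : s * C <= s0 * C by rewrite ler_pM2r.
have : a * y0 <= a * y by rewrite ler_pM2l.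
have : a * xi * ln 2 <= 1 / 2 * s * ln 2.
  by rewrite ler_pM2r // ler_pM //; lra.
have : xi * l <= s * l by rewrite ler_pM2r.
have : 0 < a * y0 by rewrite mulr_gt0.
have : 0 < s * ln 2 by rewrite mulr_gt0.
rewrite /C in s0C *; lra.
Qed.

End Core.
End GapEstimate.

(** * Gibbs' inequality for empirical laws *)

Section Gibbs.
Variables (R : realType) (V Z : finType) (v0 : V).
Local Open Scope ring_scope.

Lemma density_gt0 (z : V -> Z) v : 0 < density R z (z v).
Proof.
rewrite /density divr_gt0 // ltr0n; apply/card_gt0P; last by exists v0.
by exists v; rewrite inE.
Qed.

Lemma sum_by_density (z : V -> Z) (f : Z -> R) :
  \sum_v f (z v) = (#|V|)%:R * \sum_c density R z c * f c.
Proof.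
rewrite mulr_sumr (partition_big z predT) //=; apply: eq_bigr => c _.
rewrite (eq_bigr (fun=> f c)); last by move=> v /eqP->.
rewrite sumr_const /density mulrA mulrCA mulfV ?mulr1.
  by rewrite -[LHS]mulr_natl; congr (_%:R * _); apply: eq_card => v; rewrite inE.
by rewrite pnatr_eq0 -lt0n; apply/card_gt0P; exists v0.
Qed.

(** Entropies appear as sums over the sample: the right side is minus [#|V|] times the entropy of
    the empirical law of [z], the left side minus the cross entropy with the subprobability [K]. The
    proof is the bound ln u >= 1 - 1/u, termwise. *)
Lemma gibbs_le (z : V -> Z) (K : Z -> R) : (forall c, 0 <= K c) -> \sum_c K c <= 1 ->
  (forall v, 0 < K (z v)) -> \sum_v ln (K (z v)) <= \sum_v ln (density R z (z v)).
Proof.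
move=> K0 K1 Kz; rewrite -subr_ge0 -sumrB.
have nR : 0 < (#|V|)%:R :> R by rewrite ltr0n; apply/card_gt0P; exists v0.
apply: le_trans (_ : \sum_v (1 - K (z v) / density R z (z v)) <= _).
  rewrite sumrB sumr_const (sum_by_density z (fun c => K c / density R z c)) subr_ge0.
  rewrite -[leRHS]mulr1 ler_pM2l //; apply: le_trans K1; apply: ler_sum => c _.
  have [->|p0] := eqVneq (density R z c) 0; first by rewrite mul0r.
  by rewrite mulrCA mulfV // mulr1.
apply: ler_sum => v _; have p0 := density_gt0 z v.
have := @ln_ge_sub1V R (density R z (z v) / K (z v)); rewrite divr_gt0 // invf_div.
by rewrite ln_div ?posrE // => /(_ isT).
Qed.

End Gibbs.

Section LnProd.
Variable R : realType.
Local Open Scope ring_scope.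

Lemma ln_prod (I : finType) (F : I -> R) : (forall i, 0 < F i) ->
  ln (\prod_i F i) = \sum_i ln (F i).
Proof.
move=> F0; elim: (index_enum I) => [|i r IH]; first by rewrite !big_nil ln1.
by rewrite !big_cons lnM ?posrE ?IH // prodr_gt0.
Qed.

Lemma sum_prod_ffun (I J : finType) (F : I -> J -> R) :
  \sum_(f : {ffun I -> J}) \prod_i F i (f i) = \prod_i \sum_j F i j.
Proof. by rewrite bigA_distr_bigA. Qed.

Lemma sumC1_double (I : finType) (F : I -> R) :
  \sum_j \sum_(i | i != j) F i = (#|I|%:R - 1) * \sum_i F i.
Proof.
transitivity (\sum_(j : I) (\sum_i F i - F j)).
  by apply: eq_bigr => j _; rewrite [in RHS](bigD1 j) //= [X in X - _]addrC addrK.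
by rewrite sumrB sumr_const -[_ *+ _]mulr_natl mulrBl mul1r.
Qed.

End LnProd.

(** * Entropy of stars with one leaf forgotten *)

Section StarEntropy.
Variables (R : realType) (V S : finType) (d : nat) (v0 : V) (s0 : S).
Hypotheses (hd : (3 <= d)%N).
Variable tau : V -> S * {ffun 'I_d -> S}.
Local Open Scope ring_scope.

Let x v : S := (tau v).1.
Let y v i : S := (tau v).2 i.

Definition halfedge_type (h : V * 'I_d) : S * S := ((tau h.1).1, (tau h.1).2 h.2).

Variable m : V * 'I_d -> V * 'I_d.
Hypotheses (mK : involutive m)
  (mt : forall h, halfedge_type (m h) = ((halfedge_type h).2, (halfedge_type h).1)).

Let p : S -> R := density R x.
Let e : S * S -> R := density R halfedge_type.
Notation n := ((#|V|)%:R : R).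

Let i0 : 'I_d. Proof. by exists 0%N; apply: leq_trans hd. Qed.
Let h0 : V * 'I_d := (v0, i0).

Let nR : 0 < n.
Proof. by rewrite ltr0n; apply/card_gt0P; exists v0. Qed.

Let dR : 0 < d%:R :> R.
Proof. by rewrite ltr0n; apply: leq_trans hd. Qed.

(** The leaf label at a half-edge is the centre label at its partner, so reindexing by [m] turns
    leaves into centres. *)
Lemma sum_partner (f : S -> R) : \sum_v \sum_i f (y v i) = d%:R * \sum_v f (x v).
Proof.
rewrite pair_big /=.
transitivity (\sum_(h : V * 'I_d) f (x h.1)).
  rewrite (reindex m) /=; last by exists m => h _; apply: mK.
  by apply: eq_bigr => h _; have := congr1 snd (mt h); rewrite /= /x /y => ->.
rewrite -(pair_big xpredT xpredT (fun v _ => f (x v))) /= exchange_big /= sumr_const card_ord.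
by rewrite mulr_natl.
Qed.

Lemma sum_edge_density a : \sum_b e (a, b) = p a.
Proof.
rewrite /e /p /density -mulr_suml -natr_sum card_prod card_ord.
have -> : (\sum_b #|[pred h | halfedge_type h == (a, b)]| = #|[pred v | x v == a]| * d)%N.
  transitivity #|[predX [pred v | x v == a] & 'I_d]|; last by rewrite cardX card_ord.
  rewrite -sum1_card (partition_big (fun h => (halfedge_type h).2) predT) //=.
  apply: eq_bigr => b _; rewrite -sum1_card; apply: eq_bigl => -[v i].
  by rewrite !inE /halfedge_type /= xpair_eqE andbT.
by rewrite !natrM; field; rewrite !gt_eqF.
Qed.

Let pv v : 0 < p (x v). Proof. exact: density_gt0. Qed.
Let ev_gt0 v i : 0 < e (x v, y v i).
Proof. exact: (density_gt0 R h0 halfedge_type (v, i)). Qed.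
Let py v i : 0 < p (y v i).
Proof. by have E : x (m (v, i)).1 = y v i := congr1 fst (mt (v, i)); rewrite -E. Qed.
Let p_ge0 a : 0 <= p a. Proof. exact: density_ge0. Qed.
Let e_ge0 a : 0 <= e a. Proof. exact: density_ge0. Qed.
Let sum_p : \sum_a p a = 1. Proof. exact: sum_density. Qed.

(** Leaf [j] is overwritten by [s0] rather than removed, so that truncated stars stay in the type of
    stars. *)
Definition forget (j : 'I_d) (c : S * {ffun 'I_d -> S}) : S * {ffun 'I_d -> S} :=
  (c.1, [ffun i => if i == j then s0 else c.2 i]).

Let r j v := forget j (tau v).
Let Rj j : R := \sum_v ln (density R (r j) (r j v)).

(** Total mass of a product law on truncated stars, with a point mass at [s0] on leaf [j]; it
    normalises both comparison laws. *)
Lemma sum_star_product j (F : S -> R) (G : S -> S -> R) :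
  \sum_(c : S * {ffun 'I_d -> S}) F c.1 *
    \prod_i (if i == j then (c.2 i == s0)%:R else G c.1 (c.2 i)) =
  \sum_a F a * \prod_(i | i != j) \sum_b G a b.
Proof.
rewrite -(pair_bigA _ (fun a (f : {ffun 'I_d -> S}) => F a *
  \prod_i (if i == j then (f i == s0)%:R else G a (f i)))) /=; apply: eq_bigr => a _.
rewrite -mulr_sumr (sum_prod_ffun (fun i b => if i == j then (b == s0)%:R else G a b)).
rewrite (bigD1 j) //= eqxx (bigD1 s0) //= eqxx big1 => [|b /negbTE->//].
rewrite addr0 mul1r; congr (_ * _); apply: eq_bigr => i /negbTE ij.
by apply: eq_bigr => b _; rewrite ij.
Qed.

Lemma star_product_forget j (G : S -> S -> R) v :
  \prod_i (if i == j then ((r j v).2 i == s0)%:R else G (r j v).1 ((r j v).2 i)) =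
  \prod_i (if i == j then 1 else G (x v) (y v i)).
Proof.
apply: eq_bigr => i _; rewrite /r /forget /= ffunE.
by case: eqP => // _; rewrite eqxx.
Qed.

(** Comparison with the law that draws the centre from [p] and the remaining leaves independently
    from the transition probabilities [e (a, b) / p a]. *)
Lemma entropy_markov j :
  \sum_v (ln (p (x v)) + \sum_(i | i != j) (ln (e (x v, y v i)) - ln (p (x v)))) <= Rj j.
Proof.
pose G a b : R := e (a, b) / p a.
pose K (c : S * {ffun 'I_d -> S}) : R := p c.1 *
    \prod_i (if i == j then (c.2 i == s0)%:R else G c.1 (c.2 i)).
have G0 a b : 0 <= G a b by rewrite divr_ge0.
have Gv v i : 0 < G (x v) (y v i) by rewrite divr_gt0.
have Kr v : K (r j v) = p (x v) * \prod_i (if i == j then 1 else G (x v) (y v i)).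
  by rewrite /K star_product_forget.
have pos v i : 0 < (if i == j then 1 else G (x v) (y v i)) by case: eqP.
have -> : \sum_v (ln (p (x v)) + \sum_(i | i != j) (ln (e (x v, y v i)) - ln (p (x v)))) =
    \sum_v ln (K (r j v)).
  apply: eq_bigr => v _; rewrite Kr lnM ?posrE //; last exact: prodr_gt0.
  rewrite ln_prod // [in RHS](bigD1 j) //= eqxx ln1 add0r; congr (_ + _).
  by apply: eq_bigr => i /negbTE->; rewrite /G ln_div // posrE.
apply: gibbs_le => //.
- by move=> c; rewrite mulr_ge0 // prodr_ge0 // => i _; case: ifP.
- rewrite /K sum_star_product -[leRHS]sum_p; apply: ler_sum => a _.
  rewrite ler_piMr // prodr_ile1 // => i _; rewrite sumr_ge0 //= -mulr_suml sum_edge_density.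
  by have [->|pa] := eqVneq (p a) 0; rewrite ?mul0r // mulfV.
- by move=> v; rewrite Kr mulr_gt0 //; apply: prodr_gt0 => i _; exact: pos.
Qed.

(* Gibbs' inequality against the independent law, reweighted by 1/16 on the
   pattern: a covering with [M s q <= d - 2] never shows it, and this costs the
   independent law the mass [15 / 16 * (p s * p q ^+ d.-1)]. *)
Lemma entropy_independent j (s q : S) (xi : R) :
  (#|[pred v | (x v == s) && [forall i, (i != j) ==> (y v i == q)]]|)%:R <= xi * n ->
  \sum_v (ln (p (x v)) + \sum_(i | i != j) ln (p (y v i))) +
    n * (15 / 16 * (p s * p q ^+ d.-1) - xi * ln 16) <= Rj j.
Proof.
move=> hxi; set Y := p s * p q ^+ d.-1.
pose A (c : S * {ffun 'I_d -> S}) := (c.1 == s) && [forall i, (i != j) ==> (c.2 i == q)].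
have p_le1 a : p a <= 1.
  by rewrite -sum_p (bigD1 a) //= lerDl sumr_ge0.
have Y1 : Y <= 1 by rewrite /Y mulr_ile1 // ?exprn_ge0 // exprn_ile1.
pose Z : R := 1 - 15 / 16 * Y.
have Z0 : 0 < Z by rewrite /Z; lra.
pose K0 (c : S * {ffun 'I_d -> S}) : R := p c.1 *
    \prod_i (if i == j then (c.2 i == s0)%:R else p (c.2 i)).
pose K c := K0 c * (if A c then 1 / 16 else 1) / Z.
have K00 c : 0 <= K0 c by rewrite mulr_ge0 // prodr_ge0 // => i _; case: ifP.
have sumK0 : \sum_c K0 c = 1.
  rewrite /K0 (sum_star_product j p (fun=> p)) -[RHS]sum_p; apply: eq_bigr => a _.
  by rewrite big1 ?mulr1 // => i _; exact: sum_p.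
have sumK0A : \sum_(c | A c) K0 c = Y.
  pose c0 : S * {ffun 'I_d -> S} := (s, [ffun i => if i == j then s0 else q]).
  have Ac0 : A c0.
    rewrite /A eqxx; apply/forallP => i; apply/implyP => /negbTE ij.
    by rewrite ffunE ij.
  rewrite (bigD1 c0) //= big1 => [|c /andP[/andP[/eqP cs /forallP cq] cc0]].
    rewrite addr0 /K0 /Y /= (bigD1 j) //= eqxx ffunE !eqxx mul1r; congr (_ * _).
    rewrite (eq_bigr (fun=> p q)); last by move=> i /negbTE ij; rewrite ffunE ij.
    by rewrite prodr_const cardC1 card_ord.
  rewrite /K0 (bigD1 j) //= eqxx; case: eqP => [cj|]; last by rewrite mul0r mulr0.
  case/eqP: cc0; case: c cs cq cj => a f /= -> cq cj; congr (_, _); apply/ffunP => i.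
  by rewrite ffunE; case: eqP => [->//|/eqP ij]; have := cq i; rewrite ij => /eqP.
have Kr v : K0 (r j v) = p (x v) * \prod_i (if i == j then 1 else p (y v i)).
  by rewrite /K0 -(star_product_forget j (fun=> p)).
have pos v i : 0 < (if i == j then 1 else p (y v i)) by case: eqP.
have K0r v : 0 < K0 (r j v).
  by rewrite Kr mulr_gt0 //; apply: prodr_gt0 => i _; exact: pos.
have Ar v : A (r j v) = (x v == s) && [forall i, (i != j) ==> (y v i == q)].
  rewrite /A /r /forget /=; congr (_ && _); apply: eq_forallb => i.
  by rewrite ffunE; case: eqP.
have lnK v : ln (K (r j v)) = ln (p (x v)) + \sum_(i | i != j) ln (p (y v i)) +
    (- (((x v == s) && [forall i, (i != j) ==> (y v i == q)])%:R * ln 16) - ln Z).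
  rewrite /K lnM ?posrE ?invr_gt0 //; last by rewrite mulr_gt0 //; case: ifP.
  rewrite lnV ?posrE // lnM ?posrE //; last by case: ifP.
  rewrite Kr lnM ?posrE //; last exact: prodr_gt0.
  rewrite ln_prod // (bigD1 j) //= eqxx ln1 add0r Ar -!addrA; congr (_ + (_ + _)).
    by apply: eq_bigr => i /negbTE->.
  case: (_ && _); rewrite /= ?mulr1n ?mulr0n ?mul0r ?ln1 ?oppr0 // div1r mul1r.
  by rewrite lnV // posrE.
apply: le_trans (_ : \sum_v ln (K (r j v)) <= _); last first.
  apply: gibbs_le => //.
  - move=> c; rewrite divr_ge0 ?(ltW Z0) // mulr_ge0 //; case: ifP => _; lra.
  - rewrite /K -mulr_suml ler_pdivrMr // mul1r (bigID A) /=.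
    rewrite (eq_bigr (fun c => K0 c * (1 / 16))); last by move=> c ->; rewrite div1r.
    rewrite [X in _ + X](eq_bigr K0); last by move=> c /negbTE->; rewrite mulr1.
    have := sumK0; rewrite (bigID A) /= sumK0A -mulr_suml sumK0A /Z; lra.
  - by move=> v; rewrite divr_gt0 // mulr_gt0 //; case: ifP => _; lra.
rewrite (eq_bigr _ (fun v _ => lnK v)) [leRHS]big_split /= lerD2l.
rewrite sumrB sumr_const sumrN -mulr_suml -natr_sum.
have -> : (\sum_v ((x v == s) && [forall i, (i != j) ==> (y v i == q)]) =
   #|[pred v | (x v == s) && [forall i, (i != j) ==> (y v i == q)]]|)%N.
  by rewrite -sum1_card [RHS]big_mkcond /=; apply: eq_bigr => v _; rewrite inE; case: (_ && _).
have l16 : 0 <= ln 16 :> R by apply: ln_ge0; lra.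
(* The gain is [- ln Z], which is at least [15 / 16 * Y]. *)
have lnZ := @ln_le_subr1 R Z Z0.
have h1 := ler_wpM2r l16 hxi.
have h2 : n * ln Z <= n * (Z - 1) by rewrite ler_pM2l.
rewrite -[X in _ <= _ - X]mulr_natl; move: h2; rewrite /Z; lra.
Qed.

Variable M : S -> S -> nat.

Definition star_covering (c : S * {ffun 'I_d -> S}) : bool :=
  [forall q, #|[pred i | c.2 i == q]| == M c.1 q].

(** At a covering star the centre fixes the multiset of leaf labels, so all leaves but one determine
    the last. *)
Lemma star_covering_inj j (c c' : S * {ffun 'I_d -> S}) :
  star_covering c -> star_covering c' -> forget j c = forget j c' -> c = c'.
Proof.
case: c c' => [a f] [a' f'] /forallP /= H /forallP /= H' [aa /ffunP ff]; subst a'.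
have ffi i : i != j -> f i = f' i.
  by move=> /negbTE ij; have := ff i; rewrite !ffunE ij.
congr (_, _); apply/ffunP => i; have [->|/ffi//] := eqVneq i j.
apply/eqP; apply: contraT => fj.
have : #|[pred i | f i == f j]| = #|[pred i | f' i == f j]|.
  by rewrite (eqP (H _)) (eqP (H' _)).
rewrite (cardD1 j) [in RHS](cardD1 j) !inE eqxx eq_sym (negbTE fj).
have -> : #|[predD1 [pred i | f i == f j] & j]| = #|[predD1 [pred i | f' i == f j] & j]|.
  by apply: eq_card => k; rewrite !inE; case: eqP => //= /eqP/ffi ->.
by move=> /esym/n_Sn.
Qed.

Lemma card_forget_fiber j c0 : (#|[pred c | forget j c == c0]| <= #|S|)%N.
Proof.
rewrite -(card_in_image (f := fun c : S * {ffun 'I_d -> S} => c.2 j)); first exact: max_card.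
move=> [a f] [a' f']; rewrite !inE => /eqP <- /eqP[-> /ffunP ff] /= fj.
congr (_, _); apply/ffunP => i; have [->//|/negbTE ij] := eqVneq i j.
by have := ff i; rewrite !ffunE ij.
Qed.

(* At a covering star the forgotten label is determined by the others, so that
   forgetting it costs at most the entropy bound of Fano's inequality. *)
Lemma entropy_determined j (xi : R) : 0 < xi -> xi <= 1 / 2 ->
  (#|[pred v | ~~ star_covering (tau v)]|)%:R <= xi * n ->
  Rj j + n * ((1 - xi) * ln (1 - xi) + xi * (ln xi - ln (#|S|)%:R)) <=
  \sum_v ln (density R tau (tau v)).
Proof.
move=> xi0 xi1 hxi.
have kR : 1 <= (#|S|)%:R :> R by rewrite ler1n; apply/card_gt0P; exists s0.
have kR0 : 0 < (#|S|)%:R :> R by apply: lt_le_trans kR.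
have b0 : 0 < xi / (#|S|)%:R by rewrite divr_gt0.
have bxi : xi / (#|S|)%:R <= xi by rewrite ler_pdivrMr // ler_pMr.
(* A conditional law on the fibres of [forget j]: weight [1 - xi] for the covering star, of which
   there is at most one, and [xi] spread over at most [#|S|] stars. *)
pose kap c : R := if star_covering c then 1 - xi else xi / (#|S|)%:R.
have kap0 c : 0 < kap c by rewrite /kap; case: ifP => // _; lra.
pose D := density R (r j).
pose K c := D (forget j c) * kap c.
have D0 v : 0 < D (r j v) by apply: density_gt0.
apply: le_trans (_ : \sum_v ln (K (tau v)) <= _); last first.
  apply: gibbs_le => //.
  - by move=> c; rewrite mulr_ge0 ?density_ge0 // ltW.
  - rewrite /K (partition_big (forget j) predT) //=.
    rewrite -(sum_density R v0 (r j)); apply: ler_sum => c _.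
    rewrite (eq_bigr (fun c' => D c * kap c')); last by move=> c' /eqP->.
    rewrite -mulr_sumr ler_piMr ?density_ge0 //.
    apply: le_trans (_ : \sum_(c' | forget j c' == c) (xi / (#|S|)%:R +
       (star_covering c')%:R * (1 - xi)) <= _).
      apply: ler_sum => c' _; rewrite /kap; case: ifP => _; rewrite ?mul1r ?mul0r ?addr0 //; lra.
    rewrite big_split /= sumr_const -mulr_suml -natr_sum.
    have c1 : (\sum_(c' | forget j c' == c) star_covering c' <= 1)%N.
      have [/existsP[c0 /andP[/eqP f0 g0]]|/existsPn none] :=
          boolP [exists c', (forget j c' == c) && star_covering c'].
        rewrite (bigD1 c0) ?f0 //= g0 big1 // => c' /andP[/eqP f' c'0].
        apply/eqP; rewrite eqb0; apply: contraNN c'0 => g'.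
        by apply/eqP; apply: (@star_covering_inj j _ _ g' g0); rewrite f' f0.
      rewrite big1 // => c' fc'; apply/eqP; rewrite eqb0.
      by have := none c'; rewrite fc'.
    have c2 : xi / (#|S|)%:R *+ #|[pred c' | forget j c' == c]| <= xi.
      rewrite -[leLHS]mulr_natr mulrAC ler_pdivrMr // ler_pM2l // ler_nat.
      exact: card_forget_fiber.
    have c3 : (\sum_(c' | forget j c' == c) star_covering c')%:R * (1 - xi) <= 1 - xi.
      by rewrite ler_piMl ?lern1 //; lra.
    apply: le_trans (lerD c2 c3) _; lra.
  - by move=> v; rewrite /K mulr_gt0 //; exact: D0.
rewrite (eq_bigr (fun v => ln (D (r j v)) + ln (kap (tau v)))); last first.
  by move=> v _; rewrite /K lnM // posrE //; exact: D0.
rewrite [leRHS]big_split /= lerD2l.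
pose B := #|[pred v | ~~ star_covering (tau v)]|.
have -> : \sum_v ln (kap (tau v)) = (n - B%:R) * ln (1 - xi) + B%:R * ln (xi / (#|S|)%:R).
  rewrite (bigID (fun v => star_covering (tau v))) /=.
  rewrite (eq_bigr (fun=> ln (1 - xi))); last by move=> v; rewrite /kap => ->.
  rewrite [X in _ + X](eq_bigr (fun=> ln (xi / (#|S|)%:R))); last first.
    by move=> v; rewrite /kap => /negbTE->.
  rewrite !sumr_const -[ln (1 - xi) *+ _]mulr_natl -[ln (xi / _) *+ _]mulr_natl.
  congr (_ * _ + _ * _).
    rewrite -(cardC [pred v | star_covering (tau v)]) natrD.
    by rewrite addrK; congr _%:R; apply: eq_card => v; rewrite inE.
(* As [xi] is at most [1 / 2], non-covering stars weigh less, and the worst case is a proportion of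
   exactly [xi] of them. *)
have lnle : ln (xi / (#|S|)%:R) <= ln (1 - xi) by rewrite ler_ln ?posrE //; lra.
rewrite -ln_div ?posrE //.
have : (xi * n - B%:R) * (ln (1 - xi) - ln (xi / #|S|%:R)) >= 0.
  by rewrite mulr_ge0 // subr_ge0.
lra.
Qed.

(** The Markov and the independent bound, summed over [j] and taken with weights d and d - 2, cancel
    the vertex term [U] and bound 2(d-1) [SR] below by d(d-1) [E] plus d(d-2) n [Q]. Inserting this
    in the Fano bound and dividing by 2d(d-1) produces the coefficient 1/2 of [E] and the factor
    (d-2)/(2(d-1)). *)
Lemma star_entropy_gap (s q : S) (xi : R) : 0 < xi -> xi <= 1 / 2 ->
  (M s q <= d - 2)%N ->
  (#|[pred v | ~~ star_covering (tau v)]|)%:R <= xi * n ->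
  n * gap_core ((d%:R - 2) / (2 * (d%:R - 1))) (ln (#|S|)%:R) (p s * p q ^+ d.-1) xi <=
  \sum_v ln (density R tau (tau v)) - 2^-1 * \sum_v \sum_i ln (e (x v, y v i)).
Proof.
move=> xi0 xi1 Msq hxi.
set CC := \sum_v ln (density R tau (tau v)); set E := \sum_v \sum_i _.
set eta := (1 - xi) * ln (1 - xi) + xi * (ln xi - ln (#|S|)%:R).
set U := \sum_v ln (p (x v)).
set Q := 15 / 16 * (p s * p q ^+ d.-1) - xi * ln 16.
pose SR := \sum_j Rj j.
have dd : 3 <= d%:R :> R by rewrite ler_nat.
have cI : #|'I_d|%:R = d%:R :> R by rewrite card_ord.
have cT : #|(xpredT : pred 'I_d)| = d by rewrite -[RHS](card_ord d); apply: eq_card.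
have G1 : d%:R * U + (d%:R - 1) * (E - d%:R * U) <= SR.
  apply: le_trans (ler_sum _ (fun j _ => entropy_markov j)).
  rewrite exchange_big /= -[X in X * U]cI.
  under eq_bigr => v _ do rewrite big_split /= sumr_const sumC1_double sumrB sumr_const.
  by rewrite big_split /= -mulr_sumr sumrB -/E !sumrMnl -/U cI cT -[U *+ _]mulr_natl.
have G2 : d%:R * U + (d%:R - 1) * (d%:R * U) + d%:R * n * Q <= SR.
  (* A covering star with centre [s] has at most [d - 2] leaves labelled [q], while the pattern has
     at least [d - 1]; so the pattern occurs only at non-covering stars. *)
  have bad_sub j : (#|[pred v | (x v == s) && [forall i, (i != j) ==> (y v i == q)]]|)%:R <= xi * n.
    apply: le_trans hxi; rewrite ler_nat; apply: subset_leq_card; apply/fintype.subsetP => v.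
    rewrite !inE => /andP[/eqP xs /forallP yq]; apply/negP => /forallP/(_ q) /eqP E'.
    have : (#|[predD1 'I_d & j]| <= M s q)%N.
      rewrite -xs -[M _ _]E'; apply: subset_leq_card; apply/fintype.subsetP => i.
      by rewrite !inE andbT => ij; have := yq i; rewrite ij.
    have := cardD1 j 'I_d; rewrite card_ord inE /= => dE.
    move: dE hd Msq; set w := #|_|; lia.
  apply: le_trans (ler_sum _ (fun j _ => entropy_independent (bad_sub j))).
  rewrite big_split /= sumr_const cT exchange_big /= -[(n * _) *+ _]mulr_natl mulrA lerD2r.
  under eq_bigr => v _ do rewrite big_split /= sumr_const sumC1_double.
  by rewrite big_split /= -mulr_sumr (sum_partner (fun b => ln (p b))) -/U cI sumrMnl cT -[U *+ _]mulr_natl.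
have G3 : SR + d%:R * n * eta <= d%:R * CC.
  have : \sum_j (Rj j + n * eta) <= \sum_(j < d) CC.
    by apply: ler_sum => j _; exact: entropy_determined.
  by rewrite big_split /= !sumr_const -[CC *+ _]mulr_natl -[(n * eta) *+ _]mulr_natl !card_ord !mulrA.
have -> : gap_core ((d%:R - 2) / (2 * (d%:R - 1))) (ln (#|S|)%:R) (p s * p q ^+ d.-1) xi =
    (d%:R - 2) / (2 * (d%:R - 1)) * Q + eta by rewrite /gap_core -!addrA.
move: G1 G2 G3; move: (d%:R : R) dd n nR => D dd N N0 G1 G2 G3.
rewrite -subr_ge0 -(pmulr_rge0 _ (_ : 0 < 2 * D * (D - 1))); last by rewrite !mulr_gt0 //; lra.
have -> : 2 * D * (D - 1) * (CC - 2^-1 * E - N * ((D - 2) / (2 * (D - 1)) * Q + eta)) =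
  2 * (D - 1) * (D * CC) - D * ((D - 1) * E) - D * (D - 2) * (N * Q) - 2 * (D - 1) * (D * N * eta).
  by field; lra.
have h3 : 2 * (D - 1) * (SR + D * N * eta) <= 2 * (D - 1) * (D * CC).
  by rewrite ler_pM2l //; lra.
have h1 : D * (D * U + (D - 1) * (E - D * U)) <= D * SR by rewrite ler_pM2l //; lra.
have h2 : (D - 2) * (D * U + (D - 1) * (D * U) + D * N * Q) <= (D - 2) * SR.
  by rewrite ler_pM2l //; lra.
lra.
Qed.

End StarEntropy.

(** * Counting configurations *)

Section Matchings.
Variables (H T : finType) (t : H -> T) (sw : T -> T).
Hypothesis swK : involutive sw.

(** Perfect matchings of [A] compatible with the types, as involutions of the whole of [H] that are
    the identity off [A]. Removing a matched pair is then multiplication by a transposition. *)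
Definition matching (A : {set H}) (m : {perm H}) : bool :=
  [forall z, (m (m z) == z) &&
    (if z \in A then [&& m z \in A, m z != z & t (m z) == sw (t z)] else m z == z)].

Definition matchings (A : {set H}) : {set {perm H}} := [set m | matching A m].

Lemma matchingP (A : {set H}) (m : {perm H}) : reflect
  [/\ involutive m, forall z, z \in A -> [/\ m z \in A, m z != z & t (m z) = sw (t z)] &
      forall z, z \notin A -> m z = z] (matching A m).
Proof.
apply: (iffP forallP) => [K|[K1 K2 K3] z].
  split=> z; have /andP[/eqP E] := K z; first by [].
    by move=> + zA; rewrite zA => /and3P[-> -> /eqP].
  by move=> + zA; rewrite (negbTE zA) => /eqP.
rewrite K1 eqxx /=; case: ifP => [/K2[-> -> ->]|/negbT/K3->]; by rewrite eqxx.
Qed.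

Lemma matching_tperm (A : {set H}) x y (m : {perm H}) : x \in A -> y \in A -> x != y -> t y = sw (t x) ->
  matching (A :\ x :\ y) (m * tperm x y)%g = matching A m && (m x == y).
Proof.
move=> xA yA xy ty.
apply/idP/idP => [/matchingP[K1 K2 K3]|/andP[/matchingP[K1 K2 K3] /eqP mx]].
  set m' := (m * tperm x y)%g in K1 K2 K3.
  have mE z : m z = tperm x y (m' z) by rewrite permM tpermK.
  have m'x : m' x = x by apply: K3; rewrite !inE eqxx andbF.
  have m'y : m' y = y by apply: K3; rewrite !inE eqxx.
  have mx : m x = y by rewrite mE m'x tpermL.
  have my : m y = x by rewrite mE m'y tpermR.
  have mz z : z != x -> z != y -> m z = m' z.
    by move=> zx zy; rewrite mE tpermD // eq_sym -1?[X in _ != X]m'x -1?[X in _ != X]m'y (inj_eq perm_inj).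
  rewrite mx eqxx andbT; apply/matchingP; split.
  - move=> z; have [->|zx] := eqVneq z x; first by rewrite mx my.
    have [->|zy] := eqVneq z y; first by rewrite my mx.
    by rewrite (mz z) // mz ?K1 // -1?[X in _ != X]m'x -1?[X in _ != X]m'y (inj_eq perm_inj).
  - move=> z zA; have [->|zx] := eqVneq z x; first by rewrite mx yA eq_sym xy ty.
    have [->|zy] := eqVneq z y; first by rewrite my xA xy ty swK.
    have zA' : z \in A :\ x :\ y by rewrite !inE zx zy zA.
    by have [] := K2 z zA'; rewrite mz // !inE => /and3P[].
  - move=> z zA; rewrite mz ?K3 ?inE ?(negbTE zA) ?andbF //.
      by apply: contraNneq zA => ->.
    by apply: contraNneq zA => ->.
have my : m y = x by rewrite -mx K1.
set m' := (m * tperm x y)%g.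
have m'x : m' x = x by rewrite permM mx tpermR.
have m'y : m' y = y by rewrite permM my tpermL.
have mz z : z != x -> z != y -> m' z = m z.
  move=> zx zy; rewrite permM tpermD // eq_sym.
    by rewrite -my (inj_eq perm_inj).
  by rewrite -mx (inj_eq perm_inj).
have mzx z : z != x -> z != y -> (m z != x) && (m z != y).
  move=> zx zy; apply/andP; split; first by rewrite -my (inj_eq perm_inj).
  by rewrite -mx (inj_eq perm_inj).
apply/matchingP; split.
- move=> z; have [->|zx] := eqVneq z x; first by rewrite !m'x.
  have [->|zy] := eqVneq z y; first by rewrite !m'y.
  by have /andP[] := mzx z zx zy => ? ?; rewrite (mz z) // mz // K1.
- move=> z; rewrite !inE => /and3P[zy zx /K2[mzA zz tz]].
  have /andP[h1 h2] := mzx z zx zy.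
  by rewrite mz // h1 h2 mzA zz.
- move=> z; rewrite !inE; have [->|zx] := eqVneq z x; first by rewrite m'x.
  have [->|zy] := eqVneq z y; first by rewrite m'y.
  by move=> /= zA; rewrite mz // K3.
Qed.

Lemma card_matchings_rec (A : {set H}) x : x \in A ->
  #|matchings A| = \sum_(y in A :\ x | t y == sw (t x)) #|matchings (A :\ x :\ y)|.
Proof.
move=> xA; rewrite -sum1_card.
rewrite (partition_big (fun m : {perm H} => m x) (fun y => (y \in A :\ x) && (t y == sw (t x)))) /=; last first.
  move=> m; rewrite inE => /matchingP[_ /(_ x xA)[mA mx ->] _].
  by rewrite !inE mA mx eqxx.
apply: eq_bigr => y; rewrite !inE => /andP[/andP[yx yA] /eqP ty].
rewrite -sum1_card [RHS](reindex_inj (mulIg (tperm x y))) /=.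
by apply: eq_bigl => m; rewrite !inE matching_tperm // eq_sym.
Qed.

Lemma matchings0 : #|matchings (finset.set0 : {set H})| = 1.
Proof.
apply/eqP/cards1P; exists 1%g; apply/setP => m; rewrite !inE.
apply/matchingP/eqP => [[_ _ K]|->].
  by apply/permP => z; rewrite K ?inE // perm1.
by split=> z; rewrite ?perm1 // inE.
Qed.

Definition type_count (A : {set H}) (a : T) : nat := #|[set z in A | t z == a]|.

Lemma prod_fact_D1 (A : {set H}) x : x \in A ->
  \prod_a (type_count A a)`! = type_count A (t x) * \prod_a (type_count (A :\ x) a)`!.
Proof.
move=> xA; rewrite (bigD1 (t x)) //= [in RHS](bigD1 (t x)) //= mulnA; congr (_ * _).
  rewrite /type_count (cardsD1 x) !inE xA eqxx add1n factS; congr (_ * _`!).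
  by apply: eq_card => z; rewrite !inE andbA.
apply: eq_bigr => a ax; congr _`!; apply: eq_card => z; rewrite !inE.
by have [->|] := eqVneq z x; rewrite // eq_sym (negbTE ax) andbF.
Qed.

Lemma type_count_swap (A : {set H}) (m : {perm H}) x : matching A m -> type_count A (sw (t x)) <= type_count A (t x).
Proof.
move=> /matchingP[K1 K2 _]; rewrite /type_count -(card_imset _ (@perm_inj _ m)).
apply: subset_leq_card; apply/fintype.subsetP => _ /imsetP[z + ->].
by rewrite !inE => /andP[/K2[-> _ ->] /eqP->]; rewrite swK eqxx.
Qed.

Lemma sum_sqr_le (I : finType) (P : pred I) (F : I -> nat) B :
  (forall i, P i -> F i ^ 2 <= B) -> (\sum_(i in P) F i) ^ 2 <= #|P| ^ 2 * B.
Proof.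
move=> FB; have -> : #|P| ^ 2 * B = \sum_(i in P) \sum_(j in P) B.
  by rewrite !sum_nat_const mulnA mulnn.
rewrite -mulnn big_distrlr; apply: leq_sum => i Pi; apply: leq_sum => j Pj.
case/orP: (leq_total (F i) (F j)) => h.
  by apply: leq_trans (FB j Pj); rewrite -mulnn leq_mul.
by apply: leq_trans (FB i Pi); rewrite -mulnn leq_mul.
Qed.

Lemma sum_sqr_ge (I : finType) (P : pred I) (F : I -> nat) B c :
  (forall i, P i -> B <= c * F i ^ 2) -> #|P| ^ 2 * B <= c * (\sum_(i in P) F i) ^ 2.
Proof.
move=> FB; have -> : #|P| ^ 2 * B = \sum_(i in P) \sum_(j in P) B.
  by rewrite !sum_nat_const mulnA mulnn.
rewrite -[(\sum_(i in P) F i) ^ 2]mulnn big_distrlr big_distrr.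
apply: leq_sum => i Pi; rewrite big_distrr; apply: leq_sum => j Pj.
case/orP: (leq_total (F i) (F j)) => h.
  by apply: leq_trans (FB i Pi) _; rewrite -mulnn leq_mul2l leq_mul ?orbT.
by apply: leq_trans (FB j Pj) _; rewrite -mulnn leq_mul2l leq_mul ?orbT.
Qed.

(** Squaring replaces double factorials by factorials. Removing [x] and a partner divides the
    product by [type_count A (t x) * #|P|], where [P] is the set of possible partners, and the
    square of the count by at most [#|P| ^ 2]; and [#|P| <= type_count A (t x)] once a matching
    exists. *)
Lemma card_matchings_le (A : {set H}) : #|matchings A| ^ 2 <= \prod_a (type_count A a)`!.
Proof.
elim: {A}_.+1 {-2}A (ltnSn #|A|) => // n IH A /ltnSE An.
have [->|[x xA]] := set_0Vmem A.
  by rewrite matchings0 exp1n prodn_gt0 // => a; exact: fact_gt0.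
have [->|[m]] := set_0Vmem (matchings A); first by rewrite cards0.
rewrite inE => mA; rewrite (card_matchings_rec xA) (prod_fact_D1 xA).
set P := fun y => (y \in A :\ x) && (t y == sw (t x)).
have PE y : P y -> \prod_a (type_count (A :\ x) a)`! = #|P| * \prod_a (type_count (A :\ x :\ y) a)`!.
  move=> /andP[yA /eqP ty]; rewrite (prod_fact_D1 yA) ty; congr (_ * _).
  by apply: eq_card => z; rewrite inE.
have [y0 Py0|P0] := pickP P; last by rewrite big_pred0.
set B := \prod_a (type_count (A :\ x :\ y0) a)`!.
have P1 : 0 < #|P| by apply/card_gt0P; exists y0.
apply: (@leq_trans (#|P| ^ 2 * B)).
  apply: sum_sqr_le => y Py; apply: leq_trans (IH _ _) _.
    move: An; rewrite (cardsD1 x) xA (cardsD1 y); move/andP: Py => [-> _]; lia.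
  by rewrite -(leq_pmul2l P1) -(PE y Py) (PE y0 Py0).
rewrite (PE y0 Py0) mulnA leq_mul2r -mulnn leq_mul2r; apply/orP; right; apply/orP; right.
apply: leq_trans (type_count_swap x mA); apply: subset_leq_card.
by apply/fintype.subsetP => z; rewrite !inE /P => /andP[]; rewrite !inE => /andP[_ ->] ->.
Qed.

End Matchings.

Section AllMatchings.
Variable H : finType.
Notation all_matchings := (matchings (fun _ : H => tt) id).

(** For even N the count is (N-1)!!, whose square falls short of N! by a factor of at most N + 1. *)
Lemma card_all_matchings (A : {set H}) :
  (odd #|A| -> #|all_matchings A| = 0) /\
  (~~ odd #|A| -> (#|A|)`! <= #|A|.+1 * #|all_matchings A| ^ 2).
Proof.
elim: {A}_.+1 {-2}A (ltnSn #|A|) => // n IH A /ltnSE An.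
have [->|[x xA]] := set_0Vmem A; first by rewrite matchings0 cards0.
rewrite (@card_matchings_rec H unit (fun=> tt) id (fun=> erefl) A x xA).
have cA : #|A| = #|A :\ x|.+1 by rewrite (cardsD1 x A) xA.
have cAy y : (y \in A :\ x) -> #|A :\ x| = #|A :\ x :\ y|.+1.
  by move=> yA; rewrite (cardsD1 y (A :\ x)) yA.
have IHy y : y \in A :\ x -> _ := fun yA => IH (A :\ x :\ y) ltac:(rewrite cA (cAy y yA) in An; lia).
split=> par.
  rewrite big1 // => y /andP[yA _]; apply: (IHy y yA).1.
  by move: par; rewrite cA (cAy y yA) /= negbK.
have [y0 y0A] : exists y, y \in A :\ x.
  apply/set0Pn; apply: contraNneq par => E; by rewrite cA E cards0.
set k := #|A :\ x| in cA cAy *.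
have Fk y : y \in A :\ x -> (k.-1)`! <= k * #|all_matchings (A :\ x :\ y)| ^ 2.
  move=> yA; have := (IHy y yA).2; rewrite (cAy y yA) /=; apply.
  by move: par; rewrite cA (cAy y yA) /= negbK.
set F := \sum_(y in _ | _) _.
have k0 : 0 < k by rewrite (cAy y0 y0A).
have h : k ^ 2 * (k.-1)`! <= k * F ^ 2.
  have cP : #|(fun y => (y \in A :\ x) && (tt == id tt))| = k.
    by apply: eq_card => y; rewrite !inE unfold_in /= andbT !inE.
  by rewrite -{1}cP; apply: sum_sqr_ge => y /andP[/Fk].
have h2 : k * (k.-1)`! <= F ^ 2 by rewrite -(leq_pmul2l k0) mulnA mulnn.
have kf : k`! = k * (k.-1)`! by rewrite -[in LHS](prednK k0) factS prednK.
by rewrite cA factS kf leq_mul.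
Qed.

End AllMatchings.

(** * Simple configurations by switchings *)

Section Configurations.
Variables (V : finType) (d : nat).
Notation H := (V * 'I_d)%type.
Notation N := #|{: H}|.
Implicit Types (m : {perm H}) (h x y z : H).

Definition config (m : {perm H}) : bool := [forall z, (m (m z) == z) && (m z != z)].

Definition configs : {set {perm H}} := [set m | config m].

Lemma configP m : reflect (involutive m /\ forall z, m z != z) (config m).
Proof.
apply: (iffP forallP) => [K|[K1 K2] z]; last by rewrite K1 eqxx K2.
by split=> z; have /andP[/eqP] := K z.
Qed.

Lemma configs_matchings : configs = matchings (fun _ : H => tt) id [set: H]%SET.
Proof.
apply/setP => m; rewrite !inE; apply: eq_forallb => z.
by rewrite !inE andbT.
Qed.

Definition bad_halfedges (m : {perm H}) : {set H} :=
  [set h | ((m h).1 == h.1) || [exists k, (k != h.2) && ((m (h.1, k)).1 == (m h).1)]].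

Lemma bad_halfedgesP (m : {perm H}) h : reflect
  ((m h).1 = h.1 \/ exists2 k, k != h.2 & (m (h.1, k)).1 = (m h).1)
  (h \in bad_halfedges m).
Proof.
rewrite inE; apply: (iffP orP) => -[/eqP|]; try by left.
  by move=> /existsP[k /andP[kh /eqP E]]; right; exists k.
by move=> [k kh E]; right; apply/existsP; exists k; rewrite kh E eqxx.
Qed.

Section Switch.
Variables (m m' : {perm H}).
Hypothesis mK : involutive m.

(** The vertices of [p] and [r] are distinct and not adjacent in the multigraph of [m]. *)
Definition far (p r : H) := p.1 != r.1 /\ forall k, (m (p.1, k)).1 != r.1.

Lemma far_sym p r : far p r -> far r p.
Proof.
move=> [pr F]; split; first by rewrite eq_sym.
move=> k; apply/eqP => E; have := F (m (r.1, k)).2.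
by rewrite -E -surjective_pairing mK eqxx.
Qed.

(** Edges [hx], [yz] become [hy], [xz]. Only the values at [h] and [x] are listed, so that the
    statement about [h] applies to the other three half-edges by renaming. *)
Definition switched (h x y z : H) :=
  m' h = y /\ m' x = z /\ forall c, c != h -> c != x -> c != y -> c != z -> m' c = m c.

Lemma switched_good h x y z : switched h x y z -> far h y -> far h z ->
  ~ (h.1 = x.1 /\ y.1 = z.1) -> h \notin bad_halfedges m'.
Proof.
move=> [mh [mx mc]] [hy hyF] [hz hzF] ns; apply/bad_halfedgesP => -[|[k kh]]; rewrite mh.
  by move=> E; move: hy; rewrite E eqxx.
set c := (h.1, k) => E.
have ch : c != h by apply: contraNneq kh => <-.
have [cx|cx] := eqVneq c x; first by apply: ns; rewrite -E cx mx -cx.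
have [cy|cy] := eqVneq c y; first by move: hy; rewrite -cy eqxx.
have [cz|cz] := eqVneq c z; first by move: hz; rewrite -cz eqxx.
by have := hyF k; rewrite -(mc c) // E eqxx.
Qed.

(** The four touched half-edges are good afterwards, and [h] was bad before. A half-edge bad for
    [m'] is therefore untouched, and so is any half-edge parallel to it, which is bad as well; hence
    it was already bad for [m]. *)
Lemma card_switched h x y z : switched h x y z -> m' y = h -> m' z = x ->
  far h y -> far h z -> far x y -> far x z -> ~ (h.1 = x.1 /\ y.1 = z.1) ->
  h \in bad_halfedges m -> #|bad_halfedges m'| < #|bad_halfedges m|.
Proof.
move=> sw my mz hy hz xy xz ns hbad; have [mh [mx mc]] := sw.
have hg : h \notin bad_halfedges m' by apply: switched_good sw hy hz ns.
have xg : x \notin bad_halfedges m'.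
  apply: (@switched_good x h z y) => //; last by move=> [E1 E2]; apply: ns; rewrite E1 E2.
  by split=> //; split=> // c *; apply: mc.
have yg : y \notin bad_halfedges m'.
  apply: (@switched_good y z h x); [|exact: far_sym|exact: far_sym|by move=> [E1 E2]; apply: ns; rewrite E1 E2].
  by split=> //; split=> // c *; apply: mc.
have zg : z \notin bad_halfedges m'.
  apply: (@switched_good z y x h); [|exact: far_sym|exact: far_sym|by move=> [E1 E2]; apply: ns; rewrite E1 E2].
  by split=> //; split=> // c *; apply: mc.
apply: proper_card; apply/properP; split; last by exists h.
have untouched c : c \in bad_halfedges m' -> m' c = m c.
  by move=> cb; apply: mc; apply: contraTneq cb => ->.
apply/fintype.subsetP => c cb; have mcE := untouched c cb.
apply/bad_halfedgesP; move/bad_halfedgesP: cb; rewrite mcE => -[|[k kc E]]; [by left|right].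
exists k => //; rewrite -untouched //; apply/bad_halfedgesP; right => /=.
by exists c.2; rewrite 1?eq_sym // -surjective_pairing mcE E.
Qed.

End Switch.

(** Conjugation by a transposition lets [x] and [y] exchange their partners: this is the
    switching. *)
Lemma conj_tperm (m : {perm H}) x y z : (m ^ tperm x y)%g z = tperm x y (m (tperm x y z)).
Proof. by rewrite conjgE !permM tpermV. Qed.

Lemma config_conj m x y : config (m ^ tperm x y)%g = config m.
Proof.
suff imp m' : config m' -> config (m' ^ tperm x y)%g.
  apply/idP/idP => [/imp|/imp//]; by rewrite -conjgM tperm2 conjg1.
move=> /configP[K1 K2]; apply/configP; split=> z; rewrite !conj_tperm.
  by rewrite tpermK K1 tpermK.
by rewrite -[X in _ != X](tpermK x y) (inj_eq perm_inj) K2.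
Qed.

Lemma card_vertex_halfedges (X : {set V}) : #|[set h : H | h.1 \in X]| = #|X| * d.
Proof.
rewrite -[in RHS](card_ord d) -cardX; apply: eq_card => h.
by rewrite !inE andbT.
Qed.

Lemma card_partner_preimage (m : {perm H}) (B : {set H}) : #|[set h | m h \in B]| = #|B|.
Proof.
rewrite -(card_imset _ (@perm_inj _ m)); apply: eq_card => z.
apply/imsetP/idP => [[h + ->]|zB]; first by rewrite inE.
by exists ((m^-1)%g z); rewrite ?inE permKV.
Qed.

Lemma repair_bad m h : config m -> h \in bad_halfedges m ->
  #|bad_halfedges m| + 4 * (d * d.+1) < N ->
  exists x y, config (m ^ tperm x y)%g /\
    #|bad_halfedges (m ^ tperm x y)%g| < #|bad_halfedges m|.
Proof.
move=> /[dup] cm /configP[K1 K2] hbad big.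
pose x := m h.
pose nb (u : V) : {set V} := [set (m (u, k)).1 | k : 'I_d].
pose X := [set h.1; x.1] :|: (nb h.1 :|: nb x.1).
have cX : #|X| <= 2 * d.+1.
  apply: leq_trans (leq_card_setU _ _).1 _; rewrite mulnS.
  apply: leq_add; first by rewrite cards2; case: (_ != _).
  apply: leq_trans (leq_card_setU _ _).1 _.
  by rewrite mul2n -addnn leq_add // -[X in _ <= X](card_ord d) leq_imset_card.
(* Both [y] and its partner must avoid the at most [2 * d.+1] vertices of [X], with [d] half-edges
   each: this is the [4 * (d * d.+1)]. Avoiding bad half-edges keeps [y] off loops. *)
pose E := bad_halfedges m :|: ([set y : H | y.1 \in X] :|: [set y | m y \in [set z : H | z.1 \in X]]).
have [y yE] : exists y, y \notin E.
  apply/existsP; rewrite -negb_forall; apply: contraTN big => /forallP all.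
  have -> : N = #|E| by apply: eq_card => z; rewrite inE all.
  rewrite -leqNgt; apply: leq_trans (leq_card_setU _ _).1 _; rewrite leq_add2l.
  apply: leq_trans (leq_card_setU _ _).1 _.
  rewrite card_partner_preimage card_vertex_halfedges; nia.
move: yE; rewrite !inE !negb_or => /and4P[/andP[yl _] /and3P[/andP[yh yx] ynh ynx] /andP[zh zx] /andP[znh znx]].
pose z := m y.
have farI p r : r.1 != p.1 -> r.1 \notin nb p.1 -> far m p r.
  move=> rp rn; split; first by rewrite eq_sym.
  by move=> k; apply: contraNneq rn => <-; apply/imsetP; exists k.
have neq1 (p r : H) : p.1 != r.1 -> p != r by apply: contraNneq => ->.
have xh : x != h by exact: K2.
have zy' : z != y by exact: K2.
have [yh' yx' zh' zx'] : [/\ y != h, y != x, z != h & z != x] by split; apply: neq1.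
have [hx hy' xy' xz'] : [/\ h != x, h != y, x != y & x != z] by split; rewrite eq_sym.
exists x, y; split; first by rewrite config_conj.
set m' := (m ^ tperm x y)%g.
have m'h : m' h = y by rewrite conj_tperm [X in m X]tpermD // -/x tpermL.
have m'x : m' x = z by rewrite conj_tperm tpermL -/z tpermD // eq_sym.
have m'y : m' y = h by rewrite conj_tperm tpermR K1 tpermD.
have m'z : m' z = x by rewrite conj_tperm [X in m X]tpermD ?K1 ?tpermR // eq_sym.
apply: (@card_switched m m' K1 h x y z) => //; [|exact: farI|exact: farI|exact: farI|exact: farI|].
  split=> //; split=> // c ch cx cy cz; rewrite conj_tperm [X in m X]tpermD 1?eq_sym //.
  rewrite tpermD //; first by rewrite (inj_eq perm_inj) eq_sym.
  by rewrite -[X in X != _]K1 (inj_eq perm_inj) eq_sym.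
by move=> [_ E']; move: yl; rewrite E' eqxx.
Qed.

Definition nearly_simple k : {set {perm H}} := [set m in configs | #|bad_halfedges m| <= k].

(** Each configuration on the left is a conjugate of one on the right by [tperm x y] for one of the
    [N ^ 2] pairs; [x = y] serves configurations without bad half-edges. *)
Lemma card_nearly_simpleS k : k.+1 + 4 * (d * d.+1) < N ->
  #|nearly_simple k.+1| <= N ^ 2 * #|nearly_simple k|.
Proof.
move=> big; have [h0 _] : exists h0 : H, true.
  by have /card_gt0P[h0 _] : 0 < N by [lia]; exists h0.
have -> : N ^ 2 * #|nearly_simple k| = #|finset.setX (nearly_simple k) [set: H * H]%SET|.
  have cHH : #|{: H * H}| = N ^ 2 by rewrite card_prod mulnn.
  by rewrite cardsX cardsT cHH mulnC.
apply: leq_trans (leq_imset_card (fun p : {perm H} * (H * H) => (p.1 ^ tperm p.2.1 p.2.2)%g) _).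
apply: subset_leq_card; apply/fintype.subsetP => m; rewrite !inE => /andP[cm bm].
have [m0|[h hb]] := set_0Vmem (bad_halfedges m).
  apply/imsetP; exists (m, (h0, h0)); last by rewrite /= tperm1 conjg1.
  by rewrite !inE cm m0 cards0.
have [|x [y [cm' lt]]] := repair_bad cm hb; first by apply: leq_ltn_trans big; rewrite leq_add2r.
apply/imsetP; exists ((m ^ tperm x y)%g, (x, y)); last by rewrite /= -conjgM tperm2 conjg1.
by rewrite !inE cm' /= -ltnS (leq_trans lt).
Qed.

Lemma card_nearly_simple k : k + 4 * (d * d.+1) < N ->
  #|nearly_simple k| <= N ^ (2 * k) * #|nearly_simple 0|.
Proof.
elim: k => [|k IH] big; first by rewrite muln0 expn0 mul1n.
apply: leq_trans (card_nearly_simpleS big) _.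
by rewrite mulnS expnD -mulnA leq_mul2l IH ?orbT //; lia.
Qed.

Lemma card_configs_conj (P : pred {perm H}) x y :
  #|[set m in configs | P (m ^ tperm x y)%g]| = #|[set m in configs | P m]|.
Proof.
rewrite -!sum1_card (reindex_inj (conjg_inj (tperm x y))) /=.
apply: eq_bigl => m; rewrite !inE config_conj; congr (_ && P _).
by rewrite -conjgM tperm2 conjg1.
Qed.

(** Conjugation preserves the uniform law on configurations, so probabilities may be averaged over a
    random switching at [h], which resamples the partner of [h]. *)
Lemma sum_switches (P : pred {perm H}) h :
  N * #|[set m in configs | P m]| = \sum_(m in configs) #|[set y | P (m ^ tperm h y)%g]|.
Proof.
transitivity (\sum_(y : H) #|[set m in configs | P (m ^ tperm h y)%g]|).
  rewrite (eq_bigr (fun=> #|[set m in configs | P m]|)) ?sum_nat_const //.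
  by move=> y _; rewrite card_configs_conj.
transitivity (\sum_(y : H) \sum_(m in configs) P (m ^ tperm h y)%g).
  apply: eq_bigr => y _; rewrite -sum1_card big_mkcond [RHS]big_mkcond.
  by apply: eq_bigr => m _; rewrite !inE; case: (config m); case: (P _).
rewrite exchange_big; apply: eq_bigr => m _; rewrite -sum1_card [RHS]big_mkcond.
by apply: eq_bigr => y _; rewrite inE; case: (P _).
Qed.

(** After the switching [h] is matched with [m y], for uniform [y], except when [y] is [h] or [m h]:
    these are the 2. *)
Lemma card_partner_in h (B : {set H}) :
  N * #|[set m in configs | m h \in B]| <= #|configs| * (#|B| + 2).
Proof.
rewrite (sum_switches (fun m => m h \in B) h) -sum_nat_const.
apply: leq_sum => m; rewrite inE => /configP[K1 K2].
apply: (@leq_trans #|[set y | m y \in B] :|: [set h; m h]|).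
  apply: subset_leq_card; apply/fintype.subsetP => y; rewrite !inE conj_tperm tpermL.
  have [->|yh] := eqVneq y h; first by rewrite orbT.
  have [->|ym] := eqVneq y (m h); first by rewrite !orbT.
  rewrite tpermD ?orbF //.
    by apply: contraNneq ym => ->; rewrite K1.
  by rewrite eq_sym K2.
apply: leq_trans (leq_card_setU _ _).1 _; rewrite card_partner_preimage leq_add2l.
by rewrite cards2; case: (_ != _).
Qed.

(** Resampling the partner of [h] leaves [d] choices at the vertex of [m h'] and 4 exceptional [y].
    The event [m h' = h] is bounded separately by [card_partner_in], costing 1 + 2. *)
Lemma card_parallel h h' : h != h' ->
  N * #|[set m in configs | ((m h).1 == (m h').1) && (m h' != h)]| <= #|configs| * (d + 7).
Proof.
move=> hh'; rewrite (sum_switches (fun m => ((m h).1 == (m h').1) && (m h' != h)) h).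
apply: (@leq_trans (\sum_(m in configs) ((d + 4) + N * (m h' \in [set h])))).
  apply: leq_sum => m; rewrite inE => /configP[K1 K2].
  have [mh'|mh'] := boolP (m h' \in [set h]).
    by rewrite muln1; apply: leq_trans (leq_addl _ _); rewrite max_card.
  rewrite muln0 addn0; rewrite inE in mh'.
  pose D := [set h; h'] :|: [set m h; m h'].
  apply: (@leq_trans #|[set y | m y \in [set z : H | z.1 \in [set (m h').1]]] :|: D|).
    apply: subset_leq_card; apply/fintype.subsetP => y; rewrite !inE !conj_tperm tpermL.
    have [->|yh] := eqVneq y h; first by rewrite !orbT.
    have [->|yh'] := eqVneq y h'; first by rewrite !orbT.
    have [->|ym] := eqVneq y (m h); first by rewrite !orbT.
    have [->|ym'] := eqVneq y (m h'); first by rewrite !orbT.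
    rewrite !orbF tpermD; last 2 first.
    - by apply: contraNneq ym => ->; rewrite K1.
    - by rewrite eq_sym K2.
    have -> : tperm h y h' = h' by rewrite tpermD.
    have -> : tperm h y (m h') = m h' by rewrite tpermD // eq_sym.
    by move=> /andP[].
  apply: leq_trans (leq_card_setU _ _).1 _.
  rewrite card_partner_preimage card_vertex_halfedges cards1 mul1n leq_add2l.
  apply: leq_trans (leq_card_setU _ _).1 _; rewrite !cards2.
  by case: (_ != _); case: (_ != _).
rewrite big_split /= sum_nat_const -big_distrr /=.
have -> : \sum_(m in configs) (m h' \in [set h]) = #|[set m in configs | m h' \in [set h]]|.
  rewrite -sum1_card big_mkcond [RHS]big_mkcond; apply: eq_bigr => m _.
  by rewrite !inE; case: (config m); case: (_ == _).
have := card_partner_in h' [set h]; rewrite cards1.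
by have -> : d + 7 = d + 4 + (1 + 2) by [lia]; rewrite [X in _ -> _ <= X]mulnDr leq_add2l.
Qed.

(** Bounds the expected number of bad half-edges: [d + 2] from loops and [d + 7] for each of at most
    [d] possible parallel half-edges. Parallels with [m (h.1, k) = h] are loops and counted
    there. *)
Definition bad_mean : nat := d + 2 + d * (d + 7).

Lemma sum_bad_halfedges : \sum_(m in configs) #|bad_halfedges m| <= #|configs| * bad_mean.
Proof.
have [N0|N0] := posnP N.
  rewrite big1 // => m _; apply/eqP; rewrite -leqn0 -N0; exact: max_card.
rewrite -(leq_pmul2l N0).
pose loops h := #|[set m in configs | m h \in [set z : H | z.1 \in [set h.1]]]|.
pose par h k := #|[set m in configs | ((m h).1 == (m (h.1, k)).1) && (m (h.1, k) != h)]|.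
apply: (@leq_trans (N * \sum_h (loops h + \sum_(k | k != h.2) par h k))).
  rewrite leq_mul2l; apply/orP; right.
  apply: (@leq_trans (\sum_(m in configs) \sum_h ((m h).1 == h.1) + \sum_(m in configs) \sum_h
      \sum_(k | k != h.2) (((m h).1 == (m (h.1, k)).1) && (m (h.1, k) != h)))).
    rewrite -big_split; apply: leq_sum => m; rewrite inE => /configP[K1 K2].
    rewrite -big_split /= -sum1_card big_mkcond; apply: leq_sum => h _.
    case: bad_halfedgesP => // -[->|[k kh E]]; first by rewrite eqxx.
    have [mk|mk] := eqVneq (m (h.1, k)) h.
      by rewrite -mk K1 /= [in X in _ <= nat_of_bool X + _]mk eqxx.
    by rewrite (bigD1 k) //= E eqxx mk /= addnCA.
  rewrite big_split /= leq_add //.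
    rewrite exchange_big; apply: leq_sum => h _; rewrite /loops -sum1_card big_mkcond.
    rewrite [X in _ <= X]big_mkcond; apply: leq_sum => m _; rewrite !inE.
    by case: (config m); case: (_ == _).
  rewrite exchange_big; apply: leq_sum => h _; rewrite exchange_big; apply: leq_sum => k _.
  rewrite /par -sum1_card big_mkcond [X in _ <= X]big_mkcond; apply: leq_sum => m _.
  by rewrite !inE; case: (config m); case: (_ && _).
rewrite big_distrr /= -sum_nat_const; apply: leq_sum => h _.
rewrite mulnDr big_distrr /= /bad_mean mulnDr leq_add //.
  have := card_partner_in h [set z : H | z.1 \in [set h.1]].
  by rewrite card_vertex_halfedges cards1 mul1n.
apply: (@leq_trans (\sum_(k : 'I_d) #|configs| * (d + 7))).
  rewrite big_mkcond; apply: leq_sum => k _; case: ifP => // kh.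
  by apply: card_parallel; apply: contraTneq kh => ->; rewrite eqxx.
by rewrite sum_nat_const card_ord mulnCA.
Qed.

(** By Markov's inequality at least half of the configurations have at most twice the mean number of
    bad half-edges, and these are repaired one by one. *)
Lemma card_configs_le : 2 * bad_mean + 4 * (d * d.+1) < N ->
  #|configs| <= 2 * (N ^ (2 * (2 * bad_mean)) * #|nearly_simple 0|).
Proof.
move=> /card_nearly_simple big; set K := bad_mean in big *.
apply: leq_trans (_ : 2 * #|nearly_simple (2 * K)| <= _); last by rewrite leq_mul2l.
have K0 : 0 < K by rewrite /K /bad_mean; lia.
have := sum_bad_halfedges; rewrite -/K => sumK.
have mk : (2 * K) * #|configs :\: nearly_simple (2 * K)| <= #|configs| * K.
  apply: leq_trans sumK; rewrite mulnC -sum_nat_const.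
  rewrite [X in _ <= X](bigID (fun m => m \in nearly_simple (2 * K))) /= [X in _ <= X]addnC.
  apply: leq_trans (leq_addr _ _).
  rewrite big_mkcond [X in _ <= X]big_mkcond; apply: leq_sum => m _.
  rewrite !inE; case: (config m) => //=; rewrite andbT -ltnNge.
  by case: ifP => // /ltnW.
have := cardsD configs (nearly_simple (2 * K)).
have -> : configs :&: nearly_simple (2 * K) = nearly_simple (2 * K).
  by apply/setP => m; rewrite !inE; case: (config m).
have sub : #|nearly_simple (2 * K)| <= #|configs|.
  by apply: subset_leq_card; apply/fintype.subsetP => m; rewrite !inE => /andP[].
have : 2 * #|configs :\: nearly_simple (2 * K)| <= #|configs|.
  by rewrite -(leq_pmul2r K0) mulnAC.
lia.
Qed.

End Configurations.

(** * Regular graphs as configurations *)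

Section ConfigurationGraphs.
Variables (V : finType) (d : nat).
Notation H := (V * 'I_d)%type.
Implicit Types (m : {perm H}) (E : {set V * V}).

Definition graph_of m : {set V * V} := [set p | [exists i, (m (p.1, i)).1 == p.2]].

Definition is_regular_graph E : bool :=
  [&& [forall x, forall y, ((x, y) \in E) == ((y, x) \in E)],
      [forall x, (x, x) \notin E] & [forall x, #|[set y | (x, y) \in E]| == d]].

Lemma regular_graphP E : reflect
  [/\ forall x y, ((x, y) \in E) = ((y, x) \in E), forall x, (x, x) \notin E &
      forall x, #|[pred y | (x, y) \in E]| = d] (is_regular_graph E).
Proof.
have eqc x : #|[set y | (x, y) \in E]| = #|[pred y | (x, y) \in E]|.
  by apply: eq_card => y; rewrite !inE.
apply: (iffP and3P) => [[/forallP A /forallP B /forallP C]|[A B C]].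
  split=> x; [|exact: B|by rewrite -eqc; exact: eqP (C x)].
  by move=> y; have /forallP/(_ y)/eqP := A x.
by split; apply/forallP => x; [apply/forallP => y; rewrite A| |rewrite eqc C].
Qed.

Definition simple_config m : bool := (m \in configs V d) && (bad_halfedges m == finset.set0).

Lemma simple_configP m : reflect
  [/\ involutive m, forall h, (m h).1 != h.1 &
      forall v k l, (m (v, k)).1 = (m (v, l)).1 -> k = l] (simple_config m).
Proof.
rewrite /simple_config inE.
apply: (iffP andP) => [[/configP[K1 K2] /eqP b0]|[K1 K2 K3]].
  have nb h : h \notin bad_halfedges m by rewrite b0 inE.
  split=> // [h|v k l E].
    by apply/eqP => E; have /bad_halfedgesP := nb h; apply; left.
  apply/eqP; apply: contraT => kl; have /bad_halfedgesP := nb (v, k); case; right.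
  by exists l; rewrite 1?eq_sym.
split; last first.
  apply/eqP/setP => h; rewrite finset.in_set0; apply/negbTE/bad_halfedgesP => -[E|[k kh E]].
    by have := K2 h; rewrite E eqxx.
  by case/eqP: kh; apply: (K3 h.1); rewrite E -surjective_pairing.
by apply/configP; split=> // h; apply: contraNneq (K2 h) => ->.
Qed.

Lemma nearly_simple0 : nearly_simple V d 0 = [set m | simple_config m].
Proof. by apply/setP => m; rewrite !inE leqn0 cards_eq0 /simple_config inE. Qed.

Lemma graph_ofP m u w : reflect (exists i, (m (u, i)).1 = w) ((u, w) \in graph_of m).
Proof. by rewrite inE; apply: (iffP existsP) => -[i /eqP E]; exists i. Qed.

Lemma graph_of_card m v (P : pred V) : simple_config m ->
  #|[pred w | ((v, w) \in graph_of m) && P w]| = #|[pred i | P (m (v, i)).1]|.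
Proof.
move=> /simple_configP[K1 K2 K3].
have inj : injective (fun i => (m (v, i)).1) by move=> k l; exact: K3.
rewrite -[RHS](fintype.card_image inj); apply: eq_card => w; rewrite inE.
apply/andP/fintype.imageP => [[/graph_ofP[i <-] Pi]|[i Pi ->]]; first by exists i.
by split=> //; apply/graph_ofP; exists i.
Qed.

Lemma graph_of_regular m : simple_config m -> is_regular_graph (graph_of m).
Proof.
move=> /[dup] sm /simple_configP[K1 K2 K3].
have sym x y : (x, y) \in graph_of m -> (y, x) \in graph_of m.
  move=> /graph_ofP[i E]; apply/graph_ofP; exists (m (x, i)).2.
  by rewrite -E -surjective_pairing K1.
apply/regular_graphP; split=> [x y|x|x]; first by apply/idP/idP => /sym.
  by apply/graph_ofP => -[i E]; have := K2 (x, i); rewrite E eqxx.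
have := graph_of_card x predT sm.
have -> : #|[pred w | ((x, w) \in graph_of m) && predT w]| = #|[pred y | (x, y) \in graph_of m]|.
  by apply: eq_card => y; rewrite !inE andbT.
by move=> ->; rewrite -[RHS](card_ord d); apply: eq_card.
Qed.

Section Fiber.
Variable E : {set V * V}.
Hypothesis regE : is_regular_graph E.

Definition rotation m : {ffun V -> {ffun 'I_d -> V}} := [ffun v => [ffun i => (m (v, i)).1]].

Definition neighbor_orders (v : V) : pred {ffun 'I_d -> V} :=
  [pred r : {ffun 'I_d -> V} | injectiveb r && [forall i, (v, r i) \in E]].

Lemma card_neighbor_orders v : #|neighbor_orders v| = d`!.
Proof.
have [_ _ deg] := regular_graphP _ regE.
rewrite -ffactnn -[X in _ = X ^_ _](deg v) -[X in _ = _ ^_ X](card_ord d) -card_inj_ffuns_on.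
apply: eq_card => r; rewrite !inE andbC; congr (_ && _).
Qed.

(** The configuration with given neighbour orders: half-edge [i] of [v] is joined to the position of
    [v] in the list of [w = r v i]. By symmetry of the graph that position exists, so the default is
    not reached. *)
Definition partner_of (r : {ffun V -> {ffun 'I_d -> V}}) (h : H) : H :=
  (r h.1 h.2, odflt h.2 [pick j | r (r h.1 h.2) j == h.1]).

Section PartnerOf.
Variable r : {ffun V -> {ffun 'I_d -> V}}.
Hypothesis hr : r \in family neighbor_orders.

Let r_inj v : injective (r v).
Proof. by have /familyP/(_ v) := hr; rewrite inE => /andP[/injectiveP]. Qed.

Let r_E v i : (v, r v i) \in E.
Proof. by have /familyP/(_ v) := hr; rewrite inE => /andP[_ /forallP]. Qed.

Lemma rotation_onto v w : (v, w) \in E -> exists i, r v i = w.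
Proof.
move=> vw; have [_ _ deg] := regular_graphP _ regE.
have sub : codom (r v) \subset [pred y | (v, y) \in E].
  by apply/fintype.subsetP => _ /codomP[i ->]; rewrite inE r_E.
have cc : #|codom (r v)| = #|[pred y | (v, y) \in E]|.
  by rewrite deg card_codom // card_ord.
have := subset_cardP cc sub => /(_ w); rewrite inE vw => /codomP[i ->].
by exists i.
Qed.

Lemma partner_ofP v i : exists2 j, partner_of r (v, i) = (r v i, j) & r (r v i) j = v.
Proof.
rewrite /partner_of /=; case: pickP => [j /eqP E'|none]; first by exists j.
have [sym _ _] := regular_graphP _ regE.
have [j E'] : exists j, r (r v i) j = v by apply: rotation_onto; rewrite sym.
by have := none j; rewrite E' eqxx.
Qed.

Lemma partner_ofK : involutive (partner_of r).
Proof.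
move=> [v i]; have [j -> E1] := partner_ofP v i.
have [k -> E2] := partner_ofP (r v i) j; rewrite E1; congr (_, _).
by apply: (@r_inj v); rewrite -E1 E2 E1.
Qed.

Definition perm_of_rotation : {perm H} := perm (inv_inj partner_ofK).

Lemma perm_of_rotationP : [/\ simple_config perm_of_rotation,
  graph_of perm_of_rotation = E & rotation perm_of_rotation = r].
Proof.
have pE v i : (perm_of_rotation (v, i)).1 = r v i.
  by rewrite permE; have [j ->] := partner_ofP v i.
have [sym irr _] := regular_graphP _ regE.
split.
- apply/simple_configP; split=> [h|[v i]|v k l].
  + by rewrite !permE partner_ofK.
  + by rewrite pE; apply: contraTneq (r_E v i) => ->; exact: irr.
  + by rewrite !pE; exact: r_inj.
- apply/setP => -[u w]; apply/graph_ofP/idP => [[i <-]|/rotation_onto[i <-]].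
    by rewrite pE r_E.
  by exists i; rewrite pE.
- by apply/ffunP => v; apply/ffunP => i; rewrite !ffunE pE.
Qed.

End PartnerOf.

(** A simple configuration over [E] amounts to an ordering of the neighbours at every vertex. *)
Lemma card_graph_fiber : #|[set m | simple_config m & graph_of m == E]| = (d`!) ^ #|V|.
Proof.
have -> : (d`!) ^ #|V| = #|family neighbor_orders|.
  rewrite card_family foldrE big_map big_enum /=.
  rewrite (eq_bigr (fun=> d`!)); last by move=> v _; exact: card_neighbor_orders.
  by rewrite prod_nat_const.
rewrite -(card_in_imset (f := rotation)); last first.
  move=> m m'; rewrite !inE => /andP[/simple_configP[K1 K2 K3] _] /andP[/simple_configP[K1' K2' K3'] _].
  move=> /ffunP rr; have E1 v i : (m (v, i)).1 = (m' (v, i)).1.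
    by have /ffunP/(_ i) := rr v; rewrite !ffunE.
  apply/permP => -[v i]; rewrite [LHS]surjective_pairing [RHS]surjective_pairing -E1; congr (_, _).
  apply: (K3 (m (v, i)).1); rewrite -surjective_pairing K1 /= E1 E1 -surjective_pairing K1' /=.
  by [].
apply: eq_card => r; apply/imsetP/idP => [[m + ->]|hr]; last first.
  have [sm gE rE] := perm_of_rotationP hr; exists (perm_of_rotation hr) => //.
  by rewrite inE sm gE eqxx.
rewrite inE => /andP[/simple_configP[K1 K2 K3] /eqP gE]; apply/familyP => v.
rewrite inE; apply/andP; split.
  by apply/injectiveP => k l; rewrite !ffunE; exact: K3.
by apply/forallP => i; rewrite !ffunE -gE; apply/graph_ofP; exists i.
Qed.

End Fiber.

Lemma card_simple_graphs (P : pred {set V * V}) :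
  #|[set m | simple_config m && P (graph_of m)]| =
  #|[set E | is_regular_graph E && P E]| * (d`!) ^ #|V|.
Proof.
rewrite -sum1_card (partition_big graph_of (fun E => is_regular_graph E && P E)) /=; last first.
  by move=> m; rewrite inE => /andP[/graph_of_regular -> ->].
rewrite -sum_nat_const; apply: congr_big => //= [E|E]; first by rewrite inE.
move=> /andP[rE PE]; rewrite -(card_graph_fiber rE) -sum1_card.
apply: eq_bigl => m; rewrite !inE; case: eqP => [->|]; rewrite ?andbF ?andbT //.
by rewrite PE andbT.
Qed.

Definition star_type (S : finType) m (g : V -> S) (v : V) : S * {ffun 'I_d -> S} :=
  (g v, [ffun i => g (m (v, i)).1]).

Lemma star_type_covering (S : finType) (M : S -> S -> nat) m (g : V -> S) v : simple_config m ->
  star_covering M (star_type m g v) <->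
  covering_at (fun x y => (x, y) \in graph_of m) M g v.
Proof.
move=> sm; rewrite covering_atP /star_covering.
have E q : #|[pred i | (star_type m g v).2 i == q]| =
    #|[pred w | ((v, w) \in graph_of m) && (g w == q)]|.
  rewrite (graph_of_card v (fun w => g w == q) sm); apply: eq_card => i.
  by rewrite !inE ffunE.
split=> [/forallP K q|K]; first by rewrite -E; exact: eqP (K q).
by apply/forallP => q; rewrite E K.
Qed.

End ConfigurationGraphs.

(** * Factorial estimates and the method of types *)

Section TypeCounting.
Variable R : realType.
Local Open Scope ring_scope.

Lemma succ_pow_le (n : nat) : (n.+1%:R : R) ^+ n <= expR 1 * n%:R ^+ n.
Proof.
case: n => [|n]; first by rewrite !expr0 mulr1 ltW // expR_gt1.
have n0 : 0 < (n.+1%:R : R) by rewrite ltr0n.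
have -> : (n.+2%:R : R) = n.+1%:R * (1 + n.+1%:R^-1).
  by rewrite mulrDr mulr1 mulfV ?gt_eqF // natr1.
rewrite exprMn mulrC ler_pM2r ?exprn_gt0 //.
have -> : expR 1 = expR (n.+1%:R^-1 : R) ^+ n.+1.
  by rewrite -expRM_natl mulfV ?gt_eqF.
by rewrite lerXn2r ?nnegrE ?expR_ge0 ?expR_ge1Dx.
Qed.

Lemma fact_ge_pow (n : nat) : (n%:R : R) ^+ n <= (n`!)%:R * expR n%:R.
Proof.
elim: n => [|n IH]; first by rewrite expr0 expR0 mulr1.
rewrite exprS factS natrM -mulrA ler_pM2l ?ltr0n //.
apply: le_trans (succ_pow_le n) _.
by rewrite -natr1 expRD mulrA [expR 1 * _]mulrC ler_pM2r ?expR_gt0.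
Qed.

Lemma fact_le_pow (n : nat) : (n`!)%:R * expR n%:R <= expR 1 * n.+1%:R * n%:R ^+ n :> R.
Proof.
have H : (n`!)%:R * expR n%:R <= (n.+1%:R : R) ^+ n.+1.
  elim: n => [|n IH]; first by rewrite expR0 mulr1 expr1.
  set a : R := n.+1%:R in IH *; have a0 : 0 < a by rewrite ltr0n.
  have e1 : expR 1 * a ^+ n.+2 <= (n.+2%:R : R) ^+ n.+2.
    have b0 : 0 < (n.+2%:R : R) by rewrite ltr0n.
    have -> : a = n.+2%:R * (1 - n.+2%:R^-1).
      by rewrite mulrBr mulr1 mulfV ?gt_eqF // -[n.+2%:R]natr1 addrK.
    rewrite exprMn mulrCA ger_pMr ?exprn_gt0 //.
    have -> : expR 1 = expR (n.+2%:R^-1 : R) ^+ n.+2.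
      by rewrite -expRM_natl mulfV ?gt_eqF.
    rewrite -exprMn exprn_ile1 //.
      rewrite mulr_ge0 ?expR_ge0 // subr_ge0 invf_le1 // ler1n //.
    have := expR_ge1Dx (- n.+2%:R^-1 : R); rewrite expRN => h.
    apply: le_trans (ler_wpM2l (expR_ge0 _) h) _.
    by rewrite mulfV // gt_eqF // expR_gt0.
  have -> : (n.+1`!)%:R * expR a = expR 1 * a * ((n`!)%:R * expR n%:R).
    by rewrite factS natrM /a -natr1 expRD; ring.
  by apply: le_trans e1; rewrite exprS [leRHS]mulrA ler_pM2l ?mulr_gt0 ?expR_gt0.
apply: le_trans H _; rewrite exprS -mulrA mulrCA ler_pM2l ?ltr0n //.
exact: succ_pow_le.
Qed.

Lemma prod_by_density (H T : finType) (t : H -> T) (F : T -> R) :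
  \prod_h F (t h) = \prod_c F c ^+ #|[pred h | t h == c]|.
Proof.
rewrite (partition_big t predT) //=; apply: eq_bigr => c _.
rewrite (eq_bigr (fun=> F c)); last by move=> h /eqP->.
by rewrite prodr_const; congr (_ ^+ _); apply: eq_card => h; rewrite inE.
Qed.

Lemma sum_card_fibers (H T : finType) (t : H -> T) :
  (\sum_c #|[pred h | t h == c]|)%N = #|H|.
Proof.
rewrite -sum1_card (partition_big t predT) //=; apply: eq_bigr => c _.
by rewrite -sum1_card; apply: eq_bigl => h; rewrite inE.
Qed.

(** Lower bound for a multinomial coefficient by the exponential of the entropy, up to a polynomial
    factor. *)
Lemma prod_fact_le (H T : finType) (h0 : H) (t : H -> T) :
  \prod_c ((#|[pred h | t h == c]|)`!)%:R <=
  ((#|H|)`!)%:R * (expR 1 * #|H|.+1%:R) ^+ #|T| * \prod_h density R t (t h).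
Proof.
set N := #|H|; have N0 : 0 < (N%:R : R) by rewrite ltr0n; apply/card_gt0P; exists h0.
pose k c := #|[pred h | t h == c]|.
have kN c : (k c <= N)%N by exact: max_card.
have e0 := expR_gt0 (N%:R : R).
rewrite -(ler_pM2r e0).
have -> : expR N%:R = \prod_c expR ((k c)%:R : R).
  by rewrite -expR_sum -natr_sum sum_card_fibers.
rewrite -big_split /=.
apply: le_trans (_ : \prod_c (expR 1 * N.+1%:R * (k c)%:R ^+ k c) <= _).
  apply: ler_prod => c _; rewrite mulr_ge0 ?expR_ge0 //=.
  apply: le_trans (fact_le_pow _) _; rewrite ler_wpM2r ?exprn_ge0 //.
  by rewrite ler_pM2l ?expR_gt0 // ler_nat ltnS; exact: kN.
rewrite big_split /= prodr_const -expR_sum -natr_sum sum_card_fibers -/N.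
have -> : \prod_c (k c)%:R ^+ k c = N%:R ^+ N * \prod_h density R t (t h).
  have kS : N = (\sum_c k c)%N by rewrite sum_card_fibers.
  rewrite (prod_by_density t (density R t)) [X in _ ^+ X * _]kS.
  rewrite (big_morph (fun j => N%:R ^+ j) (exprD _) (expr0 _)) -big_split /=.
  apply: eq_bigr => c _; rewrite -exprMn; congr (_ ^+ _).
  by rewrite /density -/N mulrCA mulfV ?mulr1 // gt_eqF.
have -> : (N`!)%:R * (expR 1 * N.+1%:R) ^+ #|T| * \prod_h density R t (t h) * expR N%:R =
  (expR 1 * N.+1%:R) ^+ #|T| * ((N`!)%:R * expR N%:R * \prod_h density R t (t h)) by ring.
rewrite ler_pM2l ?exprn_gt0 ?mulr_gt0 ?expR_gt0 ?ltr0n //.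
rewrite ler_wpM2r ?fact_ge_pow // prodr_ge0 // => h _; exact: density_ge0.
Qed.

(** Assignments with the same counts have the same density; their contributions are probabilities
    under one product law and sum to at most 1. There are at most [#|V|.+1 ^ #|T|] families of
    counts. *)
Lemma sum_prod_density_le (V T : finType) (v0 : V) :
  \sum_(tau : {ffun V -> T}) \prod_v density R tau (tau v) <= (#|V|.+1%:R : R) ^+ #|T|.
Proof.
have n0 : 0 < ((#|V|)%:R : R) by rewrite ltr0n; apply/card_gt0P; exists v0.
have kN (tau : {ffun V -> T}) c : (#|[pred v | tau v == c]| < #|V|.+1)%N by rewrite ltnS max_card.
pose prof (tau : {ffun V -> T}) : {ffun T -> 'I_#|V|.+1} := [ffun c => Ordinal (kN tau c)].
rewrite (partition_big prof predT) //=.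
have -> : (#|V|.+1%:R : R) ^+ #|T| = \sum_(f : {ffun T -> 'I_#|V|.+1}) 1.
  by rewrite sumr_const card_ffun card_ord natrX.
apply: ler_sum => f _.
have [tau0 /eqP f0|none] := pickP (fun tau => prof tau == f); last by rewrite big_pred0.
apply: le_trans (_ : \sum_(tau : {ffun V -> T}) \prod_v density R tau0 (tau v) <= _).
  rewrite [leRHS](bigID (fun tau => prof tau == f)) /=.
  apply: le_trans (_ : \sum_(tau | prof tau == f) \prod_v density R tau0 (tau v) <= _).
    apply: ler_sum => tau /eqP ft; rewrite le_eqVlt; apply/orP; left; apply/eqP.
    apply: eq_bigr => v _; rewrite /density; congr (_%:R / _).
    by have /ffunP/(_ (tau v)) := etrans ft (esym f0); rewrite !ffunE => -[].
  rewrite lerDl sumr_ge0 // => tau _; rewrite prodr_ge0 // => v _; exact: density_ge0.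
rewrite (sum_prod_ffun (fun _ c => density R tau0 c)) (sum_density R v0).
by rewrite big1.
Qed.

End TypeCounting.

(** * First moment over assignments of stars *)

Section GraphCounting.
Variables (R : realType) (V S : finType) (v0 : V) (d : nat).
Hypothesis d0 : 0 < d.
Notation H := (V * 'I_d)%type.
Notation star := (S * {ffun 'I_d -> S})%type.
Notation N := #|{: H}|.
Local Open Scope ring_scope.

Definition swap_pair (c : S * S) : S * S := (c.2, c.1).

Lemma swap_pairK : involutive swap_pair.
Proof. by case. Qed.

Definition compatible_configs (tau : {ffun V -> star}) : {set {perm H}} :=
  matchings (halfedge_type tau) swap_pair [set: H]%SET.

Lemma compatible_configs_sub tau : compatible_configs tau \subset configs V d.
Proof.
apply/fintype.subsetP => m; rewrite inE => /matchingP[K1 K2 _]; rewrite inE.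
by apply/configP; split=> // z; have [] := K2 z (finset.in_setT z).
Qed.

(** The first factor is the loss in [card_all_matchings], the power is the one in [prod_fact_le]. *)
Definition type_factor : R := N.+1%:R * (expR 1 * N.+1%:R) ^+ #|{: S * S}|.

Lemma type_factor_ge1 : 1 <= type_factor.
Proof.
have N1 : 1 <= N.+1%:R :> R by rewrite ler1n.
rewrite /type_factor mulr_ege1 // exprn_ege1 // mulr_ege1 //.
by rewrite ltW // expR_gt1.
Qed.

Lemma card_compatible_configs tau :
  (#|compatible_configs tau|)%:R ^+ 2 <= (#|configs V d|)%:R ^+ 2 *
    (type_factor * \prod_h density R (halfedge_type tau) (halfedge_type tau h)).
Proof.
have i0 : 'I_d by exists 0%N.
set P := \prod_h _; have P0 : 0 <= P by rewrite prodr_ge0 // => h _; exact: density_ge0.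
have [hodd heven] := card_all_matchings [set: H]%SET.
rewrite -configs_matchings cardsT in hodd heven.
have [oddN|evenN] := boolP (odd N).
  have -> : #|compatible_configs tau| = 0%N.
    apply/eqP; rewrite -leqn0 -(hodd oddN); apply: subset_leq_card.
    exact: compatible_configs_sub.
  by rewrite expr0n /= !mulr_ge0 // ?exprn_ge0 // (le_trans ler01) // type_factor_ge1.
have h1 := card_matchings_le (halfedge_type tau) swap_pairK [set: H]%SET.
have h2 := prod_fact_le R (v0, i0) (halfedge_type tau).
have -> : ((#|compatible_configs tau|)%:R : R) ^+ 2 = ((#|compatible_configs tau| ^ 2)%N)%:R by rewrite natrX.
apply: le_trans (_ : ((\prod_a (type_count (halfedge_type tau) [set: H]%SET a)`!)%N)%:R <= _).
  by rewrite ler_nat.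
rewrite natr_prod.
rewrite (eq_bigr (fun c => ((#|[pred h | halfedge_type tau h == c]|)`!)%:R)); last first.
  by move=> c _; congr (_`!)%:R; apply: eq_card => h; rewrite !inE.
apply: le_trans h2 _.
rewrite -/P /type_factor !mulrA ler_wpM2r // ler_wpM2r ?exprn_ge0 ?mulr_ge0 ?expR_ge0 //.
by rewrite mulrC -natrX -natrM ler_nat heven.
Qed.

(** Equals n (d/2 H(edge) - H(star)), with n the number of vertices. *)
Definition star_gap (tau : {ffun V -> star}) : R :=
  \sum_v ln (density R tau (tau v)) -
  2^-1 * \sum_v \sum_i ln (density R (halfedge_type tau) ((tau v).1, (tau v).2 i)).

Lemma card_compatible_gap tau (c : R) : (#|V|)%:R * c <= star_gap tau ->
  (#|compatible_configs tau|)%:R <= (#|configs V d|)%:R * type_factor *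
    expR (- ((#|V|)%:R * c)) * \prod_v density R tau (tau v).
Proof.
move=> gap; have i0 : 'I_d by exists 0%N.
set D := \prod_v _.
have D0 : 0 < D by rewrite prodr_gt0 // => v _; exact: density_gt0.
have Q1 := type_factor_ge1; have Q0 : 0 < type_factor by exact: lt_le_trans Q1.
have e0 := expR_gt0 (- ((#|V|)%:R * c) : R).
rewrite -(@ler_pXn2r _ 2) // ?nnegrE //; last by rewrite !mulr_ge0 // ltW.
apply: le_trans (card_compatible_configs tau) _.
set P := \prod_h _.
have P_gt0 : 0 < P by rewrite prodr_gt0 // => h _; exact: (density_gt0 R (v0, i0)).
have hP : P <= (expR (- ((#|V|)%:R * c)) * D) ^+ 2.
  rewrite -ler_ln ?posrE ?exprn_gt0 ?mulr_gt0 //.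
  rewrite lnXn ?mulr_gt0 // lnM ?posrE // expRK /P /D.
  rewrite !ln_prod; [|by move=> v; exact: density_gt0|by move=> h; exact: (density_gt0 R (v0, i0))].
  have := gap; rewrite /star_gap pair_big /=.
  have -> : \sum_(p : V * 'I_d) ln (density R (halfedge_type tau) ((tau p.1).1, (tau p.1).2 p.2)) =
    \sum_h ln (density R (halfedge_type tau) (halfedge_type tau h)) by [].
  rewrite -mulr_natl; lra.
move: type_factor Q1 Q0 => Q Q1 Q0; move: (expR _) hP e0 => e hP e0.
have -> : ((#|configs V d|)%:R * Q * e * D) ^+ 2 =
  (#|configs V d|)%:R ^+ 2 * (Q * (Q * (e * D) ^+ 2)) by ring.
rewrite ler_wpM2l ?exprn_ge0 // ler_pM2l //; apply: le_trans hP _.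
by rewrite ler_peMl // exprn_ge0 // mulr_ge0 // ltW.
Qed.

Variable BG : pred {set V * V}.
Variable c : R.
Hypothesis gapBG : forall m, simple_config m -> BG (graph_of m) ->
  exists g : V -> S, (#|V|)%:R * c <= star_gap [ffun v => star_type m g v].

(** Union bound: a bad configuration is compatible with the assignment of stars read off from its
    labeling, and the densities of all assignments sum to a polynomial. *)
Lemma card_bad_simple_configs :
  (#|[set m : {perm H} | simple_config m && BG (graph_of m)]|)%:R <=
  (#|configs V d|)%:R * type_factor * expR (- ((#|V|)%:R * c)) * (#|V|.+1%:R) ^+ #|{: star}| :> R.
Proof.
pose B := [pred tau : {ffun V -> star} | (#|V|)%:R * c <= star_gap tau].
apply: le_trans (_ : \sum_(tau | B tau) (#|compatible_configs tau|)%:R <= _).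
  rewrite -natr_sum ler_nat -sum1_card.
  have -> : (\sum_(tau | B tau) #|compatible_configs tau| =
      \sum_(m : {perm H}) \sum_(tau | B tau) (m \in compatible_configs tau))%N.
    rewrite exchange_big /=; apply: eq_bigr => tau _.
    by rewrite -sum1_card big_mkcond /=; apply: eq_bigr => m _; case: (_ \in _).
  rewrite big_mkcond /=; apply: leq_sum => m _; rewrite inE; case: ifP => // /andP[sm bm].
  have [g hg] := gapBG sm bm.
  rewrite (bigD1 [ffun v => star_type m g v]) //=.
  suff -> : m \in compatible_configs [ffun v => star_type m g v] by [].
  have [K1 K2 K3] := simple_configP _ sm.
  rewrite inE; apply/matchingP; split=> // [z _|z]; last by rewrite finset.in_setT.
  split; first by rewrite finset.in_setT.
    by apply: contraNneq (K2 z) => ->.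
  rewrite /halfedge_type /swap_pair !ffunE /star_type /= ?ffunE -!surjective_pairing.
  by rewrite K1.
apply: le_trans (_ : \sum_(tau | B tau) (#|configs V d|)%:R * type_factor *
    expR (- ((#|V|)%:R * c)) * \prod_v density R tau (tau v) <= _).
  by apply: ler_sum => tau; exact: card_compatible_gap.
have X0 : 0 <= (#|configs V d|)%:R * type_factor * expR (- ((#|V|)%:R * c)).
  by rewrite !mulr_ge0 ?expR_ge0 // (le_trans ler01) // type_factor_ge1.
rewrite -mulr_sumr ler_wpM2l //; apply: le_trans (sum_prod_density_le R star v0).
rewrite [leRHS](bigID B) /= lerDl sumr_ge0 // => tau _.
by rewrite prodr_ge0 // => v _; exact: density_ge0.
Qed.

Lemma card_bad_graphs : (2 * bad_mean d + 4 * (d * d.+1) < N)%N ->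
  (#|[set E | is_regular_graph d E && BG E]|)%:R <=
  2 * N%:R ^+ (2 * (2 * bad_mean d)) * type_factor * (#|V|.+1%:R) ^+ #|{: star}| *
  expR (- ((#|V|)%:R * c)) * (#|[set E : {set V * V} | is_regular_graph d E]|)%:R :> R.
Proof.
move=> /card_configs_le; rewrite nearly_simple0.
have E1 := @card_simple_graphs V d predT.
have E2 := @card_simple_graphs V d BG.
have -> : #|[set m : {perm H} | simple_config m]| =
    (#|[set E : {set V * V} | is_regular_graph d E]| * d`! ^ #|V|)%N.
  have -> : #|[set m : {perm H} | simple_config m]| =
     #|[set m : {perm H} | simple_config m && predT (graph_of m)]|.
    by apply: eq_card => m; rewrite !inE andbT.
  rewrite E1; congr (_ * _)%N.
  by apply: eq_card => E; rewrite !inE andbT.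
rewrite -(ler_nat R) => hC.
have f0 : 0 < ((d`! ^ #|V|)%N)%:R :> R by rewrite ltr0n expn_gt0 fact_gt0.
have hB := card_bad_simple_configs; rewrite E2 natrM in hB.
rewrite -(ler_pM2r f0); apply: le_trans hB _.
set X := type_factor; set Y := expR _; set Z := _ ^+ #|{: star}|.
have X0 : 0 <= X * Y * Z.
  rewrite mulr_ge0 ?exprn_ge0 // mulr_ge0 ?expR_ge0 //.
  by rewrite (le_trans ler01) // type_factor_ge1.
move: X Y Z X0 => X Y Z X0.
have -> : (#|configs V d|)%:R * X * Y * Z = (#|configs V d|)%:R * (X * Y * Z) by rewrite !mulrA.
apply: le_trans (ler_wpM2r X0 hC) _.
rewrite !natrM natrX le_eqVlt; apply/orP; left; apply/eqP; ring.
Qed.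

End GraphCounting.

(** * The first moment bound *)

Section UniformGap.
Variables (R : realType) (d : nat) (hd : 3 <= d) (S : finType) (hS : 1 < #|S|).
Variable M : S -> S -> nat.
Hypotheses (hM : forall s : S, \sum_(q : S) M s q = d) (hconn : digraph_connected M).
Local Open Scope ring_scope.
Variables (delta : R -> R) (hdelta : is_delta d M delta).
Hypothesis eps0_gt0 : 0 < eps0 d S delta.
Notation L := (entropy_const R d S).

Let dR : 3 <= d%:R :> R. Proof. by rewrite ler_nat. Qed.

Let lS : ln 2 <= ln (#|S|)%:R :> R.
Proof. by rewrite ler_ln ?posrE // ?ltr0n ?ler_nat //; apply: ltnW. Qed.

Let L_ge : 1 / 2 <= L.
Proof.
have := dR; have := lS; have := @ln_ge_sub1V R 2 ltac:(lra) => h1 h2 h3.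
rewrite /entropy_const; apply: (@le_trans _ _ (ln (#|S|)%:R)); first by lra.
by rewrite ler_peMr //; [lra | rewrite ler_pdivlMr; lra].
Qed.

Section Bounds.
Variables (V : finType) (v0 : V) (adj : rel V) (g : {ffun V -> S}).
Hypotheses (adjC : symmetric adj) (adj_reg : forall v, #|[pred w | adj v w]| = d).
Notation x := (error adj M g : R).
Hypothesis xe : x < eps0 d S delta.

Lemma error_ge0 : 0 <= x.
Proof. by rewrite /error divr_ge0. Qed.

Lemma positive_error_bounds : 0 < x ->
  [/\ 0 < delta x, forall s, delta x <= density R g s, delta x <= 1 / 2 &
      x + 2 * Num.sqrt (x * L) < delta x ^+ d].
Proof.
move=> x0; have [del0 dp] := delta_below_eps0 hd hdelta x0 xe.
have ne := below_eps0_nonconst hd hS hM hconn hdelta v0 adjC adj_reg eps0_gt0 xe.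
have dens := delta_property_density v0 adjC adj_reg dp ne.
split=> //; last by have := below_eps0 x0 xe; rewrite mulrC; lra.
have [s [q sq]] : exists s q : S, s != q.
  have /card_gt1P[s [q [_ _ sq]]] : (1 < #|(predT : pred S)|)%N by rewrite (eq_card (B := S)).
  by exists s, q.
have := sum_density R v0 g; rewrite (bigD1 s) //= (bigD1 q) 1?eq_sym //=.
have : 0 <= \sum_(i | (i != s) && (i != q)) density R g i.
  by rewrite sumr_ge0 // => i _; exact: density_ge0.
have := dens s; have := dens q; lra.
Qed.

(** If only one of the arcs is present, [q] has density at most (d+1) x. At x = 0 this contradicts
    surjectivity of perfect coverings. Otherwise delta(x) is at most (d+1) x, while 4 x L <
    delta(x)^(2d) with L at least 1/2 and delta(x) at most 1/2; these are incompatible. Undirected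
    connectivity thus becomes directed. *)
Lemma support_symmetric s q : (0 < M q s)%N -> (0 < M s q)%N.
Proof.
move=> Mqs; rewrite lt0n; apply/eqP => Msq.
have dq := density_asym R v0 g adjC adj_reg Mqs Msq.
have := error_ge0; rewrite le_eqVlt => /orP[/eqP x0|x0].
  have [v gv] := perfect_covering_onto hd hS hM hconn hdelta v0 adjC adj_reg eps0_gt0 (esym x0) q.
  have := density_gt0 R v0 g v; rewrite gv.
  by move: dq; rewrite -x0 mulr0 => /le_lt_trans h /h; rewrite ltxx.
have [del0 dens del1 lt] := positive_error_bounds x0.
have hdq := le_trans (dens q) dq.
have sq0 := sqrtr_ge0 (x * L).
have xL : x * L = Num.sqrt (x * L) ^+ 2 by rewrite sqr_sqrtr // mulr_ge0 ?error_ge0 // (le_trans _ L_ge).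
have d2 : (d = d.-1.+1)%N by rewrite prednK // (leq_trans _ hd).
have p1 : 2 * Num.sqrt (x * L) < delta x ^+ d by have := error_ge0; lra.
have p2 : 4 * (x * L) < delta x ^+ (d * 2).
  have -> : 4 * (x * L) = (2 * Num.sqrt (x * L)) ^+ 2 by rewrite exprMn -xL -natrX.
  by rewrite exprM ltrXn2r ?nnegrE ?mulr_ge0 // exprn_ge0 // ltW.
have p3 : 2 * x < delta x ^+ (d * 2).
  by apply: le_lt_trans p2; have := error_ge0; have := L_ge => h1 h2; nra.
have p4 : delta x ^+ (d * 2) <= delta x * (1 / 2) ^+ (d * 2).-1.
  have -> : (d * 2 = (d * 2).-1.+1)%N by rewrite prednK // muln_gt0 d2.
  move: (d * 2).-1 => k /=; rewrite exprS ler_wpM2l ?(ltW del0) //.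
  by apply: lerXn2r; rewrite ?nnegrE ?(ltW del0) //; lra.
have p5 : (d.+1)%:R * (1 / 2) ^+ (d * 2).-1 <= 2 :> R.
  rewrite expr_div_n expr1n mul1r ler_pdivrMr ?exprn_gt0 // -natrX -natrM ler_nat.
  have d_lt : (d < 2 ^ d)%N by exact: ltn_expl.
  apply: leq_trans d_lt _; apply: (@leq_trans (2 ^ (d * 2).-1)); last by rewrite leq_pmull.
  by rewrite leq_exp2l // muln2 -addnn d2 addSn /= leq_addl.
have p6 : delta x * (1 / 2) ^+ (d * 2).-1 <= 2 * x.
  apply: (@le_trans _ _ (d.+1%:R * x * (1 / 2) ^+ (d * 2).-1)).
    by rewrite ler_pM2r // exprn_gt0 //; lra.
  by rewrite mulrAC ler_pM2r.
by have := lt_le_trans p3 (le_trans p4 p6); rewrite ltxx.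
Qed.

(** Some label has density at least [1 / #|S|], and a path of at most [#|S|] arcs leads from it to
    [q]. The bound does not involve the value of [delta]. *)
Lemma density_lower q : ((#|S|)%:R * d%:R ^+ #|S|)^-1 - 2 * x <= density R g q.
Proof.
have S0 : 0 < (#|S|)%:R :> R by rewrite ltr0n ltnW.
have d0 : 0 < d%:R :> R by have := dR; lra.
have [s hs] : exists s, (#|S|)%:R^-1 <= density R g s.
  apply/existsP; apply: contraT; rewrite negb_exists => /forallP all.
  have : \sum_s density R g s < \sum_(s : S) (#|S|)%:R^-1.
    have [s0 _] : exists s0 : S, true by have /card_gt0P[s0 _] := ltnW hS; exists s0.
    rewrite (bigD1 s0) //= [ltRHS](bigD1 s0) //= ltr_leD //; first by rewrite ltNge.
    by apply: ler_sum => s _; rewrite ltW // ltNge.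
  by rewrite (sum_density R v0) sumr_const -[_ *+ _]mulr_natl mulfV ?gt_eqF // ltxx.
have e' : connect (fun a b => 0 < M a b)%N s q.
  apply: connect_sub (hconn s q) => a b /orP[ab|ba]; apply: connect1 => //.
  exact: support_symmetric.
have /connectP[p0 + ->] := e'; case/shortenP => p pp up _.
have sp : (size p <= #|S|)%N.
  by have := max_card (mem (s :: p)); rewrite (card_uniqP up) => /ltnW.
have d1 : (1 < d)%N by exact: leq_trans hd.
apply: le_trans (density_path R v0 g adjC adj_reg d1 pp).
rewrite lerD2r invfM; apply: ler_pM; rewrite ?invr_ge0 ?exprn_ge0 ?ler0n //.
rewrite lef_pV2 ?posrE ?exprn_gt0 //.
by rewrite ler_weXn2l // ler1n ltnW.
Qed.

End Bounds.

Notation gap_factor := ((d%:R - 2) / (2 * (d%:R - 1)) : R).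

(** The constant must serve all finite graphs at once. Errors above a threshold [xi1] are used as
    [xi] themselves, with densities bounded by [delta]; smaller ones, 0 included, are replaced by
    [xi1], with densities bounded by [density_lower]. *)
Lemma uniform_gap (s q : S) : exists2 c : R, 0 < c &
  forall (V : finType) (v0 : V) (adj : rel V) (g : {ffun V -> S}),
  symmetric adj -> (forall v, #|[pred w | adj v w]| = d) ->
  error adj M g < eps0 d S delta ->
  exists2 xi : R, [/\ 0 < xi, xi <= 1 / 2 & error adj M g <= xi] &
    c <= gap_core gap_factor (ln (#|S|)%:R) (density R g s * density R g q ^+ d.-1) xi.
Proof.
have age : 1 / 4 <= gap_factor by have := dR => h; rewrite ler_pdivlMr; lra.
have ale : gap_factor <= 1 / 2 by have := dR => h; rewrite ler_pdivrMr; lra.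
have a0 : 0 < gap_factor by lra.
have aL : gap_factor * L = ln (#|S|)%:R / 2.
  by have := dR => h; rewrite /entropy_const; field; apply/andP; split; lra.
have L0 : 0 < L by have := L_ge; lra.
pose c0 : R := ((#|S|)%:R * d%:R ^+ #|S|)^-1.
have c00 : 0 < c0.
  by rewrite invr_gt0 mulr_gt0 ?exprn_gt0 ?ltr0n //; [exact: ltnW | exact: leq_trans hd].
have dS : (d = d.-1.+1)%N by rewrite prednK // (leq_trans _ hd).
pose y0 := (c0 / 2) ^+ d.
have y00 : 0 < y0 by rewrite exprn_gt0 // divr_gt0.
have [xi0 xi00 small] := gap_core_small age ale lS y00.
(* The bound [c0 / 4] keeps [c0 - 2 * x] above [c0 / 2], hence the product of densities above
   [y0]. *)
pose xi1 := Num.min (Num.min xi0 (1 / 2)) (c0 / 4).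
have xi10 : 0 < xi1 by rewrite !lt_min xi00 /=; apply/andP; split; lra.
pose kap : R := Num.sqrt xi1 * (ln 2 / (8 * Num.sqrt L)).
have kap0 : 0 < kap.
  by rewrite mulr_gt0 ?sqrtr_gt0 // divr_gt0 ?ln2_gt0 // mulr_gt0 ?sqrtr_gt0.
exists (Num.min kap (gap_factor * y0 / 2)).
  by rewrite lt_min kap0 divr_gt0 // mulr_gt0.
move=> V v0 adj g adjC adj_reg xe; set x := error adj M g in xe *.
have [xs|xl] := leP x xi1.
  exists xi1; first by split=> //; rewrite /xi1 !ge_min lexx ?orbT.
  rewrite ge_min; apply/orP; right; apply: small => //; first by rewrite /xi1 !ge_min lexx.
  have dens t : c0 / 2 <= density R g t.
    have := density_lower v0 adjC adj_reg xe t; rewrite -/c0 -/x.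
    have : xi1 <= c0 / 4 by rewrite /xi1 ge_min lexx orbT.
    lra.
  have cge : 0 <= c0 / 2 by lra.
  rewrite /y0 [X in _ ^+ X]dS exprS ler_pM ?exprn_ge0 //.
  by rewrite lerXn2r ?nnegrE // density_ge0.
have x0 : 0 < x by exact: lt_trans xl.
have [del0 dens del1 lt] := positive_error_bounds v0 adjC adj_reg xe x0.
rewrite -/x in dens lt del0 del1.
have sq0 := sqrtr_ge0 (x * L).
(* This gives both [x <= 1 / 2] and the bound [1 / 8] asked for by [gap_core_sqrt]. *)
have d8 : delta x ^+ d <= 1 / 8.
  apply: (@le_trans _ _ ((1 / 2) ^+ d)); first by apply: lerXn2r; rewrite ?nnegrE ?(ltW del0) //; lra.
  rewrite -(subnKC hd) exprD; apply: (@le_trans _ _ ((1 / 2) ^+ 3)); last by lra.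
  by rewrite ger_pMr ?exprn_gt0 // ?exprn_ile1 //; lra.
exists x; first by split=> //; lra.
rewrite ge_min; apply/orP; left.
have y1 : x + 2 * Num.sqrt (x * L) <= density R g s * density R g q ^+ d.-1.
  apply: le_trans (ltW lt) _; rewrite [X in _ ^+ X]dS exprS ler_pM ?exprn_ge0 ?(ltW del0) //.
  by rewrite lerXn2r ?nnegrE ?density_ge0 // ltW.
apply: le_trans (gap_core_sqrt age ale lS aL x0 _ y1 _); [|lra|lra].
rewrite /kap ler_pM2r; first by rewrite ler_wsqrtr // ltW.
by rewrite divr_gt0 ?ln2_gt0 // mulr_gt0 ?sqrtr_gt0.
Qed.

End UniformGap.

(** * Polynomial factors against exponential decay *)

Section Limit.
Variable R : realType.
Local Open Scope ring_scope.

(** The inequality u <= exp u at u = (n+1) c / (D+1), raised to the power D + 1: one power more than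
    needed leaves the factor 1/(n+1). *)
Lemma pow_expR_le (D : nat) (c : R) (n : nat) : 0 < c ->
  n.+1%:R ^+ D * expR (- (n%:R * c)) <= expR c * (D.+1%:R / c) ^+ D.+1 * n.+1%:R^-1.
Proof.
move=> c0; have n0 : 0 < n.+1%:R :> R by rewrite ltr0n.
have D0 : 0 < D.+1%:R :> R by rewrite ltr0n.
have e0 := expR_gt0 (n.+1%:R * c : R).
have -> : - (n%:R * c) = c - n.+1%:R * c by rewrite -natr1; ring.
rewrite expRD expRN mulrCA -mulrA ler_pM2l ?expR_gt0 //.
rewrite ler_pdivlMr // mulrAC -exprSr ler_pdivrMr //.
have h : n.+1%:R * c / D.+1%:R <= expR (n.+1%:R * c / D.+1%:R).
  by apply: le_trans (expR_ge1Dx _); rewrite lerDr.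
have -> : expR (n.+1%:R * c) = expR (n.+1%:R * c / D.+1%:R) ^+ D.+1.
  by rewrite -expRM_natl [D.+1%:R * _]mulrC divfK // gt_eqF.
have ec := divr_gt0 D0 c0; rewrite -exprMn; apply: lerXn2r.
- by rewrite nnegrE ltW.
- by rewrite nnegrE ltW // mulr_gt0 ?expR_gt0.
rewrite -ler_pdivrMl ?divr_gt0 // invf_div; apply: le_trans h.
by rewrite [leLHS]mulrC mulrA.
Qed.

Lemma polynomial_factor_le (d n K A B : nat) :
  2 * (n * d)%:R ^+ K * ((n * d).+1%:R * (expR 1 * (n * d).+1%:R) ^+ A) * n.+1%:R ^+ B <=
  2 * d.+1%:R ^+ (K + A + 1) * expR 1 ^+ A * n.+1%:R ^+ (K + A + 1 + B) :> R.
Proof.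
have h : (n * d).+1%:R <= n.+1%:R * d.+1%:R :> R by rewrite -natrM ler_nat; nia.
have h' : (n * d)%:R <= n.+1%:R * d.+1%:R :> R by rewrite -natrM ler_nat; nia.
have -> : 2 * d.+1%:R ^+ (K + A + 1) * expR 1 ^+ A * n.+1%:R ^+ (K + A + 1 + B) =
  2 * (n.+1%:R * d.+1%:R) ^+ K * ((n.+1%:R * d.+1%:R) * (expR 1 * (n.+1%:R * d.+1%:R)) ^+ A) *
  n.+1%:R ^+ B :> R by rewrite !exprD !expr1 !exprMn; ring.
rewrite ler_wpM2r ?exprn_ge0 // ler_pM ?mulr_ge0 ?exprn_ge0 ?mulr_ge0 ?expR_ge0 //.
  by rewrite ler_wpM2l // lerXn2r ?nnegrE // mulr_ge0.
rewrite ler_pM ?exprn_ge0 ?mulr_ge0 ?expR_ge0 // lerXn2r ?nnegrE ?mulr_ge0 ?expR_ge0 //.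
by rewrite ler_wpM2l ?expR_ge0.
Qed.

End Limit.

Section RandomRegularGraphs.
Variables (R : realType) (d : nat) (hd : 3 <= d) (S : finType) (hS : 1 < #|S|).
Variable M : S -> S -> nat.
Hypotheses (hM : forall s : S, \sum_(q : S) M s q = d) (hconn : digraph_connected M).
Local Open Scope ring_scope.
Variables (delta : R -> R) (hdelta : is_delta d M delta).

(** Two entries of a row that are both at least [d - 1] sum to more than [d]. *)
Lemma exists_small_multiplicity (s : S) : exists q, (M s q <= d - 2)%N.
Proof.
apply/existsP; apply: contraT; rewrite negb_exists => /forallP all.
have /card_gt1P[a [b [_ _ ab]]] : (1 < #|(predT : pred S)|)%N by rewrite (eq_card (B := S)).
have := hM s; rewrite (bigD1 a) //= (bigD1 b) 1?eq_sym //=.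
have := all a; have := all b; rewrite -!ltnNge.
move: hd (M s a) (M s b) (\sum_(i | _) _) => d3 x y z; lia.
Qed.

Lemma error_le1 (V : finType) (adj : rel V) (g : {ffun V -> S}) : error adj M g <= 1 :> R.
Proof.
rewrite /error; have [->|V0] := posnP #|V|; first by rewrite invr0 mulr0.
by rewrite ler_pdivrMr ?ltr0n // mul1r ler_nat max_card.
Qed.

Lemma covering_error_ratio_lt (V : finType) (adj : rel V) (eps : R) :
  covering_error_ratio adj M < eps -> exists g : {ffun V -> S}, error adj M g < eps.
Proof.
move=> h; apply: contrapT => none; move: h; apply/negP; rewrite -leNgt.
have ge g : eps <= error adj M g by rewrite leNgt; apply/negP => lt; apply: none; exists g.
have [s0 _] : exists s0 : S, true by have /card_gt0P[s0 _] := ltnW hS; exists s0.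
rewrite /covering_error_ratio; elim/big_ind: _ => //.
  exact: le_trans (ge [ffun=> s0]) (error_le1 _ _).
by move=> a b ha hb; rewrite le_min ha hb.
Qed.

Variables (eps : R) (heps : 0 < eps) (heps0 : eps < eps0 d S delta).

Lemma prob_ratio_lt_exp_bound : exists C c : R, exists D n0 : nat, [/\ 0 <= C, 0 < c &
  forall n, (n0 <= n)%N ->
  prob_ratio_lt d M eps n <= C * (n.+1%:R ^+ D * expR (- (n%:R * c)))].
Proof.
have eps00 : 0 < eps0 d S delta by exact: lt_trans heps0.
have [s0 _] : exists s0 : S, true by have /card_gt0P[s0 _] := ltnW hS; exists s0.
have [q0 Mq] := exists_small_multiplicity s0.
have [c c0 gap] := uniform_gap hd hS hM hconn hdelta eps00 s0 q0.
pose K := (2 * (2 * bad_mean d))%N.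
pose A := #|{: S * S}|.
pose B := #|{: S * {ffun 'I_d -> S}}|.
exists (2 * d.+1%:R ^+ (K + A + 1) * expR 1 ^+ A), c, (K + A + 1 + B)%N.
exists (2 * bad_mean d + 4 * (d * d.+1)).+1.
have d0 : (0 < d)%N by exact: leq_trans hd.
split=> // n nbig; have v0 : 'I_n by exists 0%N; rewrite (leq_trans _ nbig).

pose BG : pred {set 'I_n * 'I_n} := fun E => covering_error_ratio (edge_rel E) M < eps.
have gapBG (m : {perm 'I_n * 'I_d}) : simple_config m -> BG (graph_of m) ->
    exists g : 'I_n -> S, (#|'I_n|)%:R * c <= star_gap R [ffun v => star_type m g v].
  move=> sm /covering_error_ratio_lt[g hg]; exists g.
  have /regular_graphP[sym _ deg] := graph_of_regular sm.
  have [K1 K2 K3] := simple_configP _ sm.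
  have adjC : symmetric (edge_rel (graph_of m)) by move=> x y; rewrite /edge_rel sym.
  have [xi [xi0 xi1 exi] hxi] := gap _ v0 (edge_rel (graph_of m)) g adjC deg (lt_trans hg heps0).
  pose tau : {ffun 'I_n -> S * {ffun 'I_d -> S}} := [ffun v => star_type m g v].
  have mt h : halfedge_type tau (m h) = ((halfedge_type tau h).2, (halfedge_type tau h).1).
    rewrite /halfedge_type !ffunE /star_type /= ?ffunE -!surjective_pairing.
    by rewrite K1.
  have bad : (#|[pred v | ~~ star_covering M (tau v)]|)%:R <= xi * (#|'I_n|)%:R :> R.
    have nR : 0 < (#|'I_n|)%:R :> R by rewrite ltr0n card_ord; lia.
    rewrite -ler_pdivrMr //; apply: le_trans exi; rewrite /error le_eqVlt.
    apply/orP; left; apply/eqP; congr (_%:R / _); apply: eq_card => v; rewrite !inE ffunE.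
    rewrite asbool_neg; congr (~~ _); apply/idP/asboolP => h.
      exact/(star_type_covering M g v sm).
    exact/(star_type_covering M g v sm).
  have := @star_entropy_gap R _ S d v0 s0 hd tau m K1 mt M s0 q0 xi xi0 xi1 Mq bad.
  apply: le_trans; rewrite ler_wpM2l //; apply: le_trans hxi _.
  rewrite le_eqVlt; apply/orP; left; apply/eqP; congr gap_core.
  have E t : density R g t = density R (fun v => (tau v).1) t.
    by rewrite /density; congr (_%:R / _); apply: eq_card => v; rewrite !inE ffunE.
  by rewrite !E.
have Nbig : (2 * bad_mean d + 4 * (d * d.+1) < #|{: 'I_n * 'I_d}|)%N.
  by rewrite card_prod !card_ord; apply: leq_trans nbig _; rewrite leq_pmulr.
have := card_bad_graphs v0 d0 gapBG Nbig.
have -> : #|[set E | is_regular_graph d E && BG E]| =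
    #|[set E in regular_graphs d n | covering_error_ratio (edge_rel E) M < eps]%SET|.
  by apply: eq_card => E; rewrite !inE.
have -> : #|[set E : {set 'I_n * 'I_n} | is_regular_graph d E]| = #|regular_graphs d n|.
  by apply: eq_card => E; rewrite !inE.
have NE : #|{: 'I_n * 'I_d}| = (n * d)%N by rewrite card_prod !card_ord.
rewrite /type_factor NE !card_ord -/K -/A -/B => bound.
(* Without regular graphs on [n] vertices the quotient is 0 by convention. *)
rewrite /prob_ratio_lt; have [G0|G0] := posnP #|regular_graphs d n|.
  by rewrite G0 invr0 mulr0 !mulr_ge0 ?exprn_ge0 ?expR_ge0.
rewrite ler_pdivrMr ?ltr0n //; apply: le_trans bound _.
rewrite ler_wpM2r // [leRHS]mulrA ler_wpM2r ?expR_ge0 //.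
exact: polynomial_factor_le.
Qed.

End RandomRegularGraphs.

Local Open Scope classical_set_scope.
Local Open Scope ring_scope.

Theorem theorem6 (R : realType) (d : nat) (hd : (3 <= d)%N)
    (S : finType) (hS : (1 < #|S|)%N) (M : S -> S -> nat)
    (hM : forall s : S, (\sum_(q : S) M s q)%N = d)
    (hconn : digraph_connected M)
    (delta : R -> R) (hdelta : is_delta d M delta)
    (eps : R) (heps : 0 < eps) (heps0 : eps < eps0 d S delta) :
  (prob_ratio_lt d M eps i @[i --> \oo] --> (0 : R))%classic.
Proof.
have [C [c [D [n0 [C0 c0 bound]]]]] := prob_ratio_lt_exp_bound hd hS hM hconn hdelta heps heps0.
pose K := C * (expR c * (D.+1%:R / c) ^+ D.+1).
apply: (@squeeze_cvgr _ _ _ _ (fun=> 0) (fun n => K * harmonic n)); last 2 first.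
- exact: cvg_cst.
- by rewrite -[X in _ --> X](mulr0 K); apply: cvgMl_tmp; exact: cvg_harmonic.
exists n0 => // n /= nn0; apply/andP; split; first by rewrite /prob_ratio_lt divr_ge0.
apply: le_trans (bound n nn0) _.
by rewrite /K -mulrA ler_wpM2l // pow_expR_le.
Qed.
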